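(* Every graph with chromatic number $5$ and girth at least $5$ has at least $29$ vertices.
   Context: All graphs are finite, simple and undirected. The girth of a graph is the length of its shortest cycle (a graph with no cycles has girth at least $5$ by convention). *)

(* Defs.v *)
From mathcomp Require Import all_boot.
Set Implicit Arguments. Unset Strict Implicit. Unset Printing Implicit Defensive.

Definition simple_graph (T : finType) (e : rel T) : Prop :=
  symmetric e /\ irreflexive e.

Definition colorable (T : finType) (e : rel T) (k : nat) : bool :=
  [exists c : {ffun T -> 'I_k}, [forall x, forall y, e x y ==> (c x != c y)]].

Lemma colorable_card (T : finType) (e : rel T) :
  irreflexive e -> exists k, colorable e k.
Proof.
move=> irr; exists #|T|; apply/existsP; exists [ffun x => enum_rank x].
apply/forallP => x; apply/forallP => y; apply/implyP => exy.
rewrite !ffunE; apply/negP => /eqP /enum_rank_inj xy.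
by rewrite xy irr in exy.
Qed.

(* chromatic number: least k admitting a proper k-colouring.
   (The disjunct only makes the definition total for relations with loops,
   which are not graphs; for irreflexive e it is exactly min{k | colorable e k}.) *)
Definition chi_pred (T : finType) (e : rel T) (k : nat) : bool :=
  colorable e k || ~~ [forall x, ~~ e x x].

Lemma chi_pred_ex (T : finType) (e : rel T) : exists k, chi_pred e k.
Proof.
case: (boolP [forall x, ~~ e x x]) => H; last by exists 0; rewrite /chi_pred H orbT.
have irr : irreflexive e by move=> x; apply/negbTE; move/forallP: H.
by case: (colorable_card irr) => k Hk; exists k; rewrite /chi_pred Hk.
Qed.

Definition chromatic_number (T : finType) (e : rel T) : nat :=
  ex_minn (chi_pred_ex e).

Definition has_cycle_of_length (T : finType) (e : rel T) (n : nat) : Prop :=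
  exists s : seq T, [/\ 3 <= n, size s = n, uniq s & cycle e s].

(* girth >= g: every cycle has length at least g (vacuous for forests,
   matching the convention that acyclic graphs have girth >= 5). *)
Definition girth_at_least (T : finType) (e : rel T) (g : nat) : Prop :=
  forall n, has_cycle_of_length e n -> g <= n.

(* Main.v *)
(** A vertex-minimal counterexample G has at most 28 vertices, minimum degree at least 4 and, as girth 5
    bounds the sum of the degrees over each neighbourhood by 27, maximum degree at most 6. Write [n -> k] if
    any [n] vertices contain [k] independent ones. Removing closed neighbourhoods gives 3 -> 2, 6 -> 3,
    8 -> 4, 11 -> 5, 15 -> 6 and 18 -> 7, where the last step reduces by counting to a few degree patterns
    that a search excludes, and then 23 -> 8. Hence G has two disjoint independent sets with a complement O
    of at most 12 vertices (if G is 5-regular, the first of them consists of the eight neighbours of an edge).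

    Choose the two sets so that |O|, then the number of edges in O, is minimal, and then the sum of
    2^(degree in O) over O is maximal. A vertex w of O has neighbours in both sets. If y is its only neighbour
    in one of them, exchanging w and y shows that y has at least as many further neighbours in O as w has;
    they form with w a "line" of vertices that pairwise have distance more than 2 in O. Moreover, whenever w
    joins one of the sets and its neighbours there are kicked out, O - w together with them must not become
    bipartite, for otherwise G would be 4-colourable. Since the degrees in G are at most 6, most vertices of O
    have such private neighbours, and lines meet in at most one vertex. Enumerating the graphs O of girth 5 on
    at most 12 vertices leaves only those in which a pentagon is a component and the rest is bipartite; there the
    ten kicks at the pentagon need ten distinct pairs outside of it, but only nine are available. *)

Require Import Defs.
From mathcomp Require Import all_boot zify.
Set Implicit Arguments. Unset Strict Implicit. Unset Printing Implicit Defensive.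

(** Two independent classes take two colours, so a 4-colouring exists as soon as the complement [O]
    is bipartite; everything therefore turns on odd cycles in a graph on at most 12 vertices. The
    size 12 also makes [O] sparse: a vertex with four neighbours in [O] would have two lines of four
    vertices each, all far from it, besides a degree sum of at least four around it, and [far_card]
    keeps the total below 12. The tie-breaking by edges and potential has no direct bearing on
    colourings; it gives the exchange of [w] and [y] a direction and so turns every private
    neighbour into a long line, which the kicks then have to split. As to the values [n -> k], the
    minimum degree forced by the previous value usually comes into conflict with the Moore bound; at
    18 it does not, as minimum degree 3 needs only 10 vertices, hence the search there. The tests on
    [O] are one-sided: they may let through too much but never discard a graph that could be [O], so
    only their rejections need a proof. *)

Definition girth5 (T : finType) (e : rel T) :=
  [/\ symmetric e, irreflexive e,
      forall x y z, e x y -> e y z -> e x z = false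
    & forall x z y t, x != z -> e x y -> e z y -> e x t -> e z t -> y = t].

(** A cycle shorter than 5 is a triangle or a 4-cycle; excluding both locally gives a condition that
    passes to induced subgraphs at once. *)
Lemma girth5P (T : finType) (e : rel T) :
  simple_graph e -> girth_at_least e 5 -> girth5 e.
Proof.
case=> es ei g; split=> // [x y z xy yz|x z y t xz xy zy xt zt].
  apply/negP=> xz; suff: 5 <= 3 by [].
  apply: g; exists [:: x; y; z]; split=> //=.
    rewrite !inE andbT negb_or -andbA; apply/and3P.
    by split; apply/eqP => h; subst; [rewrite ei in xy|rewrite ei in xz|rewrite ei in yz].
  by rewrite xy yz es xz.
apply/eqP/negPn/negP=> yt; suff: 5 <= 4 by [].
apply: g; exists [:: x; y; z; t]; split=> //=.
  rewrite !inE !negb_or xz yt !andbT -!andbA /=.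
  by apply/and4P; split; apply/eqP => h; subst; [rewrite ei in xy|rewrite ei in xt
    |rewrite ei in zy|rewrite ei in zt].
by rewrite xy (es y) zy zt es xt.
Qed.

(** * Independent sets in graphs of girth 5 *)

Section Graph.
Variables (T : finType) (e : rel T).
Hypothesis g5 : girth5 e.
Implicit Types (S I J : {set T}) (u v w x y z : T).

Let es : symmetric e. Proof. by case: g5. Qed.
Let ei : irreflexive e. Proof. by case: g5. Qed.
Let tri x y z : e x y -> e y z -> e x z = false. Proof. by case: g5 => _ _ + _; apply. Qed.
Let C4 x z y t : x != z -> e x y -> e z y -> e x t -> e z t -> y = t.
Proof. by case: g5 => _ _ _; apply. Qed.

Definition nb v := [set u | e v u].
Definition indep I := [forall x in I, forall y in I, ~~ e x y].
Definition deg S v := #|nb v :&: S|.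
Definition alpha_ge k S := exists I, [/\ I \subset S, indep I & k <= #|I|].
Definition Ramsey n k := forall S, n <= #|S| -> alpha_ge k S.

Lemma in_nb v u : (u \in nb v) = e v u. Proof. by rewrite inE. Qed.

Lemma indepP I : reflect {in I &, forall x y, ~~ e x y} (indep I).
Proof.
apply: (iffP forall_inP) => [h x y xI yI|h x xI].
  by move/forall_inP: (h x xI); apply.
by apply/forall_inP => y yI; apply: h.
Qed.

Lemma indepS I J : I \subset J -> indep J -> indep I.
Proof. by move/subsetP=> s /indepP h; apply/indepP=> x y /s xJ /s; apply: h. Qed.

Lemma indep_nb v : indep (nb v).
Proof. by apply/indepP=> x y; rewrite !in_nb es => /tri h /h ->. Qed.

Lemma alpha_sub k S S' : S \subset S' -> alpha_ge k S -> alpha_ge k S'.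
Proof. by move=> s [I [sI iI kI]]; exists I; split=> //; apply: subset_trans s. Qed.

Lemma alpha_nb k S v : k <= deg S v -> alpha_ge k S.
Proof.
by move=> h; exists (nb v :&: S); split; rewrite ?subsetIr //; apply: indepS (indep_nb v); apply: subsetIl.
Qed.

Lemma alpha_step k S v : v \in S -> alpha_ge k (S :\: (v |: nb v)) -> alpha_ge k.+1 S.
Proof.
move=> vS [I [sI iI kI]].
have nI x : x \in I -> [/\ x != v, ~~ e v x & x \in S].
  by move/(subsetP sI); rewrite !inE negb_or => /andP[/andP[]].
exists (v |: I); split.
- by rewrite subUset sub1set vS (subset_trans sI) ?subsetDl.
- apply/indepP=> x y; rewrite !in_setU1 => /predU1P[->|xI] /predU1P[->|yI].
  + by rewrite ei.
  + by case: (nI _ yI).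
  + by rewrite es; case: (nI _ xI).
  + exact: (indepP _ iI).
- have vI : v \notin I by apply/negP=> /nI[]; rewrite eqxx.
  by rewrite cardsU1 vI.
Qed.

Lemma card_step S v : v \in S -> #|S| = #|S :\: (v |: nb v)| + (deg S v).+1.
Proof.
move=> vS; rewrite -(cardsID (v |: nb v) S) addnC; congr (_ + _).
rewrite (cardsD1 v) !inE eqxx vS /= add1n; congr _.+1.
rewrite /deg; apply: eq_card => x; rewrite !inE; case: eqP => [->|_] /=; rewrite ?ei //.
by rewrite andbC.
Qed.

Lemma Ramsey_step n k S v : Ramsey n k -> v \in S -> n + deg S v < #|S| -> alpha_ge k.+1 S.
Proof.
by move=> R vS h; apply: (alpha_step vS); apply: R; rewrite (card_step vS) in h; lia.
Qed.

Lemma Ramsey_exact n k : (forall S, #|S| = n -> alpha_ge k S) -> Ramsey n k.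
Proof.
move=> h S nS; have [S' sS' cS'] : exists2 S' : {set T}, S' \subset S & #|S'| = n.
  have [m mS] := ubnP #|S|; elim: m S mS nS => // m IH S mS nS.
  have [eq|ne] := eqVneq #|S| n; first by exists S.
  have [x xS] : exists x, x \in S by apply/set0Pn; rewrite -card_gt0; lia.
  have c := cardsD1 x S; rewrite xS in c.
  case: (IH (S :\ x)); [lia|lia|] => S' s c'.
  by exists S' => //; apply: subset_trans s (subsetDl _ _).
exact: alpha_sub sS' (h _ cS').
Qed.

(** Replacing [v] by [u] in the neighbourhood of each neighbour [u] yields a set [F u] of [deg S u]
    vertices. Without triangles and 4-cycles these sets are disjoint, and none of them contains [v]:
    this is the Moore bound for radius 2. *)
Lemma deg_nb_sum S v : v \in S -> \sum_(u in nb v :&: S) deg S u < #|S|.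
Proof.
move=> vS; pose F u := if u \in nb v :&: S then u |: ((nb u :&: S) :\ v) else set0.
have inF u x : x \in F u -> [/\ u \in nb v, x != v & x = u \/ e u x].
  rewrite /F; case: ifP; rewrite ?inE // => /andP[vu uS] /orP[/eqP->|/and3P[xv ux xS]].
    by split; [|apply: contraTneq vu => ->; rewrite ei|left].
  by split; [| |right].
have dF u u' : u != u' -> [disjoint F u & F u'].
  move=> uu'; apply/pred0P => x /=; apply/negP=> /andP[/inF[vu xv h] /inF[vu' _ h']].
  rewrite !in_nb in vu vu'.
  case: h h' => [?|ux] [?|u'x]; subst.
  - by rewrite eqxx in uu'.
  - by move: (tri vu' u'x); rewrite vu.
  - by move: (tri vu ux); rewrite vu'.
  - have := C4 uu' _ _ ux u'x => /(_ v); rewrite !(es _ v) => /(_ vu vu') h.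
    by rewrite -h eqxx in xv.
have cF u : u \in nb v :&: S -> #|F u| = deg S u.
  move=> uN; rewrite /F uN; move: uN; rewrite !inE => /andP[vu uS].
  rewrite cardsU1 !inE ei /= andbF add1n /deg [RHS](cardsD1 v) !inE es vu vS.
  by [].
have : \sum_(u in nb v :&: S) deg S u = #|\bigcup_u F u|.
  rewrite -sum1_card (partition_disjoint_bigcup addn (fun=> 1) dF) // [RHS](bigID (mem (nb v :&: S))) /=.
  rewrite [X in _ + X]big1 ?addn0 => [|u uN]; last by rewrite /F (negPf uN) big_set0.
  by apply: eq_bigr => u uN; rewrite sum1_card cF.
move->; apply: proper_card; apply/properP; split; last first.
  by exists v => //; apply/bigcupP=> -[u _ /inF[_]]; rewrite eqxx.
apply/bigcupsP=> u _; rewrite /F; case: ifP => [uN|_]; rewrite ?sub0set //.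
rewrite subUset sub1set; move: uN; rewrite inE => /andP[_ ->] /=.
by apply: subset_trans (subsetDl _ _) (subsetIr _ _).
Qed.

(** Handshake: ordered adjacent pairs are split by the ranks of their ends, and swapping the ends
    exchanges the two halves. *)
Lemma deg_sum_even S : ~~ odd (\sum_(v in S) deg S v).
Proof.
have -> : \sum_(v in S) deg S v = \sum_(p : T * T | [&& p.1 \in S, p.2 \in S & e p.1 p.2]) 1.
  rewrite -(pair_big_dep (mem S) (fun x y => (y \in S) && e x y) (fun _ _ => 1)) /=.
  apply: eq_bigr => v vS; rewrite /deg -sum1_card; apply: eq_bigl => y.
  by rewrite !inE andbC.
pose r (p : T * T) := enum_rank p.1 < enum_rank p.2.
rewrite (bigID r) /= [X in _ + X](reindex_inj (h := fun p => (p.2, p.1))) /=; last first.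
  by move=> [a b] [c d] [-> ->].
set A := \sum_(_ | _) _; set B := \sum_(_ | _) _.
suff -> : B = A by rewrite addnn odd_double.
apply: eq_bigl => -[x y] /=; rewrite (es y) /r /=.
case: (x \in S) (y \in S) => -[] //=; case exy: (e x y) => //=.
rewrite -leqNgt leq_eqVlt; case: eqP => // h.
by move: exy; rewrite (enum_rank_inj (val_inj h)) ei.
Qed.

Lemma Ramsey1 : Ramsey 1 1.
Proof.
move=> S /card_gt0P[x xS]; exists [set x]; rewrite sub1set cards1; split=> //.
by apply/indepP=> a b /set1P-> /set1P->; rewrite ei.
Qed.

Lemma Ramsey2 : Ramsey 3 2.
Proof.
apply: Ramsey_exact => S cS; have /card_gt0P[v vS] : 0 < #|S| by rewrite cS.
case: (leqP 2 (deg S v)) => [/alpha_nb //|h]; apply: (Ramsey_step Ramsey1 vS); lia.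
Qed.

Lemma Ramsey3 : Ramsey 6 3.
Proof.
apply: Ramsey_exact => S cS; have /card_gt0P[v vS] : 0 < #|S| by rewrite cS.
case: (leqP 3 (deg S v)) => [/alpha_nb //|h]; apply: (Ramsey_step Ramsey2 vS); lia.
Qed.

End Graph.
Arguments indepP {T e I}.

Section Ramsey.
Variables (T : finType) (e : rel T).
Hypothesis g5 : girth5 e.
Implicit Types (S I J : {set T}) (u v w x y z : T).

Let es : symmetric e. Proof. by case: g5. Qed.
Let ei : irreflexive e. Proof. by case: g5. Qed.
Let tri x y z : e x y -> e y z -> e x z = false. Proof. by case: g5 => _ _ + _; apply. Qed.
Let C4 x z y t : x != z -> e x y -> e z y -> e x t -> e z t -> y = t.
Proof. by case: g5 => _ _ _; apply. Qed.

Local Notation nb := (nb e).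
Local Notation deg := (deg e).
Local Notation alpha_ge := (alpha_ge e).
Local Notation Ramsey := (Ramsey e).

(** Deleting the closed neighbourhood of a vertex of degree below [m] leaves at least [n]
    vertices. *)
Lemma Ramsey_deg n k m S : Ramsey n k -> n + m = #|S| ->
  alpha_ge k.+1 S \/ {in S, forall v, m <= deg S v}.
Proof.
move=> R nm; case: (boolP [exists v in S, deg S v < m]) => [/exists_inP[v vS h]|].
  by left; apply: (Ramsey_step g5 R vS); lia.
by rewrite negb_exists_in => /forall_inP h; right=> v /h; rewrite -leqNgt.
Qed.

Lemma moore S v c d : v \in S -> {in S, forall u, c <= deg S u} -> d <= deg S v -> d * c < #|S|.
Proof.
move=> vS h dv; apply: leq_ltn_trans (deg_nb_sum g5 vS).
apply: (@leq_trans (\sum_(u in nb v :&: S) c)); last first.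
  by apply: leq_sum => u; rewrite inE => /andP[_ /h].
by rewrite sum_nat_const leq_mul2r dv orbT.
Qed.

(** Degree counting only produces a vertex [v] of degree 2 and five vertices [R] away from it. These
    may form a 5-cycle, which has no three independent vertices, so the two neighbours of [v] have
    to be taken into account. *)
Lemma Ramsey4 : Ramsey 8 4.
Proof.
apply: Ramsey_exact => S cS.
have [//|d2] := Ramsey_deg (m := 2) (Ramsey3 g5) (esym cS).
case: (boolP [exists v in S, deg S v == 2]) => [/exists_inP[v vS /eqP dv]|]; last first.
  rewrite negb_exists_in => /forall_inP n2.
  have d3 : {in S, forall v, 3 <= deg S v} by move=> v vS; move: (d2 v vS) (n2 v vS); lia.
  have /card_gt0P[v vS] : 0 < #|S| by rewrite cS.
  by have := moore vS d3 (d3 v vS); rewrite cS.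
set R := S :\: (v |: nb v).
have cR : #|R| = 5 by have := card_step g5 vS; rewrite -/R dv cS; clear; lia.
have RS : R \subset S by apply: subsetDl.
suff : alpha_ge 3 R \/ alpha_ge 4 S by case=> // /(alpha_step g5 vS).
(* If [a] has two neighbours [p], [q] in [R], these share no other neighbour. Either one of them has
   two neighbours among the other three vertices of [R], which are independent together with the
   other one, or some vertex of the three is adjacent to neither. *)
case: (boolP [exists a in nb v :&: S, 2 <= deg R a]) => [/exists_inP[a aN da]|].
  left.
  have [p [q [pq paR]]] : exists p q, p != q /\ [set p; q] \subset nb a :&: R.
    have /card_gt0P[p pN] : 0 < #|nb a :&: R| by apply: ltnW.
    have : 0 < #|(nb a :&: R) :\ p| by move: da; rewrite /deg (cardsD1 p) pN.
    case/card_gt0P=> q; rewrite in_setD1 => /andP[qp qN]; exists p, q; split; first by rewrite eq_sym.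
    by rewrite subUset !sub1set pN qN.
  move: paR; rewrite subUset !sub1set !inE => /andP[/andP[ap /andP[pv pS]] /andP[aq /andP[qv qS]]].
  have pR : p \in R by rewrite !inE pv pS.
  have qR : q \in R by rewrite !inE qv qS.
  have npq : ~~ e p q by apply/negP=> h; move: (tri ap h); rewrite aq.
  pose X := (R :\ p) :\ q.
  have cX : #|X| = 3.
    have q' : q \in R :\ p by rewrite in_setD1 eq_sym pq.
    have h2 := cardsD1 q (R :\ p); have h1 := cardsD1 p R.
    by rewrite pR cR in h1; rewrite q' -/X in h2; clear -h1 h2; lia.
  have two (A : {set T}) z : A \subset X -> z \in R -> A \subset nb z -> 2 <= #|A| ->
     forall t, t \in R -> t != z -> t \notin A -> {in A, forall x, ~~ e t x} -> alpha_ge 3 R.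
    move=> AX zR Az cA t tR tz tA ht; exists (t |: A); split.
    - rewrite subUset sub1set tR; apply: subset_trans AX _.
      by apply: subset_trans (subsetDl _ _) (subsetDl _ _).
    - apply/indepP=> x y; rewrite !in_setU1 => /predU1P[->|xA] /predU1P[->|yA].
      + by rewrite ei.
      + exact: ht.
      + by rewrite es; apply: ht.
      + apply: (indepP (indep_nb g5 z)); exact: (subsetP Az).
    - by rewrite cardsU1 tA.
  have XpqE x : x \in X -> [/\ x != q, x != p & x \in R].
    by rewrite !in_setD1 => /and3P.
  have pX : p \notin X by apply/negP=> /XpqE[]; rewrite eqxx.
  have qX : q \notin X by apply/negP=> /XpqE[]; rewrite eqxx.
  have ap' : a != v by apply: contraTneq aN => ->; rewrite !inE ei.
  have excl x : x \in X -> e p x -> e q x -> False.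
    move=> xX px qx; have /(_ a) := C4 pq px qx; rewrite !(es _ a) => /(_ ap aq) xa.
    have [_ _] := XpqE _ xX; rewrite xa /R !inE negb_or.
    by move: aN; rewrite !inE => /andP[-> _]; rewrite andbF.
  case: (leqP 2 #|X :&: nb p|) => [c2|c2].
    apply: (@two (X :&: nb p) p _ _ _ c2 q) => //; rewrite ?subsetIl ?subsetIr //.
    - by rewrite eq_sym.
    - by rewrite inE (negPf qX).
    - by move=> x; rewrite !inE => /andP[xX px]; apply/negP; apply: excl px; rewrite !inE.
  case: (leqP 2 #|X :&: nb q|) => [c2'|c2'].
    apply: (@two (X :&: nb q) q _ _ _ c2' p) => //; rewrite ?subsetIl ?subsetIr //.
    - by rewrite inE (negPf pX).
    - by move=> x; rewrite !inE => /andP[xX qx]; apply/negP=> px; apply: excl px qx; rewrite !inE.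
  have [x] : exists x, x \in X :\: (nb p :|: nb q).
    apply/set0Pn; rewrite -card_gt0.
    have h := cardsID (nb p :|: nb q) X; rewrite cX setIUr in h.
    have [h' _] := leq_card_setU (X :&: nb p) (X :&: nb q).
    by clear -h h' c2 c2'; lia.
  rewrite in_setD in_setU !in_nb negb_or => /andP[/andP[px qx] xX].
  have [xq xp xR] := XpqE _ xX.
  exists [set x; p; q]; split.
  - by rewrite !subUset !sub1set xR pR qR.
  - apply/indepP=> y z; rewrite !inE -!orbA => /or3P[]/eqP-> /or3P[]/eqP->;
      by rewrite ?ei // ?(es x) // es.
  - by rewrite -setUA cardsU1 cards2 pq !inE negb_or xp xq.
(* Otherwise the neighbours [a], [b] of [v] see at most two of the five vertices of [R]; two
   independent ones among the remaining three form an independent set with [a] and [b]. *)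
rewrite negb_exists_in => /forall_inP h; right.
have /card_gt1P[a [b [aN bN ab]]] : 1 < #|nb v :&: S| by rewrite [#|_|]dv.
have ha := h _ aN; have hb := h _ bN.
have [I [sI iI cI]] : alpha_ge 2 (R :\: (nb a :|: nb b)).
  apply: (Ramsey2 g5); have h1 := cardsID (nb a :|: nb b) R; rewrite cR setIUr in h1.
  have [h2 _] := leq_card_setU (R :&: nb a) (R :&: nb b).
  move: ha hb; rewrite /deg ![nb _ :&: R]setIC => ha hb; clear -h1 h2 ha hb; lia.
have nI x : x \in I -> [/\ ~~ e a x, ~~ e b x, x \in R & x \notin nb v].
  move/(subsetP sI); rewrite in_setD in_setU !in_nb negb_or => /andP[/andP[-> ->] xR]; split=> //.
  by move: xR; rewrite /R in_setD in_setU1 in_nb negb_or => /andP[/andP[]].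
move: (aN) (bN); rewrite !in_setI !in_nb => /andP[va aS] /andP[vb bS].
exists (I :|: [set a; b]); split.
- rewrite subUset; apply/andP; split; last by rewrite subUset !sub1set aS bS.
  by apply/subsetP=> x /nI[_ _ /(subsetP RS)].
- apply/indepP=> x y; rewrite !in_setU !in_set1 => /orP[xI|/orP[]/eqP->] /orP[yI|/orP[]/eqP->].
  + exact: (indepP iI).
  + by rewrite es; case: (nI _ xI).
  + by rewrite es; case: (nI _ xI).
  + by case: (nI _ yI).
  + by rewrite ei.
  + by apply: (indepP (indep_nb g5 v)); rewrite inE.
  + by case: (nI _ yI).
  + by apply: (indepP (indep_nb g5 v)); rewrite inE.
  + by rewrite ei.
- rewrite cardsU cards2 ab; suff -> : I :&: [set a; b] = set0 by rewrite cards0; lia.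
  apply/setP=> x; rewrite !inE; apply/negP=> /andP[/nI[_ _ _ +] /orP[]/eqP xe]; by rewrite xe in_nb ?va ?vb.
Qed.

(** A degree of 4 would need 13 vertices, so a counterexample is 3-regular on 11 vertices, against
    parity. *)
Lemma Ramsey5 : Ramsey 11 5.
Proof.
apply: Ramsey_exact => S cS.
have [//|d3] := Ramsey_deg (m := 3) Ramsey4 (esym cS).
have /card_gt0P[v0 vS0] : 0 < #|S| by rewrite cS.
case: (boolP [exists v in S, 3 < deg S v]) => [/exists_inP[v vS dv]|].
  by have := moore vS d3 dv; rewrite cS.
rewrite negb_exists_in => /forall_inP h.
have := deg_sum_even g5 S; rewrite (eq_bigr (fun=> 3)) ?sum_nat_const ?cS //.
by move=> v vS; apply/eqP; rewrite eqn_leq d3 // andbT leqNgt h.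
Qed.

Lemma Ramsey6 : Ramsey 15 6.
Proof.
apply: Ramsey_exact => S cS.
have [//|d4] := Ramsey_deg (m := 4) Ramsey5 (esym cS).
have /card_gt0P[v vS] : 0 < #|S| by rewrite cS.
by have := moore vS d4 (d4 v vS); rewrite cS.
Qed.

Lemma Ramsey8 : Ramsey 18 7 -> Ramsey 23 8.
Proof.
move=> R7; apply: Ramsey_exact => S cS.
have [//|d5] := Ramsey_deg (m := 5) R7 (esym cS).
have /card_gt0P[v vS] : 0 < #|S| by rewrite cS.
by have := moore vS d5 (d5 v vS); rewrite cS.
Qed.
End Ramsey.

(** * Eighteen vertices contain seven independent ones *)

(** The programs branch with [if] where [||] or [&&] could stand, since call-by-value evaluation
    would compute both arguments of these. *)
Fixpoint mor (a b : bitseq) : bitseq :=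
  match a, b with x :: a', y :: b' => (if x then true else y) :: mor a' b' | _, _ => [::] end.
Fixpoint mand (a b : bitseq) : bitseq :=
  match a, b with x :: a', y :: b' => (if x then y else false) :: mand a' b' | _, _ => [::] end.
Fixpoint mdiff (a b : bitseq) : bitseq :=
  match a, b with
  | x :: a', y :: b' => (if x then if y then false else true else false) :: mdiff a' b'
  | _, _ => [::] end.
Fixpoint mdis (a b : bitseq) : bool :=
  match a, b with
  | x :: a', y :: b' => if x then if y then false else mdis a' b' else mdis a' b'
  | _, _ => true end.
Fixpoint munion (rows : seq bitseq) (m acc : bitseq) : bitseq :=
  match rows, m with
  | r :: rows', x :: m' => munion rows' m' (if x then mor acc r else acc)
  | _, _ => acc end.
Fixpoint mcount (a : bitseq) : nat :=
  match a with x :: a' => if x then (mcount a').+1 else mcount a' | [::] => 0 end.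
Definition munit (n i : nat) : bitseq := mkseq (fun j => j == i) n.

Section Masks.
Implicit Types (a b : bitseq).

Lemma size_mor a b : size a = size b -> size (mor a b) = size b.
Proof. by elim: a b => [|x a IH] [|y b] //= [/IH->]. Qed.
Lemma size_mand a b : size a = size b -> size (mand a b) = size b.
Proof. by elim: a b => [|x a IH] [|y b] //= [/IH->]. Qed.
Lemma size_mdiff a b : size a = size b -> size (mdiff a b) = size b.
Proof. by elim: a b => [|x a IH] [|y b] //= [/IH->]. Qed.
Lemma nth_mor a b i : size a = size b -> nth false (mor a b) i = nth false a i || nth false b i.
Proof. by elim: a b i => [|x a IH] [|y b] [|i] //= [/IH]. Qed.
Lemma nth_mand a b i : size a = size b -> nth false (mand a b) i = nth false a i && nth false b i.
Proof. by elim: a b i => [|x a IH] [|y b] [|i] //= [/IH]. Qed.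
Lemma nth_mdiff a b i : size a = size b -> nth false (mdiff a b) i = nth false a i && ~~ nth false b i.
Proof. by elim: a b i => [|x a IH] [|y b] [|i] //= [/IH]. Qed.
Lemma mdisP a b : size a = size b ->
  reflect (forall i, nth false a i -> nth false b i -> False) (mdis a b).
Proof.
elim: a b => [|x a IH] [|y b] //= => [_|[/IH{}IH]]; first by constructor=> i; rewrite nth_nil.
have step : ~~ (x && y) ->
    (forall i, nth false a i -> nth false b i -> False) <->
    (forall i, nth false (x :: a) i -> nth false (y :: b) i -> False).
  move=> nxy; split=> [h [|i] /=|h i]; [|exact: h|exact: (h i.+1)].
  by move=> hx hy; rewrite hx hy in nxy.
case: x y step => [] [] step; first by constructor=> /(_ 0); apply.
- by apply: (iffP IH); apply step.
- by apply: (iffP IH); apply step.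
- by apply: (iffP IH); apply step.
Qed.

Lemma size_munion n rows m acc : size acc = n -> all (fun r => size r == n) rows ->
  size (munion rows m acc) = n.
Proof.
elim: rows m acc => [|r rows IH] [|x m] acc //= sa /andP[/eqP sr sR].
by apply: IH => //; case: x => //; rewrite size_mor // sa.
Qed.

Lemma nth_munion n rows m acc i : size acc = n -> all (fun r => size r == n) rows ->
  size m = size rows ->
  nth false (munion rows m acc) i =
    nth false acc i || has (fun k => nth false m k && nth false (nth [::] rows k) i) (iota 0 (size rows)).
Proof.
elim: rows m acc => [|r rows IH] [|x m] acc //= sa; first by rewrite orbF.
move=> /andP[/eqP sr sR] [sm]; rewrite IH //; last by case: x => //; rewrite size_mor // sa.
rewrite -[1]/(1 + 0) iotaDl has_map orbA; congr (_ || _).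
by case: x; rewrite ?orbF // nth_mor // sa.
Qed.

Lemma mcount_count a : mcount a = count id a.
Proof. by elim: a => //= -[] a ->. Qed.

Lemma size_munit n i : size (munit n i) = n. Proof. exact: size_mkseq. Qed.
Lemma nth_munit n i j : nth false (munit n i) j = (j < n) && (j == i).
Proof. by case: (ltnP j n) => h; [rewrite nth_mkseq|rewrite nth_default // size_mkseq]. Qed.
Lemma count_nth a : count id a = count (nth false a) (iota 0 (size a)).
Proof. by rewrite -{1}(mkseq_nth false a) /mkseq count_map. Qed.
End Masks.

(* Search for all completions of a partial graph of girth at least 5 with prescribed degrees: [Es] lists
   the known neighbourhoods, [Cs] the undecided candidates, and each leaf must contain [k]
   pairwise nonadjacent vertices. *)
Section Completion.
Variables (n k : nat) (ds : seq nat).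
Let us := mkseq (munit n) n.
Let zero := nseq n false.

Definition state := (seq bitseq * seq bitseq)%type.

Fixpoint isearch (l : seq (bitseq * bitseq)) (m : nat) (forb : bitseq) : bool :=
  if m is m'.+1 then
    if l is (u, r) :: l' then
      if mdis u forb then if isearch l' m' (mor forb r) then true else isearch l' m forb
      else isearch l' m forb
    else false
  else true.

Definition known (st : state) i j := nth false (nth [::] st.1 i) j.
Definition cand (st : state) i j := nth false (nth [::] st.2 i) j.

(** A pair whose ends are reached from [i] and from [j] by known walks of lengths [a] and [b] would
    close a cycle of length [a + b + 2] through the new edge. The candidates dropped are those with
    [a + b] at most 2, including the pair [i], [j] itself, which is now decided. *)
Definition add_edge (st : state) (i j : nat) : state :=
  let ui := munit n i in let uj := munit n j in
  let A1 := nth [::] st.1 i in let B1 := nth [::] st.1 j in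
  if (if nth false A1 j then true else nth false B1 i) then st else
  let A2 := munion st.1 A1 zero in let B2 := munion st.1 B1 zero in
  let fA := mor uj B1 in let fAA := mor fA B2 in
  let fB := mor ui A1 in let fBB := mor fB A2 in
  (mkseq (fun h => let E := nth [::] st.1 h in
     if h == i then mor E uj else if h == j then mor E ui else E) n,
   mkseq (fun h => let C := nth [::] st.2 h in
     let C' := if h == i then mdiff C fAA else if nth false A1 h then mdiff C fA
               else if nth false A2 h then mdiff C uj else C in
     if h == j then mdiff C' fBB else if nth false B1 h then mdiff C' fB
               else if nth false B2 h then mdiff C' ui else C') n).

Definition del_pair (st : state) (i j : nat) : state :=
  (st.1, mkseq (fun h => let C := nth [::] st.2 h in
     if h == i then mdiff C (munit n j) else if h == j then mdiff C (munit n i) else C) n).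

Fixpoint needs (Es : seq bitseq) (l : seq nat) : seq nat :=
  match Es, l with E :: Es', d :: l' => d - mcount E :: needs Es' l' | _, _ => [::] end.

(* The incomplete vertex with the fewest spare candidates. *)
Fixpoint pick_row (opn : bitseq) (nd : seq nat) (Es Cs : seq bitseq) (i : nat) : option (nat * nat * bitseq) :=
  match nd, Es, Cs with
  | d :: nd', E :: Es', C :: Cs' =>
    let r := pick_row opn nd' Es' Cs' i.+1 in
    if d is 0 then r else
      let c := mdiff (mand C opn) E in
      let m := mcount c in
      let s := if m < d then 0 else (m - d).+1 in
      match r with
      | Some (s', _, _) => if s <= s' then Some (s, i, c) else r
      | None => Some (s, i, c) end
  | _, _, _ => None end.

(** In the triple from [pick_row], [s = 0] means fewer candidates than missing edges, so that the
    state is contradictory; [s = 1] means exactly as many, so every candidate is an edge and the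
    branch without the edge is skipped. *)
Fixpoint refute (fuel : nat) (st : state) : bool :=
  if fuel is f.+1 then
    let nd := needs st.1 ds in
    match pick_row [seq 0 < d | d <- nd] nd st.1 st.2 0 with
    | None => isearch (zip us st.1) k zero
    | Some (0, _, _) => true
    | Some (s, i, c) =>
      let j := index true c in
      if refute f (add_edge st i j) then
        if s == 1 then true else refute f (del_pair st i j)
      else false
    end
  else false.

Definition init : state := (nseq n zero, mkseq (fun i => mdiff (nseq n true) (munit n i)) n).
Definition refutes (fuel : nat) (es : seq (nat * nat)) : bool :=
  refute fuel (foldl (fun st p => add_edge st p.1 p.2) init es).
End Completion.

(** The ball of radius 2 about 0, when 0 and its neighbours have degree 4, has 1 + 4 + 12 vertices;
    17 is the one vertex outside. It has at most one neighbour below each of 1 to 4, so these can be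
    taken among 5, 8, 11, 14, with the branches that it meets coming first. *)
Definition tree18 : seq (nat * nat) :=
  [:: (0,1); (0,2); (0,3); (0,4); (1,5); (1,6); (1,7); (2,8); (2,9); (2,10); (3,11); (3,12); (3,13);
      (4,14); (4,15); (4,16)].
Definition zedges (m : nat) : seq (nat * nat) := take m [:: (17,5); (17,8); (17,11); (17,14)].
(* o.`g selects the vertex of degree 3 among the children of the g-th neighbour of the root, 2 standing for none. *)
Definition degs18 (m : nat) (o : seq nat) : seq nat :=
  [:: 4; 4; 4; 4; 4] ++ flatten [seq [:: 4 - (x == 0); 4 - (x == 1); 4] | x <- o] ++ [:: m].
Definition tree_ok (m : nat) (o : seq nat) : bool :=
  if odd (sumn (degs18 m o)) then true else refutes 18 7 (degs18 m o) 400 (tree18 ++ zedges m).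
Definition options4 : seq (seq nat) :=
  [seq p ++ q | p <- [seq [:: a; b] | a <- iota 0 3, b <- iota 0 3],
                q <- [seq [:: a; b] | a <- iota 0 3, b <- iota 0 3]].

(** * Soundness of the completion search *)

Section Soundness.
Variables (n k : nat) (ds : seq nat) (h : rel nat).
Hypotheses (hs : symmetric h) (hi : irreflexive h) (hn : forall i j, h i j -> i < n)
  (ht : forall x y z, h x y -> h y z -> h x z = false)
  (hC : forall x z y t, x != z -> h x y -> h z y -> h x t -> h z t -> y = t)
  (sds : size ds = n) (hd : forall i, i < n -> count (h i) (iota 0 n) = nth 0 ds i).

Record consistent (st : state) : Prop := Consistent {
  cE : size st.1 = n; cC : size st.2 = n;
  sE : all (fun r => size r == n) st.1; sC : all (fun r => size r == n) st.2;
  kh : forall i j, known st i j -> h i j;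
  ks : forall i j, known st i j -> known st j i;
  kc : forall i j, h i j -> known st i j || cand st i j }.

Let hn2 i j : h i j -> j < n. Proof. by rewrite hs => /hn. Qed.

Lemma size_row (l : seq bitseq) i : size l = n -> all (fun r => size r == n) l -> i < n ->
  size (nth [::] l i) = n.
Proof. by move=> sl /all_nthP-/(_ [::] i); rewrite sl => al li; apply/eqP/al. Qed.

Lemma neigh2 st i m : consistent st -> i < n ->
  nth false (munion st.1 (nth [::] st.1 i) (nseq n false)) m -> exists2 a, known st i a & known st a m.
Proof.
move=> c li; rewrite (nth_munion (n := n)) ?size_nseq ?(sE c) //; last first.
  by rewrite (size_row (cE c) (sE c) li) (cE c).
by rewrite nth_nseq if_same /= => /hasP[a _ /andP[ia am]]; exists a.
Qed.

Lemma add_edge_consistent st i j : consistent st -> h i j -> consistent (add_edge n st i j).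
Proof.
move=> c hij; have li := hn hij; have lj := hn2 hij.
rewrite /add_edge; case: ifP => // /negbT nij.
have {nij} [nij nji] : ~~ known st i j /\ ~~ known st j i.
  by move: nij; rewrite /known; case: ifP => //= -> ->.
have ij : i != j by apply: contraTneq hij => ->; rewrite hi.
set A1 := nth [::] st.1 i; set B1 := nth [::] st.1 j.
set A2 := munion _ A1 _; set B2 := munion _ B1 _.
have sz l := @size_row l.
have sA1 : size A1 = n by apply: sz (cE c) (sE c) li.
have sB1 : size B1 = n by apply: sz (cE c) (sE c) lj.
have sA2 : size A2 = n by apply: size_munion (sE c); rewrite size_nseq.
have sB2 : size B2 = n by apply: size_munion (sE c); rewrite size_nseq.
have su m : size (munit n m) = n := size_munit n m.
have sm a b : size a = n -> size b = n -> size (mor a b) = n by move=> sa sb; rewrite size_mor ?sa ?sb.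
have sd a b : size a = n -> size b = n -> size (mdiff a b) = n by move=> sa sb; rewrite size_mdiff ?sa ?sb.
have sfA : size (mor (munit n j) B1) = n by apply: sm.
have sfB : size (mor (munit n i) A1) = n by apply: sm.
have sfAA : size (mor (mor (munit n j) B1) B2) = n by apply: sm.
have sfBB : size (mor (mor (munit n i) A1) A2) = n by apply: sm.
(* the three situations in which a pair becomes a non-edge *)
have f0 x : nth false A2 x -> x != i -> h x j = false.
  move=> /(neigh2 c li)[a ia ax] xi; apply/negP=> xj.
  have := hC xi (y := a) (t := j); rewrite (hs x a) (kh c ax) (kh c ia) xj hij => /(_ isT isT isT isT) aj.
  by rewrite -aj ia in nij.
have f0' x : nth false B2 x -> x != j -> h x i = false.
  move=> /(neigh2 c lj)[a ia ax] xi; apply/negP=> xj.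
  have := hC xi (y := a) (t := i); rewrite (hs x a) (kh c ax) (kh c ia) xj hs hij => /(_ isT isT isT isT) aj.
  by rewrite -aj ia in nji.
have f1 x y : nth false A1 x -> nth false B1 y -> h x y = false.
  move=> ix jy; apply/negP=> xy; have xj : x != j by apply: contraNneq nij => <-.
  have := hC xj (y := i) (t := y); rewrite (hs x i) (kh c ix) (hs j i) hij xy (kh c jy) => /(_ isT isT isT isT) yi.
  by move: jy; rewrite -yi => jy; rewrite /known -/B1 jy in nji.
have f2 x : nth false A1 x -> h x j = false by move=> ix; apply: ht hij; rewrite hs; exact: (kh c ix).
have f2' x : nth false B1 x -> h x i = false.
  by move=> ix; apply: (ht (y := j)); [rewrite hs; exact: (kh c ix)|rewrite hs].
have kE x y : x < n -> nth false (nth [::] (mkseq (fun h0 : nat =>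
        if h0 == i then mor (nth [::] st.1 h0) (munit n j)
        else if h0 == j then mor (nth [::] st.1 h0) (munit n i) else nth [::] st.1 h0) n) x) y
     = [|| known st x y, (x == i) && (y == j) | (x == j) && (y == i)].
  move=> lx; rewrite /known /= nth_mkseq //.
  case: (eqVneq x i) => [->|xi].
    rewrite nth_mor ?size_munit ?(sz _ _ (cE c) (sE c)) // nth_munit (negPf ij) orbF.
    by case: (eqVneq y j) => [->|]; rewrite ?lj ?andbF.
  case: (eqVneq x j) => [->|xj]; last by rewrite !orbF.
  rewrite nth_mor ?size_munit ?(sz _ _ (cE c) (sE c)) // nth_munit /=.
  by case: (eqVneq y i) => [->|]; rewrite ?li ?andbF.
split=> /=; rewrite ?size_mkseq //.
- apply/allP=> r /mapP[x]; rewrite mem_iota => /andP[_ lx] ->.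
  by have sx := sz _ _ (cE c) (sE c) lx; do 2?case: ifP => _; rewrite ?sm ?sx.
- apply/allP=> r /mapP[x]; rewrite mem_iota => /andP[_ lx] ->.
  have sx := sz _ _ (cC c) (sC c) lx; apply/eqP.
  by do 6?[case: ifP => _]; rewrite ?sd.
- move=> x y xy; have lx : x < n.
    by rewrite ltnNge; apply/negP=> nx; move: xy; rewrite /known /= (nth_default [::]) ?size_mkseq // nth_nil.
  move: xy; rewrite {1}/known /= kE // => /or3P[/(kh c)//||] /andP[/eqP-> /eqP->] //.
  by rewrite hs.
- move=> x y xy; have lx : x < n.
    by rewrite ltnNge; apply/negP=> nx; move: xy; rewrite /known /= (nth_default [::]) ?size_mkseq // nth_nil.
  move: xy; rewrite {1}/known /= kE // => xy.
  have ly : y < n by case/or3P: xy => [/(kh c)/hn2//||] /andP[_ /eqP->].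
  rewrite /known /= kE //.
  by case/or3P: xy => [/(ks c)->//||] /andP[-> ->]; rewrite ?orbT.
- move=> x y xy; have lx := hn xy; have ly := hn2 xy.
  rewrite {1}/known /= kE //.
  case: (boolP (known st x y)) => //= nxy.
  case: (boolP ((x == i) && (y == j))) => //= c1; case: (boolP ((x == j) && (y == i))) => //= c2.
  have := kc c xy; rewrite (negPf nxy) /= /cand /= nth_mkseq //.
  set C := nth [::] st.2 x => Cy.
  have sCx : size C = n := sz _ _ (cC c) (sC c) lx.
  have C1 : exists C', [/\ size C' = n, nth false C' y & 
     (if x == i then mdiff C (mor (mor (munit n j) B1) B2)
      else if nth false A1 x then mdiff C (mor (munit n j) B1)
           else if nth false A2 x then mdiff C (munit n j) else C) = C'].
    eexists; split; last by []; first by do 3?[case: ifP => _]; rewrite ?sd.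
    case: (eqVneq x i) => [xi|xi].
      rewrite nth_mdiff ?sCx ?sfAA // Cy !nth_mor ?su ?sB1 ?sB2 ?sfA // nth_munit ly /= !negb_or.
      move: c1; rewrite xi eqxx /= => yj; rewrite yj /=; apply/andP; split; apply/negP.
        by move/f2'; rewrite hs -xi xy.
      by move/f0'; rewrite yj hs -xi xy => /(_ isT).
    case: ifP => [xA|_].
      rewrite nth_mdiff ?sCx ?sfA // Cy nth_mor ?su ?sB1 // nth_munit ly /= negb_or; apply/andP; split.
        by apply: contraTneq xy => ->; rewrite f2.
      by apply: contraTN xy => yB; rewrite f1.
    case: ifP => [xA|_ //]; rewrite nth_mdiff ?sCx ?su // Cy nth_munit ly /=.
    by apply: contraTneq xy => ->; rewrite f0.
  case: C1 => C' [sC' C'y ->].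
  case: (eqVneq x j) => [xj|xj].
    rewrite nth_mdiff ?sC' ?sfBB // C'y !nth_mor ?su ?sA1 ?sA2 ?sfB // nth_munit ly /= !negb_or.
    move: c2; rewrite xj eqxx /= => yi; rewrite yi /=; apply/andP; split; apply/negP.
      by move/f2; rewrite hs -xj xy.
    by move/f0; rewrite yi hs -xj xy => /(_ isT).
  case: ifP => [xB|_].
    rewrite nth_mdiff ?sC' ?sfB // C'y nth_mor ?su ?sA1 // nth_munit ly /= negb_or; apply/andP; split.
      by apply: contraTneq xy => ->; rewrite f2'.
    by apply: contraTN xy => yA; rewrite hs f1.
  case: ifP => [xB|_ //]; rewrite nth_mdiff ?sC' ?su // C'y nth_munit ly /=.
  by apply: contraTneq xy => ->; rewrite f0'.
Qed.

Lemma del_pair_consistent st i j : consistent st -> ~~ h i j -> consistent (del_pair n st i j).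
Proof.
move=> c nij; have sz l := @size_row l; have su m : size (munit n m) = n := size_munit n m.
split=> /=; rewrite ?size_mkseq //; first exact: (cE c); first exact: (sE c).
- apply/allP=> r /mapP[x]; rewrite mem_iota => /andP[_ lx] ->; apply/eqP.
  by have sx := sz _ _ (cC c) (sC c) lx; do 2?case: ifP => _; rewrite ?size_mdiff ?sx ?su.
- exact: (kh c).
- exact: (ks c).
- move=> x y xy; have := kc c xy; case/orP; first by rewrite /known /= => ->.
  move=> Cy; apply/orP; right; have lx := hn xy; rewrite /cand /= nth_mkseq //.
  have sx := sz _ _ (cC c) (sC c) lx.
  case: (eqVneq x i) => [xi|xi].
    rewrite nth_mdiff ?sx ?su // nth_munit; apply/andP; split=> //.
    by apply/negP=> /andP[_ /eqP yj]; rewrite xi yj (negPf nij) in xy.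
  case: (eqVneq x j) => [xj|//]; rewrite nth_mdiff ?sx ?su // nth_munit; apply/andP; split=> //.
  by apply/negP=> /andP[_ /eqP yi]; rewrite xj yi hs (negPf nij) in xy.
Qed.

Lemma init_consistent : consistent (init n).
Proof.
split=> /=; rewrite ?size_nseq ?size_mkseq //.
- by apply/allP=> r /nseqP[-> _]; rewrite size_nseq.
- by apply/allP=> r /mapP[x _ ->]; rewrite size_mdiff ?size_munit ?size_nseq.
- move=> i j; rewrite /known /=; case: (ltnP i n) => li; last by rewrite (nth_default [::]) ?nth_nil // size_nseq.
  by rewrite (nth_nseq [::]) li nth_nseq if_same.
- move=> i j; rewrite /known /=; case: (ltnP i n) => li; last by rewrite (nth_default [::]) ?nth_nil // size_nseq.
  by rewrite (nth_nseq [::]) li nth_nseq if_same.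
- move=> i j ij; apply/orP; right; rewrite /cand /= nth_mkseq ?(hn ij) //.
  rewrite nth_mdiff ?size_munit ?size_nseq // nth_nseq nth_munit (hn2 ij) /=.
  by apply: contraTneq ij => ->; rewrite hi.
Qed.

Lemma size_needs Es l : size Es = size l -> size (needs Es l) = size l.
Proof. by elim: Es l => [|E Es IH] [|d l] //= [/IH->]. Qed.

Lemma nth_needs Es l i : size Es = size l -> i < size l ->
  nth 0 (needs Es l) i = nth 0 l i - mcount (nth [::] Es i).
Proof. by elim: Es l i => [|E Es IH] [|d l] [|i] //= [/IH q] /q. Qed.

Definition slack (c : bitseq) d := if mcount c < d then 0 else (mcount c - d).+1.

Lemma pickP opn nd Es Cs i0 : size Es = size nd -> size Cs = size nd ->
  match pick_row opn nd Es Cs i0 with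
  | None => forall p, p < size nd -> nth 0 nd p = 0
  | Some (s, i, c) => exists p, [/\ i = i0 + p, p < size nd, 0 < nth 0 nd p,
      c = mdiff (mand (nth [::] Cs p) opn) (nth [::] Es p) & s = slack c (nth 0 nd p)]
  end.
Proof.
elim: nd Es Cs i0 => [|d nd IH] [|E Es] [|C Cs] i0 //= [sE'] [sC'].
have := IH Es Cs i0.+1 sE' sC'; set r := pick_row _ _ _ _ _.
case: d => [|d].
  case: r => [[[s i] c]|] q; last by case=> [|p] //= /q.
  by case: q => p [-> lp h1 h2 h3]; exists p.+1; split=> //; rewrite addnS.
set c0 := mdiff _ _; set s0 := if _ then _ else _.
have h0 : exists p, [/\ i0 = i0 + p, p < (size nd).+1, 0 < nth 0 (d.+1 :: nd) p,
      c0 = mdiff (mand (nth [::] (C :: Cs) p) opn) (nth [::] (E :: Es) p) & s0 = slack c0 (nth 0 (d.+1 :: nd) p)].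
  by exists 0; rewrite addn0.
case: r => [[[s i] c]|] q //; case: ifP => // _.
by case: q => p [-> lp h1 h2 h3]; exists p.+1; split=> //; rewrite addnS.
Qed.

Lemma isearchP (Es : seq bitseq) m forb p : size Es = n -> all (fun r => size r == n) Es -> size forb = n ->
  isearch (zip (drop p (mkseq (munit n) n)) (drop p Es)) m forb ->
  exists s : seq nat, [/\ size s = m, uniq s, all (fun x => p <= x < n) s, all (fun x => ~~ nth false forb x) s
    & forall x y, x \in s -> y \in s -> x < y -> ~~ nth false (nth [::] Es x) y].
Proof.
move=> sE' aE; have [r hr] := ubnP (n - p); elim: r p m forb hr => // r IH p [|m] forb hr sf.
  by move=> _; exists [::].
case: (ltnP p n) => [lp|np]; last by rewrite !drop_oversize ?size_mkseq ?sE'.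
rewrite (drop_nth [::]) ?size_mkseq // [drop p Es](drop_nth [::]) ?sE' //= nth_mkseq //.
have sr := size_row sE' aE lp.
have skip : isearch (zip (drop p.+1 (mkseq (munit n) n)) (drop p.+1 Es)) m.+1 forb ->
   exists s : seq nat, [/\ size s = m.+1, uniq s, all (fun x => p <= x < n) s, all (fun x => ~~ nth false forb x) s
    & forall x y, x \in s -> y \in s -> x < y -> ~~ nth false (nth [::] Es x) y].
  move/(IH _ _ _ _ sf); case; first lia.
  move=> s [h1 h2 h3 h4 h5]; exists s; split=> //.
  by apply/allP=> x /(allP h3)/andP[/ltnW-> ->].
case: (mdisP (a := munit n p) (b := forb)); rewrite ?size_munit ?sf // => dis //.
case: ifP => [|_ /skip //].
move/(IH p.+1 m (mor forb (nth [::] Es p))); rewrite size_mor ?sf ?sr // => -[||s [h1 h2 h3 h4 h5] _]; [lia|by []|].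
have pf : ~~ nth false forb p by apply/negP=> pf; apply: (dis p) => //; rewrite nth_munit lp eqxx.
have sp x : x \in s -> p < x by move/(allP h3)/andP=> [].
exists (p :: s); split=> /=; rewrite ?h1 ?h2 ?lp ?leqnn ?pf //=.
- by rewrite andbT; apply/negP=> /sp; rewrite ltnn.
- by apply/allP=> x /(allP h3)/andP[/ltnW-> ->].
- by apply/allP=> x /(allP h4); rewrite nth_mor ?sf ?sr // negb_or => /andP[].
- move=> x y; rewrite !inE => /predU1P[->|xs] /predU1P[->|ys]; rewrite ?ltnn //.
  + by move=> _; move/(allP h4): ys; rewrite nth_mor ?sf ?sr // negb_or => /andP[].
  + by move=> xp; have := sp _ xs; lia.
  + exact: h5.
Qed.

Lemma sub_in_count (a b : pred nat) l : {in l, forall x, a x -> b x} -> count a l <= count b l.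
Proof.
elim: l => //= y l IH ab; rewrite leq_add ?IH //; last by move=> x xl; apply: ab; rewrite inE xl orbT.
by have := ab y (mem_head _ _); case: (a y) (b y) => [] [] // /(_ isT).
Qed.

Lemma count_sub (a b : pred nat) l : {in l, forall x, a x -> b x} -> count b l <= count a l ->
  {in l, forall x, b x -> a x}.
Proof.
elim: l => //= y l IH ab le.
have ab' : {in l, forall x, a x -> b x} by move=> x xl; apply: ab; rewrite inE xl orbT.
have le' : count a l <= count b l by apply: sub_in_count ab'.
have aby := ab y (mem_head _ _).
move=> x; rewrite inE => /predU1P[->|xl].
  by case: (a y) (b y) aby le => [] [] //= _; lia.
by apply: IH xl => //; case: (a y) (b y) aby le => [] [] //=; lia.
Qed.

Lemma count_row Es i : size Es = n -> all (fun r => size r == n) Es -> i < n ->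
  mcount (nth [::] Es i) = count (nth false (nth [::] Es i)) (iota 0 n).
Proof. by move=> s1 s2 li; rewrite mcount_count count_nth (size_row s1 s2 li). Qed.

(** Known edges are edges of [h], so a vertex with no missing edge has its whole neighbourhood
    known. Hence only open vertices can be candidates, and in a state without open vertices
    [isearch] sees all of [h]. *)
Lemma refuteP fuel st : consistent st -> refute n k ds fuel st ->
  exists s : seq nat, [/\ size s = k, uniq s, all (fun x => x < n) s
    & {in s &, forall x y, ~~ h x y}].
Proof.
elim: fuel st => // fuel IH st c /=.
set nd := needs _ _.
have snd_ : size nd = n by rewrite size_needs ?(cE c).
have row i : i < n -> mcount (nth [::] st.1 i) = count (known st i) (iota 0 n).
  by move=> li; apply: count_row (cE c) (sE c) li.
have nthnd i : i < n -> nth 0 nd i = nth 0 ds i - mcount (nth [::] st.1 i).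
  by move=> li; rewrite nth_needs ?(cE c) ?sds.
have complete i j : i < n -> nth 0 nd i = 0 -> h i j -> known st i j.
  move=> li; rewrite nthnd // -(hd li) row // => /eqP; rewrite subn_eq0 => le ij.
  have kh' : {in iota 0 n, forall x, known st i x -> h i x} by move=> x _ /(kh c).
  by apply: (count_sub kh' le) => //; rewrite mem_iota (hn2 ij).
have := @pickP [seq 0 < d | d <- nd] nd st.1 st.2 0; rewrite (cE c) (cC c) snd_ => /(_ erefl erefl).
case: pick_row => [[[s i] cd]|] pk; last first.
  move=> srch; have := @isearchP st.1 k (nseq n false) 0 (cE c) (sE c).
  rewrite !drop0 size_nseq => /(_ erefl srch)[s [h1 h2 h3 _ h5]].
  have s_lt x : x \in s -> x < n by move/(allP h3).
  exists s; split=> //.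
  move=> x y xs ys; case: (ltngtP x y) => [xy|xy|->]; last by rewrite hi.
  - apply/negP=> /(complete _ _ (s_lt _ xs) (pk _ (s_lt _ xs))); apply/negP; exact: h5.
  - rewrite hs; apply/negP=> /(complete _ _ (s_lt _ ys) (pk _ (s_lt _ ys))); apply/negP; exact: h5.
case: pk => p [-> lp]; rewrite add0n => ndp ecd es'.
have sEp := size_row (cE c) (sE c) lp; have sCp := size_row (cC c) (sC c) lp.
have sopn : size [seq 0 < d | d <- nd] = n by rewrite size_map.
have sand : size (mand (nth [::] st.2 p) [seq 0 < d | d <- nd]) = n by rewrite size_mand ?sCp ?sopn.
have scd : size cd = n by rewrite ecd size_mdiff ?sand ?sEp.
have cdE j : nth false cd j = [&& cand st p j, nth false [seq 0 < d | d <- nd] j & ~~ known st p j].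
  by rewrite ecd nth_mdiff ?sand ?sEp // nth_mand ?sCp ?sopn // andbA.
have miss j : h p j -> ~~ known st p j -> nth false cd j.
  move=> pj nk; have lj := hn2 pj; rewrite cdE nk andbT.
  have := kc c pj; rewrite (negPf nk) /= => -> /=.
  rewrite (nth_map 0) ?snd_ // lt0n; apply/eqP => z.
  have := complete j p lj z; rewrite hs => /(_ pj) /(ks c); exact/negP.
have cnt : nth 0 nd p <= count (fun j => h p j && nth false cd j) (iota 0 n).
  rewrite nthnd // -(hd lp) row // leq_subLR.
  rewrite -(count_predUI (known st p)) ; apply: leq_trans (leq_addr _ _).
  by apply: sub_count => j /= pj; case: (boolP (known st p j)) => //= nk; rewrite pj miss.
have cle : count (fun j => h p j && nth false cd j) (iota 0 n) <= mcount cd.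
  by rewrite mcount_count count_nth scd; apply: sub_count => j /andP[].
case: s es' => [|s] es'.
  by move: es'; rewrite /slack; case: ltnP => // lt _ _; have := leq_trans (leq_trans cnt cle); lia.
have [j0 lj0 jn] : exists2 j, j < n & nth false cd j.
  have : has (fun j => h p j && nth false cd j) (iota 0 n) by rewrite has_count; apply: leq_trans cnt.
  by case/hasP=> j; rewrite mem_iota => /= lj /andP[_ cj]; exists j.
have tin : true \in cd by rewrite -(jn : nth false cd j0 = true) mem_nth // scd.
set j := index true cd.
have cj : nth false cd j by rewrite nth_index.
have [pj|npj] := boolP (h p j).
  by case: ifP => // r _; apply: IH r; apply: add_edge_consistent.
case: ifP => // _; case: eqP => [s1 _|_ r]; last by apply: IH r; apply: del_pair_consistent.
(* There are exactly as many candidates as missing edges, and the missing edges are among the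
   candidates; so [j] is an edge after all. *)
exfalso; move: es'; rewrite /slack s1; case: ltnP => // le -[le0].
have := @count_sub (fun j => h p j && nth false cd j) (nth false cd) (iota 0 n).
have lj : j \in iota 0 n by rewrite mem_iota /= -scd index_mem.
move=> /(_ _ _ _ lj cj); rewrite (negPf npj) /= => hh.
suff : false by []. apply: hh.
  by move=> x _ /andP[].
rewrite (_ : count (nth false cd) _ = mcount cd); last by rewrite mcount_count count_nth scd.
by apply: leq_trans cnt; lia.
Qed.

Lemma refutesP fuel es : all (fun p => h p.1 p.2) es -> refutes n k ds fuel es ->
  exists s : seq nat, [/\ size s = k, uniq s, all (fun x => x < n) s
    & {in s &, forall x y, ~~ h x y}].
Proof.
move=> he; apply: refuteP.
elim: es he (init n) init_consistent => //= p es IH /andP[hp he] st c.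
by apply: IH => //; apply: add_edge_consistent.
Qed.
End Soundness.

(** * Transfer from indices to vertices *)

Section Labelled.
Variables (T : finType) (e : rel T).
Hypothesis g5 : girth5 e.

Lemma refutes_alpha (v0 : T) (l : seq T) ds fuel es k : uniq l ->
  [seq deg e [set x in l] v | v <- l] = ds ->
  all (fun p => [&& p.1 < size l, p.2 < size l & e (nth v0 l p.1) (nth v0 l p.2)]) es ->
  refutes (size l) k ds fuel es -> alpha_ge e k [set x in l].
Proof.
case: g5 => es' ei tri C4 ul hds hes.
pose h i j := [&& i < size l, j < size l & e (nth v0 l i) (nth v0 l j)].
case/(refutesP (h := h)) => //.
- by move=> i j; rewrite /h es' andbCA.
- by move=> i; rewrite /h ei !andbF.
- by move=> i j /and3P[].
- by move=> x y z /and3P[lx _ xy] /and3P[_ lz yz]; rewrite /h (tri _ _ _ xy yz) !andbF.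
- move=> x z y t xz /and3P[lx ly xy] /and3P[lz _ zy] /and3P[_ lt' xt] /and3P[_ _ zt].
  apply/eqP; rewrite -(nth_uniq v0 ly lt' ul); apply/eqP; apply: C4 xy zy xt zt.
  by rewrite nth_uniq.
- by rewrite -hds size_map.
- move=> i li; rewrite -hds (nth_map v0) // /deg.
  have -> : nb e (nth v0 l i) :&: [set x in l] = [set x in filter (e (nth v0 l i)) l].
    by apply/setP=> x; rewrite !inE mem_filter.
  rewrite cardsE (card_uniqP (filter_uniq _ ul)) size_filter -{3}(mkseq_nth v0 l) /mkseq count_map.
  by apply: eq_in_count => j; rewrite mem_iota /= => lj; rewrite /h li lj.
move=> s [ss us /allP ls hs]; exists [set x in map (nth v0 l) s]; split.
- by apply/subsetP=> x; rewrite !inE => /mapP[i /ls li ->]; apply: mem_nth.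
- apply/indepP=> x y; rewrite !inE => /mapP[i si ->] /mapP[j sj ->].
  by move: (hs i j si sj); rewrite /h !ls.
- rewrite cardsE (card_uniqP _) ?size_map ?ss // map_inj_in_uniq // => i j si sj /eqP.
  by rewrite nth_uniq ?ls // => /eqP.
Qed.

(** By counting, a list as long as [S] that covers [S] cannot repeat a vertex; this spares comparing
    the 18 named vertices pair by pair. *)
Lemma cover_uniq (S : {set T}) (l : seq T) : size l = #|S| -> {subset S <= l} ->
  uniq l /\ S = [set x in l].
Proof.
move=> sl Sl.
have c : #|S| <= #|[set x in l]| by apply/subset_leq_card/subsetP=> x /Sl; rewrite inE.
have ul : uniq l.
  by rewrite cardsE -sl in c; apply/card_uniqP/eqP; rewrite eqn_leq card_size c.
split=> //; apply/eqP; rewrite eqEcard cardsE (card_uniqP ul) sl leqnn andbT.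
by apply/subsetP=> x /Sl; rewrite inE.
Qed.

Lemma refutes_cover (v0 : T) (S : {set T}) (l : seq T) ds fuel es k : size l = #|S| ->
  {subset S <= l} -> [seq deg e S v | v <- l] = ds ->
  all (fun p => [&& p.1 < size l, p.2 < size l & e (nth v0 l p.1) (nth v0 l p.2)]) es ->
  refutes (size l) k ds fuel es -> alpha_ge e k S.
Proof.
move=> sl Sl hds hes hr.
have [ul eS] := cover_uniq sl Sl.
by rewrite eS; apply: refutes_alpha hes hr; rewrite // -eS.
Qed.
End Labelled.

Lemma tree_okT m o : m \in [:: 3; 4] -> o \in options4 -> tree_ok m o.
Proof.
move=> hm; have : all (fun m => all (tree_ok m) options4) [:: 3; 4] by vm_cast_no_check (erefl true).
by move=> /allP /(_ m hm) /allP; apply.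
Qed.

(** Three blocks of six: two adjacent vertices of degree 3 and the two other neighbours of each,
    which have degree 4. The edges between the blocks are left to the search. *)
Definition six18 : seq (nat * nat) :=
  [:: (0,1); (0,2); (0,3); (1,4); (1,5); (6,7); (6,8); (6,9); (7,10); (7,11);
      (12,13); (12,14); (12,15); (13,16); (13,17)].
Definition sixdegs := [:: 3; 3; 4; 4; 4; 4; 3; 3; 4; 4; 4; 4; 3; 3; 4; 4; 4; 4].
Lemma six18_ok : refutes 18 7 sixdegs 400 six18.
Proof. by vm_cast_no_check (erefl true). Qed.

(** * Structure of a counterexample on eighteen vertices *)

Section Ramsey18.
Variables (T : finType) (e : rel T).
Hypothesis g5 : girth5 e.
Let es : symmetric e. Proof. by case: g5. Qed.
Let ei : irreflexive e. Proof. by case: g5. Qed.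
Let tri x y z : e x y -> e y z -> e x z = false. Proof. by case: g5 => _ _ + _; apply. Qed.
Let C4 x z y t : x != z -> e x y -> e z y -> e x t -> e z t -> y = t.
Proof. by case: g5 => _ _ _; apply. Qed.
Variable S : {set T}.
Hypotheses (cS : #|S| = 18) (N7 : ~ alpha_ge e 7 S).
Local Notation nb := (nb e).
Local Notation dg := (deg e S).
Implicit Types (u v w x y z : T).

Lemma min3 v : v \in S -> 3 <= dg v.
Proof. by move: v; have [//|h] := Ramsey_deg g5 (m := 3) (Ramsey6 g5) (esym cS); apply: h. Qed.

(* Removing the closed neighbourhoods of [v] and [z] would leave 11 vertices, hence 5 independent ones. *)
Lemma far3 v z : v \in S -> z \in S -> dg v = 3 -> z != v -> ~~ e v z ->
  3 <= deg e (S :\: (v |: nb v)) z.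
Proof.
move=> vS zS d3 zv vz; set R := S :\: _; rewrite leqNgt; apply/negP=> h; apply: N7.
apply: (alpha_step g5 vS); rewrite -/R.
have zR : z \in R by rewrite !inE negb_or zv vz.
have cR : #|R| = 14 by have := card_step g5 vS; rewrite -/R d3 cS; clear; lia.
by apply: (Ramsey_step g5 (Ramsey5 g5) zR); rewrite cR; clear -h; lia.
Qed.

(** Otherwise deleting the closed neighbourhood of [v] also deletes the neighbour [x] of [z],
    leaving [z] with a degree below 3, against [far3]. *)
Lemma deg3_uniq x v z : v \in S -> z \in S -> dg v = 3 -> dg z = 3 -> x \in S ->
  e x v -> e x z -> v = z.
Proof.
move=> vS zS dv dz xS xv xz; apply/eqP/negPn/negP=> vz.
have nvz : ~~ e v z by apply/negP=> h; move: (tri xv h); rewrite xz.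
have := far3 vS zS dv; rewrite eq_sym vz nvz => /(_ isT isT).
suff lt : deg e (S :\: (v |: nb v)) z < dg z by move: lt; rewrite dz; clear; lia.
apply/proper_card/properP; split.
  by apply/subsetP=> y; rewrite !inE => /andP[-> /andP[_ ->]].
by exists x; rewrite !inE ?(es _ x) ?xz ?xv ?xS ?orbT.
Qed.

Let D := [set v in S | dg v == 3].
Let in_D v : (v \in D) = (v \in S) && (dg v == 3). Proof. by rewrite inE. Qed.

Lemma deg3_le1 x : x \in S -> #|nb x :&: D| <= 1.
Proof.
move=> xS; apply/card_le1_eqP=> v z; rewrite !inE => /and3P[xv vS /eqP dv] /and3P[xz zS /eqP dz].
exact: (deg3_uniq (x := x)).
Qed.

(** Among five or more neighbours at most one has degree 3 and the others have at least 4, so their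
    degrees add up to at least 19, whereas the Moore bound allows 17. *)
Lemma max4 v : v \in S -> dg v <= 4.
Proof.
move=> vS; rewrite leqNgt; apply/negP=> d5.
have := deg_nb_sum g5 vS; rewrite cS ltnNge => /negP; apply.
have h : \sum_(u in nb v :&: S) 4 <= \sum_(u in nb v :&: S) (dg u + (u \in D)).
  apply: leq_sum => u; rewrite !inE => /andP[_ uS]; rewrite uS /=.
  by have := min3 uS; case: eqP; clear; lia.
rewrite big_split sum_nat_const /= in h.
have h1 : \sum_(u in nb v :&: S) (u \in D : nat) <= 1.
  apply: leq_trans (deg3_le1 vS); rewrite -sum1_card big_mkcond /= [X in _ <= X]big_mkcond /=.
  by apply: leq_sum => u _; rewrite !inE; case: (e v u) (u \in S) => [] [].
have h2 : 5 * 4 <= #|nb v :&: S| * 4 by rewrite leq_mul2r.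
by move: h h1 h2; clear; lia.
Qed.

Lemma deg34 v : v \in S -> dg v = 3 \/ dg v = 4.
Proof. by move=> vS; move: (min3 vS) (max4 vS); clear; lia. Qed.

Lemma D_nb x : x \in S -> #|nb x :&: D| = [exists v in D, e x v].
Proof.
move=> xS; case: exists_inP => [[v vD xv]|h].
  apply/eqP; rewrite eqn_leq deg3_le1 //= card_gt0; apply/set0Pn; exists v; by rewrite !in_setI in_nb xv.
apply/eqP; rewrite cards_eq0; apply/negPn/negP=> /set0Pn[v]; rewrite in_setI in_nb => /andP[xv vD].
by apply: h; exists v.
Qed.

(* Double counting of the edges leaving [D] gives [#|D| = 6], the vertices of [D] being joined in pairs. *)
Lemma paired_case : {in S, forall x, dg x = 4 -> exists2 v, v \in D & e x v} -> False.
Proof.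
move=> h4; pose b := \sum_(x in D) #|nb x :&: D|.
have DS : D \subset S by apply/subsetP=> x; rewrite in_D => /andP[].
have cnt : \sum_(x in S) #|nb x :&: D| = 3 * #|D|.
  rewrite (eq_bigr (fun x => \sum_(v in D) (e x v : nat))); last first.
    move=> x _; rewrite -sum1_card big_mkcond [RHS]big_mkcond /=; apply: eq_bigr => v _.
    by rewrite in_setI in_nb; case: (e x v) (v \in D) => [] [].
  rewrite exchange_big /= mulnC -sum_nat_const; apply: eq_bigr => v vD.
  move: (vD); rewrite in_D => /andP[_ /eqP <-]; rewrite /deg -sum1_card big_mkcond [RHS]big_mkcond /=.
  by apply: eq_bigr => x _; rewrite in_setI in_nb es; case: (e v x) (x \in S) => [] [].
(* The [3 * #|D|] incidences at [D], counted from the other end: [b] come from [D] itself, and each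
   vertex outside [D] contributes exactly one. *)
have e1 : 18 + b = 4 * #|D|.
  have : \sum_(x in S) #|nb x :&: D| = b + (18 - #|D|).
    rewrite (big_setID D) (setIidPr DS) /=; congr (_ + _).
    have c : #|S :\: D| = 18 - #|D| by rewrite cardsD (setIidPr DS) cS.
    rewrite -c -sum1_card; apply: eq_bigr => x; rewrite in_setD in_D => /andP[nD xS]; rewrite D_nb //.
    have d4 : dg x = 4 by move: nD; rewrite xS; case: (deg34 xS) => ->.
    by case: (h4 x xS d4) => v vD xv; apply/eqP; rewrite eqb1; apply/exists_inP; exists v.
  have : #|D| <= 18 by rewrite -cS subset_leq_card.
  by rewrite cnt; clear; lia.
have b1 : b <= #|D|.
  by rewrite -sum1_card; apply: leq_sum => x /(subsetP DS); apply: deg3_le1.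
have ev : ~~ odd #|D|.
  have := deg_sum_even g5 S.
  have -> : \sum_(v in S) dg v = 3 * #|D| + 4 * #|S :\: D|.
    rewrite (big_setID D) (setIidPr DS) /= mulnC -sum_nat_const mulnC -sum_nat_const; congr (_ + _).
      by apply: eq_bigr => x; rewrite in_D => /andP[_ /eqP].
    by apply: eq_bigr => x; rewrite in_setD in_D => /andP[nD xS]; move: nD; rewrite xS; case: (deg34 xS) => ->.
  by rewrite oddD !oddM /= addbF.
(* From [18 + b = 4 * #|D|] and [b <= #|D|] it follows that [#|D|] is 5 or 6; the parity of the
   degree sum excludes 5. *)
have [cD bD] : #|D| = 6 /\ b = 6 by move: e1 b1 ev; clear; lia.
have partner x : x \in D -> exists2 y, y \in D & e x y.
  move=> xD; case: (boolP [exists v in D, e x v]) => [/exists_inP //|nx]; exfalso.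
  have : b < #|D|.
    rewrite -sum1_card /b (big_setD1 x) //= [X in _ < X](big_setD1 x) //= D_nb ?(subsetP DS) // (negPf nx) add0n add1n ltnS.
    by apply: leq_sum => y; rewrite in_setD1 => /andP[_ /(subsetP DS)]; apply: deg3_le1.
  by rewrite bD cD.
have partner_uniq x y z : x \in D -> y \in D -> z \in D -> e x y -> e x z -> y = z.
  rewrite !in_D => /andP[xS _] /andP[yS /eqP dy] /andP[zS /eqP dz]; exact: deg3_uniq.
(* The block of [x] consists of [x], its partner [y] in [D] and the two further neighbours of each.
   The three blocks will exhaust [S], since every vertex has a neighbour in [D]. *)
have block x : x \in D -> exists y l, [/\ y \in D, e x y, l = [:: x; y] ++ drop 2 l,
    size l = 6 /\ [seq dg v | v <- l] = [:: 3; 3; 4; 4; 4; 4]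
    & ({in S, forall v, e x v -> v \in l} /\ {in S, forall v, e y v -> v \in l}) /\ [&& e x (nth x l 2), e x (nth x l 3), e y (nth x l 4) & e y (nth x l 5)]].
  have rest u u' : u \in D -> u' \in D -> e u u' -> exists p q, [/\ dg p = 4, dg q = 4, e u p, e u q
      & {in S, forall v, e u v -> v \in [:: u'; p; q]}].
    move=> uD u'D uu'; move: (uD) (u'D); rewrite !in_D => /andP[uS /eqP du] /andP[u'S /eqP du'].
    have c : #|(nb u :&: S) :\ u'| = 2.
      by have := cardsD1 u' (nb u :&: S); rewrite -/(dg u) du !inE uu' u'S; clear; lia.
    have /cards2P[p [q [_ pq]]] : #|(nb u :&: S) :\ u'| == 2 by rewrite c.
    have d4 v : v \in (nb u :&: S) :\ u' -> dg v = 4.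
      rewrite !inE => /and3P[vu' uv vS]; case: (deg34 vS) => // dv.
      by move: vu'; rewrite (deg3_uniq vS u'S dv du' uS uv uu') eqxx.
    have ps : p \in (nb u :&: S) :\ u' by rewrite pq !inE eqxx.
    have qs : q \in (nb u :&: S) :\ u' by rewrite pq !inE eqxx orbT.
    exists p, q; rewrite (d4 p ps) (d4 q qs); move: ps qs; rewrite !inE => /and3P[_ -> _] /and3P[_ -> _].
    split=> // v vS uv; rewrite !inE; case: eqVneq => //= vu'.
    have : v \in (nb u :&: S) :\ u' by rewrite !inE vu' uv.
    by rewrite pq !inE.
  move=> xD; have [y yD xy] := partner x xD; have yx : e y x by rewrite es.
  have [p [q [dp dq xp xq hx]]] := rest x y xD yD xy.
  have [p' [q' [dp' dq' yp' yq' hy]]] := rest y x yD xD yx.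
  exists y, [:: x; y; p; q; p'; q']; split=> //=.
  - by move: xD yD; rewrite !in_D => /andP[_ /eqP->] /andP[_ /eqP->]; rewrite dp dq dp' dq'.
  - split; last by rewrite xp xq yp' yq'.
    by split=> v vS => [/(hx v vS)|/(hy v vS)]; rewrite !inE => /or3P[]->; rewrite ?orbT.
have [x0 x0D] : exists x, x \in D by apply/set0Pn; rewrite -card_gt0 cD.
have [y0 [l0 [y0D xy0 el0 [sl0 dl0] [[hx0 hy0] el0']]]] := block x0 x0D.
have ci (A : {set T}) x : x \in A -> #|A| = (#|A :\ x|).+1 by move=> xA; rewrite (cardsD1 x) xA.
have neq x y : e x y -> y != x by move=> xy; apply: contraTneq xy => ->; rewrite ei.
have y0D' : y0 \in D :\ x0 by rewrite in_setD1 neq.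
have c1 : #|D :\ x0 :\ y0| = 4.
  by have := ci _ _ x0D; have := ci _ _ y0D'; rewrite cD; clear; lia.
have [x1 x1D] : exists x, x \in D :\ x0 :\ y0 by apply/set0Pn; rewrite -card_gt0 c1.
move: (x1D); rewrite !in_setD1 => /and3P[x1y0 x1x0 x1D'].
have [y1 [l1 [y1D' xy1 el1 [sl1 dl1] [[hx1 hy1] el1']]]] := block x1 x1D'.
have y1D : y1 \in D :\ x0 :\ y0 :\ x1.
  rewrite !in_setD1 neq //= y1D' andbT; apply/andP; split.
    by apply/negP=> /eqP h; rewrite h in xy1; rewrite (partner_uniq y0 x1 x0) ?(es y0) ?eqxx in x1x0.
  by apply/negP=> /eqP h; rewrite h in xy1; rewrite (partner_uniq x0 x1 y0) ?(es x0 x1) ?eqxx in x1y0.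
have c2 : #|D :\ x0 :\ y0 :\ x1 :\ y1| = 2.
  by have := ci _ _ x1D; have := ci _ _ y1D; rewrite c1; clear; lia.
have [x2 x2D] : exists x, x \in D :\ x0 :\ y0 :\ x1 :\ y1 by apply/set0Pn; rewrite -card_gt0 c2.
move: (x2D); rewrite !in_setD1 => /and5P[x2y1 x2x1 x2y0 x2x0 x2D'].
have [y2 [l2 [y2D' xy2 el2 [sl2 dl2] [[hx2 hy2] el2']]]] := block x2 x2D'.
have y2D : y2 \in D :\ x0 :\ y0 :\ x1 :\ y1 :\ x2.
  rewrite !in_setD1 neq //= y2D' andbT; apply/and4P; split.
  - by apply/negP=> /eqP h; rewrite h in xy2; rewrite (partner_uniq y1 x2 x1) ?(es y1) ?eqxx in x2x1.
  - by apply/negP=> /eqP h; rewrite h in xy2; rewrite (partner_uniq x1 x2 y1) ?(es x1 x2) ?eqxx in x2y1.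
  - by apply/negP=> /eqP h; rewrite h in xy2; rewrite (partner_uniq y0 x2 x0) ?(es y0) ?eqxx in x2x0.
  - by apply/negP=> /eqP h; rewrite h in xy2; rewrite (partner_uniq x0 x2 y0) ?(es x0 x2) ?eqxx in x2y0.
have c3 : #|D :\ x0 :\ y0 :\ x1 :\ y1 :\ x2 :\ y2| = 0.
  by have := ci _ _ x2D; have := ci _ _ y2D; rewrite c2; clear; lia.
have De x : x \in D -> x \in [:: x0; y0; x1; y1; x2; y2].
  move=> xD; apply/negPn/negP=> nx; have : x \in D :\ x0 :\ y0 :\ x1 :\ y1 :\ x2 :\ y2.
    by move: nx; rewrite !in_setD1 xD !inE !negb_or andbT => /and5P[-> -> -> -> /andP[-> ->]].
  by rewrite (cards0_eq c3) inE.
have sl : size (l0 ++ l1 ++ l2) = 18 by rewrite !size_cat sl0 sl1 sl2.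
apply: N7; apply: (@refutes_cover _ _ g5 x0 S (l0 ++ l1 ++ l2) sixdegs 400 six18).
- by rewrite sl cS.
- have cov d : d \in D -> {in S, forall x, e d x -> x \in l0 ++ l1 ++ l2}.
    move=> /De; rewrite !inE => hd x xS dx; rewrite !mem_cat; move: hd dx.
    by do ![case/orP=> [/eqP->|]] => [/(hx0 x xS)|/(hy0 x xS)|/(hx1 x xS)|/(hy1 x xS)|/(hx2 x xS)|/eqP-> /(hy2 x xS)] ->;
       rewrite ?orbT.
  move=> x xS; case: (deg34 xS) => dx.
    have xD : x \in D by rewrite in_D xS dx.
    by have [y yD xy] := partner x xD; apply: (cov y yD x xS); rewrite es.
  by have [y yD xy] := h4 x xS dx; apply: (cov y yD x xS); rewrite es.
- by rewrite !map_cat dl0 dl1 dl2.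
- move: el0' el1' el2'; case: l0 el0 sl0 {dl0 hx0 hy0 sl} => [//|? [//|? [|? [|? [|? [|? []]]]]]] // [-> ->] _.
  case: l1 el1 sl1 {dl1 hx1 hy1} => [//|? [//|? [|? [|? [|? [|? []]]]]]] // [-> ->] _.
  case: l2 el2 sl2 {dl2 hx2 hy2} => [//|? [//|? [|? [|? [|? [|? []]]]]]] // [-> ->] _ /=.
  by rewrite xy0 xy1 xy2 => /and4P[-> -> -> ->] /and4P[-> -> -> ->] /and4P[-> -> -> ->].
- by rewrite sl; exact: six18_ok.
Qed.

Section Tree.
Variable r : T.
Hypotheses (rS : r \in S) (dr : dg r = 4) (dN : forall g, g \in S -> e r g -> dg g = 4).
Let N := nb r :&: S.
Let B := [set x in S | [|| x == r, e r x | [exists g in N, e g x]]].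
Let in_N g : (g \in N) = e r g && (g \in S). Proof. by rewrite !inE. Qed.
Let in_B x : (x \in B) = (x \in S) && [|| x == r, e r x | [exists g in N, e g x]].
Proof. by rewrite inE. Qed.

(** The Moore bound inside [B] gives at least 17, and counting with repetition gives at most 1 + 4 +
    12. *)
Lemma ball_card : #|B| = 17.
Proof.
have BS : B \subset S by apply/subsetP=> x; rewrite in_B => /andP[].
have rB : r \in B by rewrite in_B rS eqxx.
have eN : nb r :&: B = N.
  by apply/setP=> g; rewrite in_setI in_nb in_N in_B; case: (e r g); rewrite //= orbT andbT.
apply/eqP; rewrite eqn_leq; apply/andP; split; last first.
  have := deg_nb_sum g5 rB; rewrite eN (eq_bigr (fun=> 4)) ?sum_nat_const ?[#|N|]dr // => g.
  rewrite in_N => /andP[rg gS]; rewrite -(dN gS rg) /deg; apply: eq_card => x.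
  rewrite !in_setI in_nb in_B; case gx: (e g x) => //=; case: (x \in S) => //=.
  by apply/or3P/Or33/exists_inP; exists g; rewrite // in_N rg.
have sub : B \subset r |: (N :|: \bigcup_(g in N) (nb g :&: S :\ r)).
  apply/subsetP=> x; rewrite in_B in_setU1 in_setU in_N => /andP[xS].
  rewrite xS andbT => /or3P[->//|->|/exists_inP[g gN gx]]; first by rewrite orbT.
  case: eqVneq => //= xr; apply/orP; right; apply/bigcupP; exists g => //.
  by rewrite in_setD1 xr in_setI in_nb gx.
apply: leq_trans (subset_leq_card sub) _.
have [h1 _] := leq_card_setU [set r] (N :|: \bigcup_(g in N) (nb g :&: S :\ r)).
have [h2 _] := leq_card_setU N (\bigcup_(g in N) (nb g :&: S :\ r)).
have h3 : #|\bigcup_(g in N) (nb g :&: S :\ r)| <= \sum_(g in N) 3.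
  apply: (big_rec2 (fun (A : {set T}) m => #|A| <= m)); first by rewrite cards0.
  move=> g A m gN le; have [h _] := leq_card_setU (nb g :&: S :\ r) A.
  apply: leq_trans h _; apply: leq_add le.
  rewrite in_N in gN; case/andP: gN => rg gS; rewrite -ltnS -(dN gS rg).
  by rewrite /deg [X in _ < X](cardsD1 r) in_setI in_nb es rg rS.
rewrite sum_nat_const in h3; have cN : #|N| = 4 := dr.
by move: h1 h2 h3; rewrite cards1 cN; clear; lia.
Qed.

(* The ball of radius 2 about [r] has 17 vertices and misses a single vertex [z]. *)
Lemma tree_false : False.
Proof.
have BS : B \subset S by apply/subsetP=> x; rewrite in_B => /andP[].
have cZ : #|S :\: B| == 1 by rewrite cardsD (setIidPr BS) cS ball_card.
have /cards1P[z eZ] := cZ.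
have : z \in S :\: B by rewrite eZ set11.
rewrite in_setD => /andP[zB zS].
have other x : x \in S -> x != z -> x \in B.
  move=> xS xz; apply/negPn/negP=> xB; have : x \in S :\: B by rewrite in_setD xB.
  by rewrite eZ in_set1 (negPf xz).
have [zr rz Nz] : [/\ z != r, ~~ e r z & forall g, g \in N -> ~~ e g z].
  move: zB; rewrite in_B zS /= !negb_or => /and3P[-> -> h]; split=> // g gN.
  by apply: contra h => gz; apply/exists_inP; exists g.
pose P g := [exists x in S, e g x && e z x].
have zg g : g \in N -> z != g by apply: contraTneq => <-; rewrite in_N (negPf rz).
(* Of the three neighbours of [g] other than [r], [a] is the one adjacent to [z] if there is one. At
   most one of the three has degree 3; [b] and [c] are ordered so that it is never [c], and [o]
   records which one it is. *)
have block g : g \in N -> exists a b c o, [/\ [&& e g a, e g b & e g c], (P g -> e z a),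
    [/\ dg a = 4 - (o == 0), dg b = 4 - (o == 1) & dg c = 4], o < 3
    & {in S, forall x, e g x -> x \in [:: r; a; b; c]}].
  move=> gN; move: (gN); rewrite in_N => /andP[rg gS].
  pose C := (nb g :&: S) :\ r.
  have in_C x : (x \in C) = [&& x != r, e g x & x \in S] by rewrite in_setD1 in_setI in_nb.
  have cC : #|C| = 3 by have := dN gS rg; rewrite /deg (cardsD1 r) in_setI in_nb es rg rS => -[].
  have [a aC Pa] : exists2 a, a \in C & P g -> e z a.
    case: (boolP (P g)) => [/exists_inP[x xS /andP[gx zx]]|nP].
      exists x => //; rewrite in_C gx xS !andbT; apply: contraTneq zx => ->; by rewrite es.
    have /card_gt0P[a aC] : 0 < #|C| by rewrite cC.
    by exists a.
  have c2 : #|C :\ a| == 2 by move: cC; rewrite (cardsD1 a) aC add1n => -[->].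
  have [b [c [cb dc eC]]] : exists b c, [/\ b != c, dg c = 4 & C :\ a = [set b; c]].
    case/cards2P: c2 => b [c [bc eC]].
    have : b \in C :\ a by rewrite eC !inE eqxx.
    have : c \in C :\ a by rewrite eC !inE eqxx orbT.
    rewrite !in_setD1 !in_setI !in_nb => /and4P[_ _ gc cS'] /and4P[_ _ gb bS].
    case: (deg34 cS') => dc; last by exists b, c.
    case: (deg34 bS) => db; last by exists c, b; rewrite eq_sym setUC.
    by rewrite (deg3_uniq bS cS' db dc gS gb gc) eqxx in bc.
  have : b \in C :\ a by rewrite eC !inE eqxx.
  have : c \in C :\ a by rewrite eC !inE eqxx orbT.
  move: (aC); rewrite !in_setD1 !in_setI !in_nb => /and3P[_ ga aS] /and4P[_ _ gc cS'] /and4P[ba _ gb bS].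
  have cov : {in S, forall x, e g x -> x \in [:: r; a; b; c]}.
    move=> x xS gx; rewrite !inE; case: eqVneq => //= xr; case: eqVneq => //= xa.
    have : x \in C :\ a by rewrite in_setD1 xa in_C xr gx.
    by rewrite eC !inE.
  case: (deg34 aS) => da; case: (deg34 bS) => db.
  - by rewrite (deg3_uniq aS bS da db gS ga gb) eqxx in ba.
  - by exists a, b, c, 0; rewrite ga gb gc da db dc.
  - by exists a, b, c, 1; rewrite ga gb gc da db dc.
  - by exists a, b, c, 2; rewrite ga gb gc da db dc.
(* Every neighbour of [z] lies below exactly one [g], and no [g] has two of them below it, as this
   would be a 4-cycle. *)
have cP : count P (enum N) = dg z.
  have -> : count P (enum N) = \sum_(g in N) #|nb g :&: (nb z :&: S)|.
    rewrite -sum1_count big_enum_cond big_mkcondr /=; apply: eq_bigr => g gN.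
    have c1 : #|nb g :&: (nb z :&: S)| <= 1.
      apply/card_le1_eqP=> x y; rewrite !in_setI !in_nb => /and3P[gx zx _] /and3P[gy zy _].
      by rewrite (C4 (zg g gN) zx gx zy gy).
    case: ifP => [/exists_inP[x xS /andP[gx zx]]|nP].
      apply/eqP; rewrite eq_sym eqn_leq c1 card_gt0; apply/set0Pn; exists x.
      by rewrite !in_setI !in_nb gx zx.
    apply/esym/eqP; rewrite cards_eq0; apply/negPn/negP=> /set0Pn[x].
    rewrite !in_setI !in_nb => /and3P[gx zx xS]; case/negP: (negbT nP).
    by apply/exists_inP; exists x; rewrite ?gx.
  rewrite (eq_bigr (fun g => \sum_(x in nb z :&: S) (e g x : nat))); last first.
    move=> g _; rewrite -sum1_card big_mkcond [RHS]big_mkcond /=; apply: eq_bigr => x _.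
    by rewrite in_setI in_nb; case: (e g x) (x \in _) => [] [].
  rewrite exchange_big /= /deg -sum1_card; apply: eq_bigr => x; rewrite in_setI in_nb => /andP[zx xS].
  have xz : x != z by apply: contraTneq zx => ->; rewrite ei.
  move: (other x xS xz); rewrite in_B xS /= => /or3P[/eqP h|h|/exists_inP[g gN gx]].
  - by rewrite h es (negPf rz) in zx.
  - by have := Nz x; rewrite in_N h xS es zx => /(_ isT).
  rewrite (bigD1 g) //= gx big1 ?addn0 // => g' /andP[g'N gg']; apply/eqP; rewrite eqb0; apply/negP=> g'x.
  move: gN g'N; rewrite !in_N => /andP[rg _] /andP[rg' _].
  have := C4 gg' _ _ g'x gx => /(_ r); rewrite !(es _ r) => /(_ rg' rg) h.
  by move: zx rz; rewrite es h => ->.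
(* The branches met by [z] come first, as [zedges] expects. *)
pose gs := filter P (enum N) ++ filter (predC P) (enum N).
have gsN g : (g \in gs) = (g \in N).
  by rewrite /gs mem_cat (mem_filter P) (mem_filter (predC P)) !mem_enum /=; case: (P g); rewrite ?orbF.
have sgs : size gs = 4 by rewrite size_cat !size_filter count_predC -cardE; exact: dr.
have Pgs : all P (take (dg z) gs) by rewrite take_size_cat ?filter_all // size_filter.
case: gs sgs gsN Pgs => [|g1 [|g2 [|g3 [|g4 []]]]] // _ gsN Pgs.
have gN i : i < 4 -> nth g1 [:: g1; g2; g3; g4] i \in N by move=> li; rewrite -gsN mem_nth.
have [a1 [b1 [c1 [o1 [gc1 za1 [da1 db1 dc1] lo1 cov1]]]]] := block g1 (gN 0 isT).
have [a2 [b2 [c2 [o2 [gc2 za2 [da2 db2 dc2] lo2 cov2]]]]] := block g2 (gN 1 isT).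
have [a3 [b3 [c3 [o3 [gc3 za3 [da3 db3 dc3] lo3 cov3]]]]] := block g3 (gN 2 isT).
have [a4 [b4 [c4 [o4 [gc4 za4 [da4 db4 dc4] lo4 cov4]]]]] := block g4 (gN 3 isT).
pose l := [:: r; g1; g2; g3; g4; a1; b1; c1; a2; b2; c2; a3; b3; c3; a4; b4; c4; z].
have Sl : {subset S <= l}.
  move=> x xS; case: (eqVneq x z) => [->|xz]; first by rewrite !inE eqxx !orbT.
  move: (other x xS xz); rewrite in_B xS /= => /or3P[/eqP ->|rx|/exists_inP[g gN' gx]].
  - by rewrite !inE eqxx.
  - have : x \in [:: g1; g2; g3; g4] by rewrite gsN in_N rx.
    by rewrite !inE => /or4P[]->; rewrite ?orbT.
  - move: gN'; rewrite -gsN !inE => /or4P[]/eqP h; rewrite {}h in gx;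
      [move: (cov1 x xS gx)|move: (cov2 x xS gx)|move: (cov3 x xS gx)|move: (cov4 x xS gx)];
      rewrite !inE => /or4P[]->; by rewrite ?orbT.
have sl : size l = #|S| by rewrite cS.
have dl : [seq dg v | v <- l] = degs18 (dg z) [:: o1; o2; o3; o4].
  have dgN g : g \in N -> dg g = 4 by rewrite in_N => /andP[rg gS]; apply: dN.
  rewrite /= dr (dgN _ (gN 0 isT)) (dgN _ (gN 1 isT)) (dgN _ (gN 2 isT)) (dgN _ (gN 3 isT)).
  by rewrite da1 da2 da3 da4 db1 db2 db3 db4 dc1 dc2 dc3 dc4.
have oo : [:: o1; o2; o3; o4] \in options4.
  by case: o1 lo1 {da1 db1 dl} => [|[|[|]]] // _; case: o2 lo2 {da2 db2} => [|[|[|]]] // _;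
     case: o3 lo3 {da3 db3} => [|[|[|]]] // _; case: o4 lo4 {da4 db4} => [|[|[|]]].
have ev : ~~ odd (sumn (degs18 (dg z) [:: o1; o2; o3; o4])).
  have [ul eS] := cover_uniq sl Sl.
  rewrite -dl sumnE big_map big_uniq //=.
  have := deg_sum_even g5 S; congr (~~ odd _); apply: eq_bigl => x; rewrite {1}eS inE; done.
have mz : dg z \in [:: 3; 4] by case: (deg34 zS) => ->.
have := tree_okT mz oo; rewrite /tree_ok (negPf ev) => ok.
apply: N7; apply: (refutes_cover g5 (v0 := r) sl Sl dl) ok.
have rN i : i < 4 -> e r (nth g1 [:: g1; g2; g3; g4] i) by move/gN; rewrite in_N => /andP[].
move: Pgs gc1 gc2 gc3 gc4 => + /and3P[x1 x2 x3] /and3P[x4 x5 x6] /and3P[x7 x8 x9] /and3P[x10 x11 x12].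
case: (deg34 zS) => -> /=.
  case/and4P=> /za1 h1 /za2 h2 /za3 h3 _.
  by rewrite (rN 0 isT) (rN 1 isT) (rN 2 isT) (rN 3 isT) x1 x2 x3 x4 x5 x6 x7 x8 x9 x10 x11 x12 h1 h2 h3.
case/and5P=> /za1 h1 /za2 h2 /za3 h3 /za4 h4 _.
by rewrite (rN 0 isT) (rN 1 isT) (rN 2 isT) (rN 3 isT) x1 x2 x3 x4 x5 x6 x7 x8 x9 x10 x11 x12 h1 h2 h3 h4.
Qed.
End Tree.

(** A vertex of degree 4 without a neighbour in [D] would be a root as in [tree_false]; so none
    exists, which is the hypothesis of [paired_case]. *)
Lemma Ramsey18_false : False.
Proof.
apply: paired_case => r rS dr.
case: (boolP [exists v in D, e r v]) => [/exists_inP //|h]; exfalso.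
apply: (@tree_false r rS dr) => g gS rg; case: (deg34 gS) => // dg3.
by case/exists_inP: h; exists g; rewrite // in_D gS dg3.
Qed.
End Ramsey18.

Lemma alpha_dec (T : finType) (e : rel T) k S : alpha_ge e k S \/ ~ alpha_ge e k S.
Proof.
case: (boolP [exists I : {set T}, [&& I \subset S, indep e I & k <= #|I|]]) => [/existsP[I /and3P h]|h].
  by left; exists I.
by right=> -[I [h1 h2 h3]]; case/existsP: h; exists I; rewrite h1 h2.
Qed.

Lemma Ramsey7 (T : finType) (e : rel T) : girth5 e -> Ramsey e 18 7.
Proof.
move=> g5; apply: Ramsey_exact => S cS.
by case: (alpha_dec e 7 S) => // /(Ramsey18_false g5 cS).
Qed.

(** * Two independent classes with small complement *)

(* What a [minimal] pair of independent classes (below) implies for its complement [O]. If [private w c],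
   then [w] has a single neighbour [y] in class [c], and [line w c] consists of the other neighbours of [y]
   in [O]; [six w] says that [w] has degree 6 in the whole graph. *)
Record residual (T : finType) (e : rel T) (O : {set T}) (line : T -> bool -> {set T})
  (private : T -> bool -> bool) (six : T -> bool) (far : rel T) : Prop := Residual {
  res_card : #|O| <= 12;
  res_odd : forall f : T -> bool, ~ {in O &, forall u v, e u v -> f u != f v};
  res_deg : {in O, forall w, deg e O w <= 3};
  res_sub : forall w c, line w c \subset O :\ w;
  res_far1 : forall w c, w \in O -> private w c -> {in line w c, forall u, far w u};
  res_far2 : forall w c, w \in O -> private w c -> {in line w c &, forall u u', u != u' -> far u u'};
  res_ge : forall w c, w \in O -> private w c -> deg e O w <= #|line w c|;
  res_pot : forall w c, w \in O -> private w c -> #|line w c| = deg e O w ->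
    \sum_(u in line w c) 2 ^ deg e O u <= \sum_(q in nb e w :&: O) 2 ^ (deg e O q).-1;
  res_kick : forall w c (f : T -> bool), w \in O -> private w c ->
    {in O :\ w &, forall u v, e u v -> f u != f v} ->
    exists u u', [/\ u \in line w c, u' \in line w c & f u != f u'];
  res_meet : forall w w' c c', w \in O -> w' \in O -> private w c -> private w' c' ->
    (w, c) != (w', c') -> #|(w |: line w c) :&: (w' |: line w' c')| <= 1;
  res_three : {in O, forall w, deg e O w = 3 -> ~~ six w ->
    [/\ private w true, private w false & \sum_(q in nb e w :&: O) deg e O q <= 5]};
  res_sum : {in O, forall w, deg e O w = 3 -> \sum_(q in nb e w :&: O) deg e O q <= 8};
  res_six : {in O, forall w, deg e O w = 3 -> exists2 c, private w c &
    forall f : T -> bool, {in O :\ w &, forall u v, e u v -> f u != f v} ->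
    exists u u', [/\ u \in O :\: line w c, u' \in O :\: line w c, far w u, far w u' & far u u']};
  res_two : {in O, forall w, deg e O w = 2 -> ~~ six w -> exists c, private w c};
  res_match : {in O, forall w, six w -> #|[set u in nb e w | six u]| <= 1} }.

(* The hypotheses say that [K] spans a pentagon which is a component of [O]; [f] colours the rest of [O].
   Each vertex [w] of [K] and each class yields a vertex seeing two vertices of different colours outside
   [K], and these ten pairs are distinct. *)
Definition pentagon_free (T : finType) (e : rel T) (O : {set T}) (far : rel T) : Prop :=
  forall (K : {set T}) (f : T -> bool), K \subset O -> #|K| = 5 ->
  {in K & O, forall u v, e u v -> v \in K} -> {in K &, forall u v, ~~ far u v} ->
  {in K, forall w, exists g : T -> bool, {in K :\ w &, forall u v, e u v -> g u != g v}} ->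
  {in O :\: K &, forall u v, e u v -> f u != f v} ->
  #|[set p : T * T | [&& p.1 \in O :\: K, p.2 \in O :\: K, f p.1, ~~ f p.2 & ~~ e p.1 p.2]]| <= 9 -> False.

(** * Existence of a minimal pair of classes *)

Section Graph.
Variables (T : finType) (e : rel T).
Hypothesis g5 : girth5 e.
Let es : symmetric e. Proof. by case: g5. Qed.
Let ei : irreflexive e. Proof. by case: g5. Qed.
Let tri x y z : e x y -> e y z -> e x z = false. Proof. by case: g5 => _ _ + _; apply. Qed.
Let C4 x z y t : x != z -> e x y -> e z y -> e x t -> e z t -> y = t.
Proof. by case: g5 => _ _ _; apply. Qed.
Local Notation nb := (nb e).
Local Notation deg := (deg e).
Local Notation indep := (indep e).
Local Notation alpha_ge := (alpha_ge e).
Implicit Types (u v w x y z : T) (A B S O : {set T}) (I : bool -> {set T}) (f : T -> bool).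

Definition independent_pair I := [/\ indep (I true), indep (I false) & [disjoint I true & I false]].
Definition rest I := ~: (I true :|: I false).
Definition degsum O := \sum_(u in O) deg O u.
(* Breaks ties between complements with equally many edges. *)
Definition potential O := \sum_(u in O) 2 ^ deg O u.
Definition two_colours f A := {in A &, forall u v, e u v -> f u != f v}.
Definition far O u v := [&& u != v, ~~ e u v & [forall z in O, ~~ (e u z && e v z)]].

Definition minimal I := forall I', independent_pair I' ->
  #|rest I| <= #|rest I'| /\ (#|rest I'| = #|rest I| -> degsum (rest I) <= degsum (rest I') /\
    (degsum (rest I') = degsum (rest I) -> potential (rest I') <= potential (rest I))).

Lemma small_rest S : #|S| <= 19 -> exists A, [/\ A \subset S, indep A & #|S :\: A| <= 12].
Proof.
have go k : alpha_ge k S -> #|S| <= k + 12 -> exists A, [/\ A \subset S, indep A & #|S :\: A| <= 12].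
  move=> [A [AS iA kA]] le; exists A; split=> //; rewrite cardsD (setIidPr AS).
  by clear -le kA; lia.
move=> le; case: (leqP 18 #|S|) => [/(Ramsey7 g5)/go|h18]; first by apply.
case: (leqP 15 #|S|) => [/(Ramsey6 g5)/go|h15]; first by apply; clear -h18; lia.
case: (leqP 11 #|S|) => [/(Ramsey5 g5)/go|h11]; first by apply; clear -h15; lia.
exists set0; rewrite sub0set setD0; split=> //; first by apply/indepP=> x y; rewrite inE.
by apply: leq_trans (_ : 10 <= 12).
Qed.

Lemma pair_le A S : indep A -> #|~: A| <= 19 -> exists I, independent_pair I /\ #|rest I| <= 12.
Proof.
move=> iA /small_rest[B [BA iB cB]]; exists (fun c => if c then A else B).
rewrite /rest /independent_pair setCU -setDE; split=> //; split=> //.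
by rewrite disjoint_sym disjoints_subset.
Qed.

Lemma card_nb v : #|nb v| = deg setT v. Proof. by rewrite /deg setIT. Qed.

(** Since 19 = 7 + 12, a first class with a complement of at most 19 vertices suffices; after
    [23 -> 8] only 28 vertices remain. There a vertex of degree 4 yields nine independent ones, and
    otherwise the Moore bound makes the graph 5-regular. *)
Lemma ex_pair : #|T| <= 28 -> (forall v, 4 <= deg setT v) ->
  exists I, independent_pair I /\ #|rest I| <= 12.
Proof.
move=> n28 d4; have cC A k : k <= #|A| -> #|T| <= k + 19 -> #|~: A| <= 19.
  by have := cardsC A; clear; lia.
case: (leqP #|T| 19) => [h19|h19].
  apply: (@pair_le set0 set0); last by apply: cC (leq0n _) h19.
  by apply/indepP=> x y; rewrite inE.
case: (leqP 23 #|T|) => [h23|h23]; last first.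
  have [A [_ iA kA]] : alpha_ge 7 setT by apply: (Ramsey7 g5); rewrite cardsT; clear -h19; lia.
  by apply: (pair_le setT iA); apply: cC kA _; clear -h23; lia.
case: (leqP #|T| 27) => [h27|h27].
  have [A [_ iA kA]] : alpha_ge 8 setT by apply: (Ramsey8 g5 (Ramsey7 g5)); rewrite cardsT.
  by apply: (pair_le setT iA); apply: cC kA _; clear -h27; lia.
have cT : #|T| = 28 by clear -n28 h27; lia.
case: (boolP [exists v, deg setT v <= 4]) => [/existsP[v dv]|].
  have [A [_ iA kA]] : alpha_ge 9 setT.
    apply: (Ramsey_step g5 (Ramsey8 g5 (Ramsey7 g5)) (in_setT v)).
    by rewrite cardsT cT; clear -dv; lia.
  by apply: (pair_le setT iA); apply: cC kA _; clear -n28; lia.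
rewrite negb_exists => /forallP n4.
have d5 v : deg setT v = 5.
  have ge u : 5 <= deg setT u by rewrite ltnNge n4.
  have := moore g5 (in_setT v) (c := 5) (d := deg setT v) (fun u _ => ge u) (leqnn _).
  by rewrite cardsT cT; have := ge v; clear; lia.
have [w _] : exists w : T, true by have /card_gt0P[w _] : 0 < #|T| by rewrite cT. 
have /card_gt0P[u] : 0 < #|nb w| by rewrite card_nb d5.
rewrite in_nb => wu; have uw : e u w by rewrite es.
(* These eight vertices around the edge are independent by girth 5. None of the 18 vertices other
   than these and [w], [u] is adjacent to [w], so [w] extends seven independent ones among them to a
   second class of eight: 28 = 8 + 8 + 12. *)
pose A := (nb w :\ u) :|: (nb u :\ w).
have iA : indep A.
  have cross x y : x \in nb w :\ u -> y \in nb u :\ w -> ~~ e x y.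
    rewrite !in_setD1 !in_nb => /andP[xu wx] /andP[yw uy]; apply/negP=> xy.
    have wy : w != y by rewrite eq_sym.
    have := C4 wy wu; rewrite (es y u) => /(_ x uy wx); rewrite es => /(_ xy) h.
    by rewrite h eqxx in xu.
  apply/indepP=> x y; rewrite !in_setU => /orP[]hx /orP[]hy.
  - by move: hx hy; rewrite !in_setD1 => /andP[_ hx] /andP[_ hy]; apply: (indepP (indep_nb g5 w)).
  - exact: cross.
  - by rewrite es; apply: cross.
  - by move: hx hy; rewrite !in_setD1 => /andP[_ hx] /andP[_ hy]; apply: (indepP (indep_nb g5 u)).
have cA : #|A| = 8.
  have c1 : #|nb w :\ u| = 4 by have := cardsD1 u (nb w); rewrite card_nb d5 in_nb wu; clear; lia.
  have c2 : #|nb u :\ w| = 4 by have := cardsD1 w (nb u); rewrite card_nb d5 in_nb uw; clear; lia.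
  rewrite cardsU c1 c2; suff -> : (nb w :\ u) :&: (nb u :\ w) = set0 by rewrite cards0.
  apply/setP=> x; rewrite in_setI !in_setD1 !in_nb inE; apply/negP=> /andP[/andP[_ wx] /andP[_ ux]].
  by move: (tri uw wx); rewrite ux.
pose R := ~: (A :|: [set w; u]).
have wuA : A :&: [set w; u] = set0.
  apply/setP=> x; rewrite in_setI in_set2 /A in_setU !in_setD1 !in_nb inE; apply/negP.
  by move=> /andP[/orP[]/andP[xn ex] /orP[]/eqP xe]; move: ex xn; rewrite xe ?ei ?eqxx.
have cR : #|R| = 18.
  have := cardsC (A :|: [set w; u]); rewrite cardsU wuA cards0 cA cards2 cT -/R.
  by rewrite (_ : w != u); [clear; lia | apply: contraTneq wu => ->; rewrite ei].
have [J [JR iJ cJ]] : alpha_ge 7 R by apply: (Ramsey7 g5); rewrite cR.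
have nJ x : x \in J -> [/\ x \notin A, x != w & ~~ e w x].
  move/(subsetP JR); rewrite in_setC in_setU in_set2 !negb_or => /and3P[xA xw xu]; split=> //.
  by apply: contra xA => wx; rewrite in_setU in_setD1 xu in_nb wx.
have wJ : w \notin J by apply/negP=> /nJ[_]; rewrite eqxx.
exists (fun c => if c then A else w |: J); split.
  split=> //.
    apply/indepP=> x y; rewrite !in_setU1 => /predU1P[->|xJ] /predU1P[->|yJ]; rewrite ?ei //.
    - by case: (nJ y yJ).
    - by rewrite es; case: (nJ x xJ).
    - exact: (indepP iJ).
  apply/pred0P=> x /=; apply/negP=> /andP[xA]; rewrite in_setU1 => /predU1P[xw|/nJ[]]; last by rewrite xA.
  by have := in_set0 x; rewrite -wuA in_setI xA xw set21.
rewrite /rest; have cc := cardsC (A :|: (w |: J)); rewrite cT cardsU cA cardsU1 wJ in cc.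
suff e0 : A :&: (w |: J) = set0 by move: cc; rewrite e0 cards0; clear -cJ; lia.
apply/setP=> x; rewrite in_setI in_setU1 in_set0; apply/negP=> /andP[xA /predU1P[xw|/nJ[]]]; last by rewrite xA.
by have := in_set0 x; rewrite -wuA in_setI xA xw set21.
Qed.

Lemma lex_le (a b a' b' K : nat) : b <= K -> b' <= K -> a * K.+1 + b <= a' * K.+1 + b' ->
  a <= a' /\ (a' = a -> b <= b').
Proof. by move=> hb hb' h; split; [nia|move=> eq; rewrite eq leq_add2l in h]. Qed.

(** The three criteria are packed into one number in mixed radix, [D] and [P] bounding the lower
    digits; the potential is to be maximal and so enters as [P - potential O]. *)
Lemma ex_minimal I0 : independent_pair I0 -> exists I, [/\ independent_pair I, minimal I & #|rest I| <= #|rest I0|].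
Proof.
pose good (p : {ffun bool -> {set T}}) := [&& indep (p true), indep (p false) & [disjoint p true & p false]].
pose D := #|T| * #|T|; pose P := #|T| * 2 ^ #|T|.
have degT O u : deg O u <= #|T| by apply: max_card.
have bD O : degsum O <= D.
  apply: (@leq_trans (\sum_(u in O) #|T|)); first by apply: leq_sum.
  by rewrite sum_nat_const leq_mul2r max_card orbT.
have bP O : potential O <= P.
  apply: (@leq_trans (\sum_(u in O) 2 ^ #|T|)); first by apply: leq_sum => u _; rewrite leq_exp2l.
  by rewrite sum_nat_const leq_mul2r max_card orbT.
pose m (O : {set T}) := (#|O| * D.+1 + degsum O) * P.+1 + (P - potential O).
have mP O O' : m O <= m O' -> #|O| <= #|O'| /\ (#|O'| = #|O| -> degsum O <= degsum O' /\
    (degsum O' = degsum O -> potential O' <= potential O)).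
  move/(lex_le (leq_subr _ _) (leq_subr _ _))=> [/(lex_le (bD O) (bD O'))[h1 h2] h3]; split=> // eO.
  split=> [|eD]; first exact: h2.
  by move: h3; rewrite eO eD => /(_ erefl); have := bP O; have := bP O'; clear; lia.
move=> [g1 g2 g3]; have gI0 : good [ffun c => I0 c] by rewrite /good !ffunE g1 g2.
case: (arg_minnP (fun p : {ffun bool -> {set T}} => m (rest p)) gI0) => p /and3P[p1 p2 p3] pm.
have ffI I : rest [ffun c => I c] = rest I by rewrite /rest !ffunE.
have pm' I : independent_pair I -> m (rest p) <= m (rest I).
  by move=> [i1 i2 i3]; have := pm [ffun c => I c]; rewrite ffI; apply; rewrite /good !ffunE i1 i2.
exists (fun c => p c); split=> // [I' /pm'/mP //|].
by have /mP[] : m (rest p) <= m (rest I0) by apply: pm'.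
Qed.

(** * Local structure of the complement of a minimal pair *)

Section Local.
Variable I : bool -> {set T}.
Hypotheses (gI : independent_pair I) (mI : minimal I).
Hypothesis not4 : forall c : T -> nat, (forall x, c x < 4) -> exists x y, e x y /\ c x = c y.
Hypotheses (d4 : forall v, 4 <= deg setT v) (n28 : #|T| <= 28).
Let O := rest I.

Let indI c : indep (I c). Proof. by case: gI; case: c. Qed.
Let disI c x : x \in I c -> x \in I (~~ c) = false.
Proof.
case: gI => _ _ /pred0P d; case: c => /= h; apply/negP=> h'; by have := d x; rewrite /= ?h ?h'.
Qed.
Let sameI c c' x : x \in I c -> x \in I c' -> c = c'.
Proof. by move=> /disI + h'; case: c c' h' => [] [] //= ->. Qed.
Let in_O x : (x \in O) = (x \notin I true) && (x \notin I false).
Proof. by rewrite /O in_setC in_setU negb_or. Qed.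
Let OI c x : x \in O -> x \in I c = false.
Proof. by rewrite in_O => /andP[/negbTE h /negbTE h']; case: c. Qed.
Let in_Oc c x : (x \in O) = (x \notin I c) && (x \notin I (~~ c)).
Proof. by rewrite in_O; case: c; rewrite // andbC. Qed.

Lemma exchange c A : indep A -> [disjoint A & I (~~ c)] ->
  let O' := ~: (A :|: I (~~ c)) in
  #|O| <= #|O'| /\ (#|O'| = #|O| -> degsum O <= degsum O' /\
    (degsum O' = degsum O -> potential O' <= potential O)).
Proof.
move=> iA dA /=; have := mI (I' := fun d => if c then if d then A else I false else if d then I true else A).
rewrite -/O /rest /independent_pair; case: c dA => /= dA.
  by apply; split=> //; apply: indI.
by rewrite [A :|: _]setUC; apply; split; rewrite ?(disjoint_sym (I true)) //; apply: indI.
Qed.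

Lemma touch w c : w \in O -> exists2 y, y \in I c & e w y.
Proof.
move=> wO; case: (boolP [exists y in I c, e w y]) => [/exists_inP //|].
rewrite negb_exists_in => /forall_inP h; exfalso.
have iA : indep (w |: I c).
  apply/indepP=> x y; rewrite !in_setU1 => /predU1P[->|xI] /predU1P[->|yI]; rewrite ?ei ?h //.
    by rewrite es h.
  exact: (indepP (indI c)).
have := exchange iA (c := c) _; case=> [|le _].
  apply/pred0P=> x /=; rewrite in_setU1; apply/negP=> /andP[/predU1P[->|xI]]; first by rewrite OI.
  by rewrite disI.
suff : ~: ((w |: I c) :|: I (~~ c)) \proper O by move/proper_card; rewrite ltnNge le.
apply/properP; split; last by exists w => //; rewrite !inE eqxx.
apply/subsetP=> x; rewrite in_O !inE !negb_or -andbA => /and3P[_]; by case: c {h iA le} => /= -> ->.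
Qed.

(* Otherwise [w] could join class [c], its former neighbours there taking one of the two colours of [f]. *)
Lemma kick w c f : w \in O -> two_colours f (O :\ w) -> exists y u u',
  [/\ y \in I c, e w y, e y u /\ e y u', (u \in O :\ w) /\ (u' \in O :\ w) & f u != f u'].
Proof.
move=> wO pf.
case: (boolP [exists y in I c, e w y && [exists u in O :\ w, e y u && [exists u' in O :\ w, e y u' && (f u != f u')]]]).
  case/exists_inP=> y yI /andP[wy /exists_inP[u uO /andP[yu /exists_inP[u' uO' /andP[yu' ff]]]]].
  by exists y, u, u'.
rewrite negb_exists_in => /forall_inP h; exfalso.
have mono y u u' : y \in I c -> e w y -> u \in O :\ w -> u' \in O :\ w -> e y u -> e y u' -> f u = f u'.
  move=> yI wy uO uO' yu yu'; apply/eqP/negPn/negP=> ff; case/negP: (h y yI); rewrite wy /=.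
  by apply/exists_inP; exists u; rewrite // yu; apply/exists_inP; exists u'; rewrite // yu'.
pose g y := [exists u in O :\ w, e y u && f u].
(* Colours 0 and 1 are those of [f], 2 is class [~~ c], and 3 is [w] with the vertices of class [c]
   that stay. A kicked vertex takes the colour opposite to that of its neighbours in [O :\ w], which
   all agree by [mono]. *)
pose col x := if x \in I (~~ c) then 2 else if (x == w) then 3 else
  if x \in I c then if e w x then ~~ g x : nat else 3 else f x : nat.
have colT x : col x < 4.
  by rewrite /col; do ![case: ifP => _ //]; case: (g x) (f x) => [] [].
have inO z : z \in I (~~ c) = false -> z \in I c = false -> z == w = false -> z \in O :\ w.
  by move=> h1 h2 h3; rewrite in_setD1 h3 in_O; case: c h1 h2 {h mono col colT} => /= -> ->.
have gP y' u : y' \in I c -> e w y' -> u \in O :\ w -> e y' u -> g y' = f u.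
  move=> yI wy uO yu; apply/exists_inP/idP => [[u' uO' /andP[yu' fu']]|fu]; last by exists u; rewrite // yu.
  by rewrite (mono y' u u').
have [x [y [xy cxy]]] := not4 colT.
move: cxy; rewrite /col.
case x2: (x \in I (~~ c)).
  case y2: (y \in I (~~ c)); first by have := indepP (indI (~~ c)) x y x2 y2; rewrite xy.
  by do ![case: ifP => _ //]; case: (g y) (f y) => [] [].
case y2: (y \in I (~~ c)).
  by do ![case: ifP => _ //]; case: (g x) (f x) => [] [].
case xw: (x == w).
  move/eqP: xw => xw; rewrite xw in xy; have -> : (y == w) = false by apply: contraTF xy => /eqP ->; rewrite ei.
  by rewrite xy; case: ifP => _; [case: (g y)|case: (f y)].
case yw: (y == w).
  move/eqP: yw => yw; rewrite yw es in xy; rewrite xy; by case: ifP => _; [case: (g x)|case: (f x)].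
case xI: (x \in I c); case yI: (y \in I c).
- by have := indepP (indI c) x y xI yI; rewrite xy.
- case wx: (e w x); last by case: (f y).
  by rewrite (gP x y xI wx (inO y y2 yI yw) xy); case: (f y).
- case wy: (e w y); last by case: (f x).
  by rewrite es in xy; rewrite (gP y x yI wy (inO x x2 xI xw) xy); case: (f x).
- by have := pf x y (inO x x2 xI xw) (inO y y2 yI yw) xy; case: (f x) (f y) => [] [].
Qed.

Definition line w c := [set u in O | (u != w) && [exists y in I c, e w y && e y u]].
Definition private w c := #|nb w :&: I c| == 1.

Lemma privateP w c : w \in O -> private w c -> exists y, [/\ y \in I c, e w y,
  {in I c, forall y', e w y' -> y' = y} & w |: line w c = nb y :&: O].
Proof.
move=> wO /cards1P[y ey]; have : y \in nb w :&: I c by rewrite ey set11.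
rewrite in_setI in_nb => /andP[wy yI].
have uy : {in I c, forall y', e w y' -> y' = y}.
  by move=> y' yI' wy'; apply/set1P; rewrite -ey in_setI in_nb wy'.
exists y; split=> //; apply/setP=> u; rewrite in_setU1 inE in_setI in_nb.
case: eqVneq => [->|uw] /=; first by rewrite es wy wO.
rewrite andbC; case: (u \in O); rewrite ?andbF // !andbT /=.
apply/exists_inP/idP => [[y' yI' /andP[wy' y'u]]|yu]; last by exists y; rewrite ?wy ?yu.
by rewrite -(uy y' yI' wy').
Qed.

Lemma lineE w c y : w |: line w c = nb y :&: O -> line w c = (nb y :&: O) :\ w.
Proof. by move=> <-; rewrite setU1K // inE eqxx andbF. Qed.

(** The only common neighbour of the two, [y], lies outside [O]; the distances on a line come from
    this. *)
Lemma nb_far y u u' : y \notin O -> u != u' -> e y u -> e y u' -> far O u u'.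
Proof.
move=> yO uu' yu yu'; rewrite /far uu' /=; apply/andP; split.
  by apply/negP=> h; move: (tri yu h); rewrite yu'.
apply/forall_inP=> z zO; apply/negP=> /andP[uz u'z].
have := C4 uu' _ _ uz u'z => /(_ y); rewrite !(es _ y) => /(_ yu yu') h.
by rewrite h zO in yO.
Qed.

Lemma line_far w c : w \in O -> private w c ->
  {in line w c, forall u, far O w u} /\ {in line w c &, forall u u', u != u' -> far O u u'}.
Proof.
move=> wO /(privateP wO)[y [yI wy _ hl]].
have yO : y \notin O by apply/negP=> /(OI c); rewrite yI.
have yw : e y w by rewrite es.
have yL u : u \in line w c -> u != w /\ e y u.
  by rewrite (lineE hl) in_setD1 in_setI in_nb => /and3P[].
split=> [u /yL[uw yu]|u u' /yL[_ yu] /yL[_ yu'] uu']; last exact: nb_far yu'.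
by apply: nb_far yu; rewrite // eq_sym.
Qed.

Lemma line_kick w c f : w \in O -> private w c -> two_colours f (O :\ w) ->
  exists u u', [/\ u \in line w c, u' \in line w c & f u != f u'].
Proof.
move=> wO /(privateP wO)[y [yI wy uy hl]] pf.
have [y' [u [u' [yI' wy' [yu yu'] [uO uO'] ff]]]] := kick c wO pf.
have ey := uy y' yI' wy'; rewrite {}ey in yu yu'.
by exists u, u'; rewrite (lineE hl) !in_setD1 !in_setI !in_nb yu yu' -!in_setD1 uO uO'.
Qed.

(* [w] is exchanged with its only neighbour [y] in class [c]. *)
Section Swap.
Variables (w : T) (c : bool) (y : T).
Hypotheses (wO : w \in O) (yI : y \in I c) (wy : e w y) (uy : {in I c, forall y', e w y' -> y' = y})
  (hl : w |: line w c = nb y :&: O).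
Let O' := y |: (O :\ w).
Let yO : y \notin O. Proof. by apply/negP=> /(OI c); rewrite yI. Qed.
Let yw : y != w. Proof. by apply: contraNneq yO => ->. Qed.

Lemma swap_min : degsum O <= degsum O' /\ (degsum O' = degsum O -> potential O' <= potential O).
Proof.
have iA : indep (w |: (I c :\ y)).
  apply/indepP=> a b; rewrite !in_setU1 !in_setD1 => /predU1P[->|/andP[ay aI]] /predU1P[->|/andP[b_y bI]].
  - by rewrite ei.
  - by apply: contra b_y => /(uy bI) ->.
  - by rewrite es; apply: contra ay => /(uy aI) ->.
  - exact: (indepP (indI c)).
have dA : [disjoint w |: (I c :\ y) & I (~~ c)].
  apply/pred0P=> x /=; rewrite in_setU1 in_setD1; apply/negP=> /andP[/predU1P[->|/andP[_ xI]]].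
    by rewrite OI.
  by rewrite disI.
have eO' : ~: ((w |: (I c :\ y)) :|: I (~~ c)) = O'.
  apply/setP=> x; rewrite in_setC in_setU in_setU1 in_setD1 in_setU1 in_setD1 (in_Oc c) !negb_or negb_and negbK.
  by case: (eqVneq x y) => [->|xy] /=; [rewrite yw (disI yI)|rewrite andbA].
have := exchange iA dA; rewrite /= eO'; case=> _; apply.
by rewrite cardsU1 in_setD1 (negPf yO) andbF (cardsD1 w O) wO.
Qed.

Lemma swap_deg u : u \in O :\ w -> deg O' u + e u w = deg O u + e u y.
Proof.
move=> uO; rewrite /deg (cardsD1 w (nb u :&: O)) in_setI in_nb wO andbT.
rewrite (cardsD1 y (nb u :&: O')) in_setI in_nb in_setU1 eqxx andbT.
suff -> : nb u :&: O' :\ y = nb u :&: O :\ w by clear; lia.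
apply/setP=> x; rewrite !in_setD1 !in_setI in_setU1 in_setD1; case: (eqVneq x y) => //= [->|_].
  by rewrite (negPf yO) !andbF.
by rewrite andbCA.
Qed.

Lemma swap_deg_y : deg O' y = #|line w c|.
Proof.
rewrite /deg (lineE hl); apply: eq_card => x; rewrite in_setI in_nb in_setU1 !in_setD1 in_setI in_nb.
case: eqVneq => [->|_] /=; first by rewrite ei andbF.
by rewrite andbCA.
Qed.

Lemma swap_sum (F : nat -> nat) : \sum_(u in O') F (deg O' u) = F #|line w c| + \sum_(u in O :\ w) F (deg O' u).
Proof. by rewrite big_setU1 ?swap_deg_y // in_setD1 (negPf yO) andbF. Qed.

Lemma count_nb A v : \sum_(u in A) e u v = #|nb v :&: A|.
Proof.
rewrite -sum1_card big_mkcond [RHS]big_mkcond /=; apply: eq_bigr => x _.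
by rewrite in_setI in_nb es; case: (e v x) (x \in A) => [] [].
Qed.

Lemma nb_w : nb w :&: (O :\ w) = nb w :&: O.
Proof. by apply/setP=> x; rewrite !in_setI in_setD1 in_nb; case: eqVneq => //= ->; rewrite ei. Qed.

Lemma nb_y : nb y :&: (O :\ w) = line w c.
Proof. by rewrite (lineE hl); apply/setP=> x; rewrite in_setI !in_setD1 in_setI andbCA. Qed.

(** The exchange trades the [deg O w] edges at [w] for [#|line w c|] edges at [y], and [degsum]
    counts every edge twice. *)
Lemma swap_degsum : degsum O' + 2 * deg O w = degsum O + 2 * #|line w c|.
Proof.
have h : \sum_(u in O :\ w) (deg O' u + e u w) = \sum_(u in O :\ w) (deg O u + e u y).
  exact: eq_bigr swap_deg.
rewrite !big_split /= !count_nb nb_w nb_y -/(deg O w) in h.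
rewrite /degsum (swap_sum id) (big_setD1 w wO) /=; clear -h; lia.
Qed.

Lemma swap_line_ge : deg O w <= #|line w c|.
Proof. by have [h _] := swap_min; have := swap_degsum; clear -h; lia. Qed.

(** The exchange lowers the degree [d] of each neighbour of [w] by one, which costs [2 ^ d.-1], and
    raises that of each vertex of the line by one, which gains [2 ^ d]; the terms of [w] and [y]
    cancel. Maximality forbids a net gain. *)
Lemma swap_pot : #|line w c| = deg O w ->
  \sum_(u in line w c) 2 ^ deg O u <= \sum_(q in nb w :&: O) 2 ^ (deg O q).-1.
Proof.
move=> eL; have [_ h] := swap_min.
have {h} : potential O' <= potential O by apply: h; have := swap_degsum; rewrite eL; clear; lia.
rewrite /potential (swap_sum (expn 2)) [in X in _ <= X](big_setD1 w wO) /= eL leq_add2l => h.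
have e1 : \sum_(u in O :\ w) (2 ^ deg O' u + (if e u w then 2 ^ (deg O u).-1 else 0))
        = \sum_(u in O :\ w) (2 ^ deg O u + (if e u y then 2 ^ deg O u else 0)).
  apply: eq_bigr => u uO; have := swap_deg uO.
  case uw: (e u w); case u_y': (e u y) => /= h'.
  - by rewrite es in uw; move: (tri uw u_y'); rewrite wy.
  - rewrite !addn0 addn1 in h'; rewrite -h' /= expnS; clear; lia.
  - rewrite addn0 addn1 in h'; rewrite h' expnS; clear; lia.
  - by rewrite !addn0 in h'; rewrite h'.
rewrite !big_split /= in e1.
have s1 : \sum_(u in O :\ w) (if e u w then 2 ^ (deg O u).-1 else 0) = \sum_(q in nb w :&: O) 2 ^ (deg O q).-1.
  rewrite -big_mkcondr /= -nb_w; apply: eq_bigl => u; by rewrite in_setI in_nb es andbC.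
have s2 : \sum_(u in O :\ w) (if e u y then 2 ^ deg O u else 0) = \sum_(u in line w c) 2 ^ deg O u.
  rewrite -big_mkcondr /= -nb_y; apply: eq_bigl => u; by rewrite in_setI in_nb es andbC.
by rewrite s1 s2 in e1; clear -e1 h; lia.
Qed.
End Swap.

Lemma line_ge w c : w \in O -> private w c -> deg O w <= #|line w c|.
Proof. by move=> wO /(privateP wO)[y [yI wy uy hl]]; apply: swap_line_ge wO yI uy hl. Qed.

Lemma line_pot w c : w \in O -> private w c -> #|line w c| = deg O w ->
  \sum_(u in line w c) 2 ^ deg O u <= \sum_(q in nb w :&: O) 2 ^ (deg O q).-1.
Proof. by move=> wO /(privateP wO)[y [yI wy uy hl]]; apply: swap_pot wO yI wy uy hl. Qed.

(** Otherwise [w] and [w'], nonadjacent because they share [y], could both enter class [c] in place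
    of [y], making the complement smaller. *)
Lemma private_inj w w' c y : w \in O -> w' \in O -> e w y -> e w' y ->
  {in I c, forall y', e w y' -> y' = y} -> {in I c, forall y', e w' y' -> y' = y} -> w = w'.
Proof.
move=> wO wO' wy wy' u1 u2; apply/eqP/negPn/negP=> ww'.
have nww : ~~ e w w' by apply/negP=> h; move: (tri h wy'); rewrite wy.
pose A := w |: (w' |: (I c :\ y)).
have iA : indep A.
  have n1 b : b \in I c :\ y -> ~~ e w b.
    by rewrite in_setD1 => /andP[b_y bI]; apply: contra b_y => /(u1 b bI) ->.
  have n2 b : b \in I c :\ y -> ~~ e w' b.
    by rewrite in_setD1 => /andP[b_y bI]; apply: contra b_y => /(u2 b bI) ->.
  apply/indepP=> a b; rewrite /A !in_setU1 => /or3P[/eqP->|/eqP->|aI] /or3P[/eqP->|/eqP->|bI].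
  - by rewrite ei.
  - exact: nww.
  - exact: n1.
  - by rewrite es.
  - by rewrite ei.
  - exact: n2.
  - by rewrite es n1.
  - by rewrite es n2.
  - by move: aI bI; rewrite !in_setD1 => /andP[_ aI] /andP[_ bI]; apply: (indepP (indI c)).
have dA : [disjoint A & I (~~ c)].
  apply/pred0P=> x /=; rewrite /A !in_setU1 in_setD1; apply/negP=> /andP[/or3P[/eqP->|/eqP->|/andP[_ xI]]].
  - by rewrite OI.
  - by rewrite OI.
  - by rewrite disI.
have [le _] := exchange iA dA.
have sub : ~: (A :|: I (~~ c)) \subset y |: (O :\ w :\ w').
  apply/subsetP=> x; rewrite /A in_setC in_setU !in_setU1 !in_setD1 (in_Oc c) !negb_or negb_and negbK.
  by case: (eqVneq x y) => //= xy; rewrite -!andbA => /and4P[-> -> -> ->].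
have := leq_trans le (subset_leq_card sub); rewrite cardsU1.
have := cardsD1 w O; have := cardsD1 w' (O :\ w); rewrite in_setD1 eq_sym ww' wO wO'.
by clear; case: (_ \notin _); lia.
Qed.

(** Together with its vertex each line is the neighbourhood in [O] of a single [y]. These [y]
    differ, within one class by [private_inj], and two vertices share at most one neighbour. *)
Lemma lines_meet w w' c c' : w \in O -> w' \in O -> private w c -> private w' c' ->
  (w, c) != (w', c') -> #|(w |: line w c) :&: (w' |: line w' c')| <= 1.
Proof.
move=> wO wO' /(privateP wO)[y [yI wy uy ->]] /(privateP wO')[y' [yI' wy' uy' ->]] ne.
have yy : y != y'.
  apply: contraNneq ne => ey; subst y'; have cc : c = c' := sameI yI yI'.
  by subst c'; rewrite (private_inj wO wO' wy wy' uy uy').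
apply/card_le1_eqP=> a b; rewrite !in_setI !in_nb => /andP[/andP[ya _] /andP[ya' _]] /andP[/andP[yb _] /andP[yb' _]].
by rewrite (C4 yy ya ya' yb yb').
Qed.

Hypothesis cO : #|O| <= 12.

Lemma deg_split w : deg setT w = deg O w + #|nb w :&: I true| + #|nb w :&: I false|.
Proof.
have h1 := cardsID (I true) (nb w); have h2 := cardsID (I false) (nb w :\: I true).
have e1 : (nb w :\: I true) :&: I false = nb w :&: I false.
  apply/setP=> x; rewrite !in_setI in_setD; case h: (x \in I false); rewrite ?andbF //.
  by have /= -> := disI h.
have e2 : nb w :\: I true :\: I false = nb w :&: O.
  by apply/setP=> x; rewrite in_setI !in_setD in_O; case: (x \in I true) (x \in I false) => [] []; rewrite ?andbF ?andbT.
by rewrite /deg setIT; rewrite e1 e2 in h2; clear -h1 h2; lia.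
Qed.

Lemma touch_card w c : w \in O -> 0 < #|nb w :&: I c|.
Proof. by move=> /(touch c)[y yI wy]; apply/card_gt0P; exists y; rewrite in_setI in_nb wy. Qed.

Lemma nb_sum v : 4 * deg setT v <= \sum_(u in nb v) deg setT u <= 27.
Proof.
apply/andP; split.
  by rewrite mulnC /deg setIT -sum_nat_const; apply: leq_sum => u _; apply: d4.
have := deg_nb_sum g5 (in_setT v); rewrite setIT cardsT; move: n28; clear; lia.
Qed.

Definition six v := 6 <= deg setT v.

Lemma deg_le6 v : deg setT v <= 6.
Proof. by have /andP[] := nb_sum v; clear; lia. Qed.

(** The degrees around a vertex of degree 6 add up to at most 27, while its neighbours take 4 each,
    in all 24, and every neighbour of degree 6 takes two more. *)
Lemma six_match v : six v -> #|[set u in nb v | six u]| <= 1.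
Proof.
move=> sv; have /andP[_] := nb_sum v.
have : \sum_(u in nb v) (4 + 2 * six u) <= \sum_(u in nb v) deg setT u.
  by apply: leq_sum => u _; have := d4 u; rewrite /six; case: leqP; clear; lia.
rewrite big_split /= sum_nat_const -big_distrr /=.
have -> : \sum_(u in nb v) six u = #|[set u in nb v | six u]|.
  by rewrite -sum1_card big_mkcond [RHS]big_mkcond /=; apply: eq_bigr => u _; rewrite !inE; case: (e v u) (six u) => [] [].
by rewrite card_nb; move: sv; rewrite /six; clear; lia.
Qed.

Definition far_set w := [set u in O | far O w u].

(** This is the Moore bound for the vertices of [O] that are not far from [w]: they include [w], its
    neighbours and the neighbours of these, so no degree in the sum shrinks. *)
Lemma far_card w : w \in O -> #|far_set w| + \sum_(q in nb w :&: O) deg O q < 12.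
Proof.
move=> wO; pose S := O :\: far_set w.
have FO : far_set w \subset O by apply/subsetP=> x; rewrite inE => /andP[].
have nearS x : x \in O -> ~~ far O w x -> x \in S by move=> xO nf; rewrite in_setD inE xO (negPf nf).
have wS : w \in S by rewrite nearS // /far eqxx.
have eN : nb w :&: S = nb w :&: O.
  apply/setP=> q; rewrite !in_setI in_nb; case wq: (e w q) => //=.
  by apply/idP/idP => [|qO]; [rewrite in_setD => /andP[]|rewrite nearS // /far wq /= andbF].
have := deg_nb_sum g5 wS; rewrite eN (eq_bigr (deg O)).
  by rewrite cardsD (setIidPr FO) => h; have := subset_leq_card FO; move: cO h; clear; lia.
move=> q; rewrite in_setI in_nb => /andP[wq qO]; rewrite /deg; apply: eq_card => x; rewrite !in_setI in_nb.
case qx: (e q x) => //=; apply/idP/idP => [|xO]; first by rewrite in_setD => /andP[].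
apply: nearS => //; rewrite /far; apply/negP=> /and3P[_ _ /forall_inP/(_ q qO)].
by rewrite wq es qx.
Qed.

Lemma line_sub w c : line w c \subset O :\ w.
Proof. by apply/subsetP=> x; rewrite inE in_setD1 => /and3P[-> ->]. Qed.

Lemma line_far_set w c : w \in O -> private w c -> line w c \subset far_set w.
Proof.
move=> wO pw; have [h _] := line_far wO pw; apply/subsetP=> x xL; rewrite inE h // andbT.
by have := subsetP (line_sub w c) x xL; rewrite in_setD1 => /andP[].
Qed.

Lemma line_disjoint w : w \in O -> private w true -> private w false ->
  #|line w true| + #|line w false| <= #|far_set w|.
Proof.
move=> wO p1 p2; have := lines_meet wO wO p1 p2; rewrite xpair_eqE eqxx /= => /(_ isT) h.
have e0 : line w true :&: line w false = set0.
  apply/setP=> x; rewrite in_setI in_set0; apply/negP=> /andP[x1 x2].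
  have xw : x != w by have := subsetP (line_sub w true) x x1; rewrite in_setD1 => /andP[].
  have : #|[set x; w]| <= 1.
    apply: leq_trans h; apply/subset_leq_card; rewrite subUset !sub1set !in_setI !in_setU1.
    by rewrite x1 x2 eqxx !orbT.
  by rewrite cards2 xw.
have := cardsU (line w true) (line w false); rewrite e0 cards0 subn0 => <-.
by apply: subset_leq_card; rewrite subUset !line_far_set.
Qed.

Lemma private_lt w c : w \in O -> #|nb w :&: I c| <= 1 -> private w c.
Proof. by move=> wO h; rewrite /private eqn_leq h touch_card. Qed.

Lemma rest_deg w : w \in O -> deg O w <= 3.
Proof.
move=> wO; rewrite leqNgt; apply/negP=> h4.
have ds := deg_split w; have d6 := deg_le6 w.
have t1 := touch_card true wO; have t2 := touch_card false wO.
have p1 : private w true by apply: private_lt => //; clear -ds d6 h4 t2; lia.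
have p2 : private w false by apply: private_lt => //; clear -ds d6 h4 t1; lia.
have l1 := line_ge wO p1; have l2 := line_ge wO p2.
have hd := line_disjoint wO p1 p2; have hf := far_card wO.
have : \sum_(q in nb w :&: O) 1 <= \sum_(q in nb w :&: O) deg O q.
  apply: leq_sum => q; rewrite in_setI in_nb => /andP[wq _]; apply/card_gt0P; exists w.
  by rewrite in_setI in_nb es wq.
by rewrite sum1_card -/(deg O w); clear -l1 l2 hd hf h4; lia.
Qed.

Lemma rest_odd f : ~ {in O &, forall u v, e u v -> f u != f v}.
Proof.
move=> pf; pose col x := if x \in I true then 2 else if x \in I false then 3 else f x : nat.
have colT x : col x < 4 by rewrite /col; do 2?[case: ifP => _ //]; case: (f x).
have [x [y [xy]]] := not4 colT; rewrite /col.
case x1: (x \in I true); case y1: (y \in I true).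
- by have := indepP (indI true) x y x1 y1; rewrite xy.
- by case: ifP => // _; case: (f y).
- by case: ifP => // _; case: (f x).
case x2: (x \in I false); case y2: (y \in I false).
- by have := indepP (indI false) x y x2 y2; rewrite xy.
- by case: (f y).
- by case: (f x).
have := pf x y; rewrite !in_O x1 x2 y1 y2 => /(_ isT isT xy).
by case: (f x) (f y) => [] [].
Qed.

Lemma residual_rest : residual e O line private six (far O).
Proof.
split=> //.
- exact: rest_odd.
- exact: rest_deg.
- exact: line_sub.
- by move=> w c wO pw; case: (line_far wO pw).
- by move=> w c wO pw; case: (line_far wO pw).
- exact: line_ge.
- exact: line_pot.
- exact: line_kick.
- exact: lines_meet.
(* With degree at most 5, [w] has a single neighbour in each class, thus two disjoint lines of at
   least three vertices; [far_card] leaves less than 6 for the degree sum. *)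
- move=> w wO dw s6; have ds := deg_split w; rewrite /six -ltnNge in s6.
  have t1 := touch_card true wO; have t2 := touch_card false wO.
  have p1 : private w true by apply: private_lt => //; clear -ds s6 dw t2; lia.
  have p2 : private w false by apply: private_lt => //; clear -ds s6 dw t1; lia.
  split=> //; have hd := line_disjoint wO p1 p2; have hf := far_card wO.
  have l1 := line_ge wO p1; have l2 := line_ge wO p2; clear -l1 l2 hd hf dw; lia.
- move=> w wO dw; have ds := deg_split w; have d6 := deg_le6 w.
  have [c pc] : exists c, private w c.
    case: (leqP #|nb w :&: I true| 1) => h; first by exists true; apply: private_lt.
    by exists false; apply: private_lt => //; clear -ds d6 h dw; lia.
  have := subset_leq_card (line_far_set wO pc); have := line_ge wO pc; have := far_card wO.
  by clear -dw; lia.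
(* The kick in the class opposite to the private one supplies [u] and [u']. They are neighbours of a
   vertex [y] other than the private neighbour [y0]; as [w] is already a common neighbour of [y] and
   [y0], both avoid the line. *)
- move=> w wO dw; have ds := deg_split w; have d6 := deg_le6 w.
  have [c pc] : exists c, private w c.
    case: (leqP #|nb w :&: I true| 1) => h; first by exists true; apply: private_lt.
    by exists false; apply: private_lt => //; clear -ds d6 h dw; lia.
  exists c => // f pf; have [y [u [u' [yI wy [yu yu'] [uO uO'] ff]]]] := kick (~~ c) wO pf.
  have yO : y \notin O by apply/negP=> /(OI (~~ c)); rewrite yI.
  have [y0 [yI0 wy0 _ hl]] := privateP wO pc.
  have yy0 : y0 != y by apply: contraTneq yI => <-; rewrite disI.
  have out x : x \in O :\ w -> e y x -> x \in O :\: line w c.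
    rewrite in_setD1 in_setD (lineE hl) in_setD1 in_setI in_nb => /andP[xw ->] yx.
    rewrite xw !andbT /=; apply: contra xw => y0x; apply/eqP; apply: (C4 yy0 y0x yx).
      by rewrite es.
    by rewrite es.
  have farw x : x \in O :\ w -> e y x -> far O w x.
    by rewrite in_setD1 eq_sym => /andP[xw _] yx; apply: nb_far yx; rewrite // es.
  have uu' : u != u' by apply: contraNneq ff => ->.
  exists u, u'; split; rewrite ?out ?farw //; exact: nb_far yu'.
- move=> w wO dw s6; have ds := deg_split w; rewrite /six -ltnNge in s6.
  case: (leqP #|nb w :&: I true| 1) => h; first by exists true; apply: private_lt.
  by exists false; apply: private_lt => //; clear -ds s6 h dw; lia.
- by move=> w _; apply: six_match.
Qed.

(** Combining [g] on [K] with [f] elsewhere gives a kick of [w] for either class, and its pair lies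
    outside [K] because nothing in [K] is far from [w]. The pair determines the class vertex [y],
    hence the class; and [y] is adjacent to only one vertex of [K], as two of them would be far. So
    ten different pairs arise. *)
Lemma rest_pentagon_free : pentagon_free e O (far O).
Proof.
move=> K f KO cK cl nf gK pf; set Q := [set p | _] => cQ.
have ex (p : T * bool) : exists q : T * T, p.1 \in K -> q \in Q /\
    exists y, [/\ y \in I p.2, e p.1 y, e y q.1 & e y q.2].
  case: p => w c /=; case: (boolP (w \in K)) => [wK|]; last by exists (w, w).
  have wO := subsetP KO w wK; have [g pg] := gK w wK.
  have ph : two_colours (fun x => if x \in K then g x else f x) (O :\ w).
    move=> u v; rewrite !in_setD1 => /andP[uw uO] /andP[vw vO] uv.
    case uK: (u \in K).
      by rewrite (cl u v uK vO uv); apply: pg => //; rewrite in_setD1 ?uw ?vw // (cl u v uK vO uv).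
    case vK: (v \in K); first by rewrite es in uv; rewrite (cl v u vK uO uv) in uK.
    by apply: pf; rewrite ?in_setD ?uK ?vK.
  have [y [u [u' [yI wy [yu yu'] [uO uO'] ff]]]] := kick c wO ph.
  have yO : y \notin O by apply/negP=> /(OI c); rewrite yI.
  have nK x : x \in O :\ w -> e y x -> x \notin K.
    rewrite in_setD1 => /andP[xw _] yx; apply/negP=> xK; case/negP: (nf w x wK xK).
    by apply: nb_far yx; rewrite // 1?eq_sym // es.
  have uK := nK u uO yu; have uK' := nK u' uO' yu'; rewrite (negPf uK) (negPf uK') in ff.
  have nuu' : e u u' = false by apply/negP=> h; move: (tri yu h); rewrite yu'.
  move: uO uO'; rewrite !in_setD1 => /andP[_ uO] /andP[_ uO'].
  case fu: (f u) ff => /= fu'; [exists (u, u')|exists (u', u)] => _.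
    by split; [rewrite inE /= !in_setD uK uK' uO uO' fu fu' nuu'|exists y].
  split; last by exists y.
  by rewrite inE /= !in_setD uK uK' uO uO' es nuu' fu; move: fu'; rewrite negbK => ->.
have [F hF] := fin_all_exists ex.
have sub : F @: (setX K [set: bool]) \subset Q.
  by apply/subsetP=> q /imsetP[[w c]]; rewrite in_setX => /andP[wK _] ->; case: (hF (w, c) wK).
have := subset_leq_card sub; rewrite card_in_imset ?cardsX ?cK ?cardsT ?card_bool.
  by clear -cQ; lia.
move=> [w c] [w' c']; rewrite !in_setX => /andP[/= wK _] /andP[/= wK' _] eF.
have [h [y [yI wy y1 y2]]] := hF (w, c) wK; have [_ [y' [yI' wy' y1' y2']]] := hF (w', c') wK'.
rewrite -eF in y1' y2'; case eq: (F (w, c)) h y1 y2 y1' y2' => [u u'] + /= y1 y2 y1' y2'.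
rewrite inE /= => /and5P[_ _ fu fu' _].
have uu' : u != u' by apply: contraNneq fu' => <-.
have eyy : y = y' by apply: (C4 uu'); rewrite es //.
subst y'; have cc : c = c' := sameI yI yI'.
have yO : y \notin O by apply/negP=> /(OI c); rewrite yI.
case: (eqVneq w w') => [->|ww']; first by rewrite cc.
by case/negP: (nf w w' wK wK'); apply: (nb_far yO ww'); rewrite es.
Qed.
End Local.
End Graph.

(** * Enumeration of the complements *)

Fixpoint hasb {A} (p : A -> bool) (l : seq A) : bool :=
  if l is x :: l' then if p x then true else hasb p l' else false.
Fixpoint allb {A} (p : A -> bool) (l : seq A) : bool :=
  if l is x :: l' then if p x then allb p l' else false else true.
Fixpoint two {A} (f : A -> A -> bool) (l : seq A) : bool :=
  if l is a :: l' then if hasb (f a) l' then true else two f l' else false.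
Fixpoint meq (a b : bitseq) : bool :=
  match a, b with
  | x :: a', y :: b' => if x then if y then meq a' b' else false
                        else if y then false else meq a' b'
  | _, _ => true end.
Fixpoint le1 (a b : bitseq) : bool :=
  match a, b with
  | x :: a', y :: b' => if x then if y then mdis a' b' else le1 a' b' else le1 a' b'
  | _, _ => true end.

(* The singleton of a vertex, its neighbourhood, its degree, and the vertices at distance at most 2. *)
Record vtx := Vtx { vu : bitseq; vr : bitseq; vd : nat; vn : bitseq }.
Fixpoint infos (rows l us : seq bitseq) : seq vtx :=
  match l, us with
  | r :: l', u :: us' => Vtx u r (mcount r) (mor u (munion rows r r)) :: infos rows l' us'
  | _, _ => [::] end.
Fixpoint wsum (f : nat -> nat) (l : seq vtx) (r : bitseq) : nat :=
  match l, r with v :: l', x :: r' => if x then f (vd v) + wsum f l' r' else wsum f l' r'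
  | _, _ => 0 end.
(* [2 ^ n] for [n <= 4] only: no larger degree occurs. *)
Definition pow2 n := nth 0 [:: 1; 2; 4; 8; 16] n.

Section Node.
Variable l : seq vtx.
Let n := size l.
Let rows := map vr l.
Let zero := nseq n false.
Let full := nseq n true.

(* The results of [flood], [comps] and [colour] are never trusted: every 2-colouring that they produce is
   verified by [proper_mask]. *)
Fixpoint flood (fuel : nat) (msk a b : bitseq) : option (bitseq * bitseq) :=
  if fuel is k.+1 then
    let b' := mor b (mand (munion rows a zero) msk) in
    let a' := mor a (mand (munion rows b' zero) msk) in
    if mdis a' b' then
      if (if meq a a' then meq b b' else false) then Some (a, b) else flood k msk a' b'
    else None
  else None.
Fixpoint comps (l : seq vtx) (msk : bitseq) : option (seq (bitseq * bitseq)) :=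
  if l is v :: l' then
    if mdis (vu v) msk then comps l' msk
    else if mdis (vr v) msk then comps l' msk
    else if flood 12 msk (vu v) zero is Some (a, b) then
      if comps l' (mdiff msk (mor a b)) is Some cs then Some ((a, b) :: cs) else None
    else None
  else Some [::].
Fixpoint colour (cs : seq (bitseq * bitseq)) (m : bitseq) : bitseq :=
  if cs is (a, b) :: cs' then mor (if mdis a m then a else b) (colour cs' m) else zero.
Fixpoint hits (cs : seq (bitseq * bitseq)) (m : bitseq) : bool :=
  if cs is c :: cs' then if mdis c.1 m then hits cs' m else if mdis c.2 m then hits cs' m else true
  else false.

Fixpoint indep_mask (l : seq vtx) (p q : bitseq) : bool :=
  match l, p with
  | v :: l', x :: p' => if (if x then mdis (vr v) q else true) then indep_mask l' p' q else false
  | _, _ => true end.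
Definition proper_mask (msk X : bitseq) : bool :=
  if size X == n then
    let p := mand msk X in let q := mdiff msk X in
    if indep_mask l p p then indep_mask l q q else false
  else false.
Definition mono (cs : seq (bitseq * bitseq)) (msk m : bitseq) : bool :=
  let X := colour cs m in if proper_mask msk X then mdis X m else false.
(** By [res_kick], a line meets both colours of every 2-colouring of [msk]. The test fails only on a
    verified colouring that is constant on [m]; [hits] is a shortcut to success when some component
    has both of its sides met. *)
Definition valid (cs : option (seq (bitseq * bitseq))) (msk m : bitseq) : bool :=
  if cs is Some cs' then if hits cs' m then true else ~~ mono cs' msk m else true.
Definition bipartite (msk : bitseq) : bool :=
  if comps l msk is Some cs then proper_mask msk (colour cs zero) else false.

(* Candidates for lines: pairwise far sets, cut off at the first admissible prefix, so that a line is only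
   known to contain one of them. *)
Section Lines.
Variables (msk : bitseq) (cs : option (seq (bitseq * bitseq))) (s b : nat).
Fixpoint lines (far : seq vtx) (m : bitseq) (k : nat) (forb : bitseq) (sum : nat) (acc : seq bitseq) :=
  if far is v :: far' then
    let acc' := lines far' m k forb sum acc in
    if mdis (vu v) forb then
      let m' := mor m (vu v) in let k' := k.+1 in let sum' := sum + pow2 (vd v) in
      if (if s < k' then valid cs msk m'
          else if k' == s then if sum' <= b then valid cs msk m' else false else false)
      then m' :: acc' else lines far' m' k' (mor forb (vn v)) sum' acc'
    else acc'
  else acc.
End Lines.

Definition options (w : vtx) (cs : option (seq (bitseq * bitseq))) : seq bitseq :=
  lines (mdiff full (vu w)) cs (vd w) (wsum (fun d => pow2 d.-1) l (vr w))
    (filter (fun v => mdis (vu v) (vn w)) l) zero 0 zero 0 [::].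

Definition farpair (f m : bitseq) : bool :=
  let f' := mdiff f m in
  hasb (fun v => if mdis (vu v) f' then false else ~~ mdis (mdiff f' (vn v)) full) l.

Record item := Item { iw : vtx; io : seq bitseq; ib : bool }.
Definition mk_item (w : vtx) : item :=
  let msk := mdiff full (vu w) in let cs := comps l msk in
  Item w (options w cs) (if cs is Some cs' then proper_mask msk (colour cs' zero) else false).

(* Assigns lines to the vertices of degree 3 and 2; [ch] collects the sets [w |: line w c], which meet in
   at most one vertex, and [six] the vertices assumed to have degree 6 in the whole graph. *)
Fixpoint go (its : seq item) (ch : seq bitseq) (six : bitseq) : bool :=
  if its is it :: its' then
    let w := iw it in
    let o := filter (fun a => allb (le1 (mor a (vu w))) ch) (io it) in
    if (if vd w == 3 then
          two (fun a b => if mdis a b then go its' [:: mor a (vu w), mor b (vu w) & ch] six else false) o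
        else hasb (fun a => go its' (mor a (vu w) :: ch) six) o)
    then true else
    let sn := mand (vr w) six in
    if mcount sn <= 1 then
      if mdis (munion rows sn zero) six then
        if vd w == 3 then
          hasb (fun a => if (if ib it then farpair (mdiff full (vn w)) a else true)
                       then go its' (mor a (vu w) :: ch) (mor six (vu w)) else false) o
        else go its' ch (mor six (vu w))
      else false
    else false
  else true.

(** A vertex of degree 3 has a private neighbour, since at most three edges lead from it to the two
    classes; if it has no admissible line, the whole graph is refuted. *)
Fixpoint items (d : nat) (l : seq vtx) : option (seq item) :=
  if l is v :: l' then
    if vd v == d then
      let it := mk_item v in
      if (if io it is [::] then d == 3 else false) then None
      else if items d l' is Some its then Some (it :: its) else None
    else items d l'
  else Some [::].
(** The vertices of degree 3 carry the strongest constraints and are tried alone first; lines for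
    those of degree 2 are computed only if this succeeds. *)
Definition csp : bool :=
  if items 3 l is Some l3 then
    if go l3 [::] zero then
      if items 2 l is Some l2 then go (l3 ++ l2) [::] zero else false
    else false
  else false.

Fixpoint choices (cs : seq (bitseq * bitseq)) (X : bitseq) (p : bitseq -> bool) : bool :=
  if cs is (a, b) :: cs' then if choices cs' (mor a X) p then true else choices cs' (mor b X) p
  else p X.
Fixpoint cross (l : seq vtx) (p q : bitseq) : nat :=
  match l, p with
  | v :: l', x :: p' => if x then mcount (mdiff q (vr v)) + cross l' p' q else cross l' p' q
  | _, _ => 0 end.
(** If every vertex of [K] has [K] as its ball of radius 2, then [K] is a component without far
    pairs, as [pentagon_free] requires. *)
Definition pentagon : bool :=
  hasb (fun v => let K := vn v in let F := mdiff full K in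
    if mcount K == 5 then
      if allb (fun u => if mdis (vu u) K then true else
               if meq (vn u) K then bipartite (mdiff K (vu u)) else false) l then
        if comps l F is Some cs then
          choices cs zero (fun X => if proper_mask F X then cross l (mand F X) (mdiff F X) <= 9 else false)
        else false
      else false
    else false) l.

(** Truth excludes the listed graph as a complete [O]: it is bipartite, admits no system of lines,
    or falls to the count of pairs at a pentagon. More vertices may still be added to it. *)
Definition leaf : bool := if bipartite full then true else if csp then pentagon else true.

(** By girth 5 the neighbours of a new vertex pairwise have distance more than 2 among the listed
    ones, so each chosen one forbids its [vn]; [k] starts at 3, the largest degree possible in
    [O]. *)
Fixpoint gen (l : seq vtx) (forb : bitseq) (k : nat) : seq bitseq :=
  if l is v :: l' then
    let no := [seq false :: Z | Z <- gen l' forb k] in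
    if mdis (vu v) forb then if vd v < 3 then
      if k is k'.+1 then no ++ [seq true :: Z | Z <- gen l' (mor forb (vn v)) k'] else no
    else no else no
  else [:: [::]].
Definition extend (Z : bitseq) : seq vtx :=
  let rows' := (false :: Z) :: [seq p.1 :: p.2 | p <- zip Z rows] in
  infos rows' rows' (mkseq (munit n.+1) n.+1).
(** These are necessary conditions on partial lists. Once the newest vertex misses the oldest one,
    no neighbour of the latter is still to come, so its listed degree is final and maximal. Degree
    sums only grow, and by [res_three] a sum above 5 around a vertex of degree 3 forces it to have
    degree 6 in the whole graph. *)
Definition plausible : bool :=
  let d0 := vd (last (Vtx [::] [::] 0 [::]) l) in
  if (if last false (head [::] rows) then true else allb (fun v => vd v <= d0) l) then
    if allb (fun v => if vd v == 3 then wsum id l (vr v) <= 8 else true) l then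
      let six := [seq if vd v == 3 then 5 < wsum id l (vr v) else false | v <- l] in
      allb (fun v => if mdis (vu v) six then true else mcount (mand (vr v) six) <= 1) l
    else false
  else false.
End Node.

Fixpoint cmp (a b : bitseq) : comparison :=
  match a, b with
  | x :: a', y :: b' => match cmp a' b' with
      | Eq => if x then if y then Eq else Gt else if y then Lt else Eq
      | c => c end
  | _, _ => Eq end.

(* Vertices are listed newest first, the oldest one having maximal degree. The next vertex is one whose
   adjacency vector to the listed vertices is largest, the oldest vertex being most significant; hence these
   vectors, suitably truncated, never increase. *)
Fixpoint search (k : nat) (l : seq vtx) (lst : bitseq) : bool :=
  if leaf l then
    if k is k'.+1 then
      allb (fun Z => if cmp (behead Z) lst is Gt then true
                   else let l' := extend l Z in
                     if plausible l' then search k' l' Z else true)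
         (gen l (nseq (size l) false) 3)
    else true
  else false.

Definition start : seq vtx := [:: Vtx [:: true] [:: false] 0 [:: true]].

Lemma hasbE (A : Type) (p : A -> bool) l : hasb p l = has p l.
Proof. by elim: l => //= x l ->; case: (p x). Qed.
Lemma allbE (A : Type) (p : A -> bool) l : allb p l = all p l.
Proof. by elim: l => //= x l ->; case: (p x). Qed.
Lemma two_mem (A : eqType) (f : A -> A -> bool) l x y :
  x \in l -> y \in l -> x != y -> f x y -> f y x -> two f l.
Proof.
elim: l => //= a l IH; rewrite !inE hasbE => /predU1P[->|xl] /predU1P[->|yl] xy fxy fyx.
- by rewrite eqxx in xy.
- by rewrite (_ : has _ _) //; apply/hasP; exists y.
- by rewrite (_ : has _ _) //; apply/hasP; exists x.
- by case: has => //; apply: IH.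
Qed.
Lemma meqP a b : size a = size b -> meq a b -> a = b.
Proof. by elim: a b => [|x a IH] [|y b] //= [/IH h]; case: x y => [] [] // /h->. Qed.

(** * Bit vectors as subsets of a list of vertices *)

Section Masks.
Variables (T : finType) (e : rel T).
Implicit Types (s vs : seq T) (A B : {set T}) (u v w x y : T).
Local Notation nb := (nb e).

(* All bit vectors of the search are of this form, [vs] being the list of vertices named so far. *)
Definition mk vs A : bitseq := [seq x \in A | x <- vs].
Definition nbl vs A := [set x | has (fun a => (a \in A) && e a x) vs].
Definition near vs v := v |: (nb v :|: nbl vs (nb v)).
Definition vinfo vs v := Vtx (mk vs [set v]) (mk vs (nb v)) (count (e v) vs) (mk vs (near vs v)).

Lemma size_mk vs A : size (mk vs A) = size vs. Proof. exact: size_map. Qed.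
Lemma mor_mk vs A B : mor (mk vs A) (mk vs B) = mk vs (A :|: B).
Proof. by elim: vs => //= x vs ->; rewrite in_setU; case: (x \in A). Qed.
Lemma mand_mk vs A B : mand (mk vs A) (mk vs B) = mk vs (A :&: B).
Proof. by elim: vs => //= x vs ->; rewrite in_setI; case: (x \in A). Qed.
Lemma mdiff_mk vs A B : mdiff (mk vs A) (mk vs B) = mk vs (A :\: B).
Proof. by elim: vs => //= x vs ->; rewrite in_setD; case: (x \in A) (x \in B) => [] []. Qed.
Lemma mdis_mk vs A B : mdis (mk vs A) (mk vs B) = all (fun x => ~~ ((x \in A) && (x \in B))) vs.
Proof. by elim: vs => //= x vs ->; case: (x \in A) (x \in B) => [] []. Qed.
Lemma mdis1 vs v B : v \in vs -> mdis (mk vs [set v]) (mk vs B) = (v \notin B).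
Proof.
move=> vvs; rewrite mdis_mk; apply/allP/idP => [/(_ v vvs)|vB x _]; first by rewrite set11.
by rewrite in_set1; case: eqP => // ->.
Qed.
Lemma mcount_mk vs A : mcount (mk vs A) = count (mem A) vs.
Proof. by rewrite mcount_count /mk count_map. Qed.
Lemma mk_set0 vs : mk vs set0 = nseq (size vs) false.
Proof. by elim: vs => //= x vs ->; rewrite in_set0. Qed.
Lemma mk_setT vs : mk vs setT = nseq (size vs) true.
Proof. by elim: vs => //= x vs ->; rewrite in_setT. Qed.
Lemma eq_mk vs A B : {in vs, forall x, (x \in A) = (x \in B)} -> mk vs A = mk vs B.
Proof. by move=> h; apply/eq_in_map. Qed.
Lemma mk_mem vs A B x : mk vs A = mk vs B -> x \in vs -> (x \in A) = (x \in B).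
Proof. by move/eq_in_map => h /h. Qed.

Lemma munion_mk s vs A B : munion [seq mk vs (nb a) | a <- s] (mk s A) (mk vs B) = mk vs (B :|: nbl s A).
Proof.
elim: s B => [|a s IH] B /=; first by apply: eq_mk => x _; rewrite in_setU inE /= orbF.
case: ifP => aA; rewrite ?mor_mk IH; apply: eq_mk => x _; rewrite !in_setU !inE /= aA //.
by rewrite orbA.
Qed.

Definition colouring vs (X : bitseq) v := nth false X (index v vs).
Lemma mk_colouring vs X : uniq vs -> size X = size vs -> X = mk vs [set x | colouring vs X x].
Proof.
move=> uvs sX; apply: (@eq_from_nth _ false); rewrite ?size_mk // => i li.
case: vs => [|v0 vs'] in uvs sX *; first by case: X sX li.
by rewrite (nth_map v0) -?sX // inE /colouring index_uniq -?sX.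
Qed.

Lemma units_mk vs : uniq vs -> mkseq (munit (size vs)) (size vs) = [seq mk vs [set v] | v <- vs].
Proof.
move=> uvs; apply: (@eq_from_nth _ [::]); rewrite ?size_mkseq ?size_map // => i li.
case: vs => [//|v0 vs'] in uvs li *; rewrite nth_mkseq // (nth_map v0) //.
apply: (@eq_from_nth _ false); rewrite ?size_mkseq ?size_mk // => j lj.
by rewrite nth_mkseq // (nth_map v0) // in_set1 nth_uniq.
Qed.

Lemma infos_mk vs : uniq vs -> let rows := [seq mk vs (nb v) | v <- vs] in
  infos rows rows (mkseq (munit (size vs)) (size vs)) = [seq vinfo vs v | v <- vs].
Proof.
move=> uvs /=; rewrite units_mk //; set rows := [seq _ | _ <- _].
suff gen s : infos rows [seq mk vs (nb v) | v <- s] [seq mk vs [set v] | v <- s] = [seq vinfo vs v | v <- s] by exact: gen.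
elim: s => //= v s ->; congr (_ :: _).
rewrite /vinfo mcount_mk munion_mk mor_mk; congr Vtx.
by apply: eq_count => x /=; rewrite in_nb.
Qed.

Lemma wsum_mk (f : nat -> nat) vs s A :
  wsum f [seq vinfo vs v | v <- s] (mk s A) = \sum_(v <- s | v \in A) f (count (e v) vs).
Proof. by elim: s => [|v s IH] /=; rewrite ?big_nil // big_cons IH. Qed.

Lemma indep_mask_mk vs s A B :
  indep_mask [seq vinfo vs v | v <- s] (mk s A) (mk vs B) =
  all (fun v => (v \in A) ==> all (fun u => ~~ (e v u && (u \in B))) vs) s.
Proof.
elim: s => //= v s IH; rewrite -IH; case: (v \in A) => //=.
rewrite mdis_mk (@eq_all _ _ (fun u => ~~ (e v u && (u \in B)))) => [|u]; last by rewrite in_nb.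
by case: all.
Qed.

Lemma le1_mk vs A B : count (fun x => (x \in A) && (x \in B)) vs <= 1 -> le1 (mk vs A) (mk vs B).
Proof.
elim: vs => //= x vs IH; case: (x \in A) (x \in B) => [] [] //=.
rewrite add1n ltnS leqn0 => /eqP c0; rewrite mdis_mk; apply/allP=> y yvs; apply/negP=> h.
by have : has (fun x => (x \in A) && (x \in B)) vs by [apply/hasP; exists y]; rewrite has_count c0.
Qed.

Section Proper.
Variable vs : seq T.
Hypothesis uvs : uniq vs.
Let l := [seq vinfo vs v | v <- vs].

Lemma proper_maskP M X : proper_mask l (mk vs M) X -> size X = size vs /\
  {in vs &, forall u v, u \in M -> v \in M -> e u v -> colouring vs X u != colouring vs X v}.
Proof.
rewrite /proper_mask size_map; case: eqP => // sX; set C := [set x | colouring vs X x].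
rewrite {1 2 3 4}(mk_colouring uvs sX) -/C mand_mk mdiff_mk !indep_mask_mk.
case: ifP => // /allP h1 /allP h2; split=> // u v uvs' vvs uM vM uv; apply/negP=> /eqP eq.
case cu: (colouring vs X u).
  have := h1 u uvs'; rewrite !inE uM cu /= => /allP/(_ v vvs).
  by rewrite uv !inE vM -eq cu.
have := h2 u uvs'; rewrite !inE uM cu /= => /allP/(_ v vvs).
by rewrite uv !inE vM -eq cu.
Qed.

Lemma mdis_colouring X A : size X = size vs -> mdis X (mk vs A) ->
  {in vs, forall u, u \in A -> colouring vs X u = false}.
Proof.
move=> sX; rewrite {1}(mk_colouring uvs sX) mdis_mk => /allP h u uvs' uA.
by have := h u uvs'; rewrite inE uA andbT => /negbTE.
Qed.

Lemma bipartiteP M : bipartite l (mk vs M) -> exists f : T -> bool,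
  {in vs &, forall u v, u \in M -> v \in M -> e u v -> f u != f v}.
Proof.
rewrite /bipartite; case: comps => // cs /proper_maskP[_ h].
by eexists; exact: h.
Qed.

Lemma invalidP cs M A : valid l cs (mk vs M) (mk vs A) = false -> exists f : T -> bool,
  {in vs &, forall u v, u \in M -> v \in M -> e u v -> f u != f v} /\ {in vs, forall u, u \in A -> f u = false}.
Proof.
rewrite /valid; case: cs => // cs; case: ifP => // _ /negbFE; rewrite /mono.
case: ifP => // /proper_maskP[sX h] d; exists (colouring vs (colour l cs (mk vs A))); split=> //.
exact: mdis_colouring.
Qed.
End Proper.
End Masks.

(** * Leaf tests on a complete list of the complement *)

Section Complete.
Variables (T : finType) (e : rel T).
Hypothesis g5 : girth5 e.
Let es : symmetric e. Proof. by case: g5. Qed.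
Let ei : irreflexive e. Proof. by case: g5. Qed.
Implicit Types (s : seq T) (A B K : {set T}) (u v w x y : T).
Local Notation nb := (nb e).

Variables (O : {set T}) (line : T -> bool -> {set T}) (private : T -> bool -> bool) (six : T -> bool).
Hypothesis res : residual e O line private six (far e O).
Variable vs : seq T.
Hypotheses (uvs : uniq vs) (vsO : vs =i O).
Local Notation mk := (mk vs).
Local Notation info := (vinfo e vs).
Let l := [seq info v | v <- vs].
Local Notation dg := (deg e O).

Let sl : size l = size vs. Proof. exact: size_map. Qed.
Let full : nseq (size l) true = mk setT. Proof. by rewrite sl mk_setT. Qed.
Let zero : nseq (size l) false = mk set0. Proof. by rewrite sl mk_set0. Qed.

Lemma count_deg v : count (e v) vs = dg v.
Proof.
rewrite /deg -size_filter -(card_uniqP (filter_uniq _ uvs)); apply: eq_card => x.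
by rewrite mem_filter in_setI in_nb vsO.
Qed.

Lemma count_vs A : count (mem A) vs = #|A :&: O|.
Proof.
rewrite -size_filter -(card_uniqP (filter_uniq _ uvs)); apply: eq_card => x.
by rewrite mem_filter in_setI vsO.
Qed.

Lemma farE v u : v \in O -> u \in O -> far e O v u = (u \notin near e vs v).
Proof.
move=> vO uO; rewrite /far /near !in_setU in_set1 in_nb inE !negb_or eq_sym; congr [&& _, _ & _].
apply/forall_inP/hasPn => h z zO /=.
  by rewrite in_nb (es z u); apply: h; rewrite -vsO.
by have := h z; rewrite /= in_nb (es z u); apply; rewrite vsO.
Qed.

Lemma sum_vs A F : A \subset O -> \sum_(v <- vs | v \in A) F v = \sum_(v in A) F v.
Proof.
move=> /subsetP AO; rewrite -big_filter big_uniq ?filter_uniq //=; apply: eq_bigl => x.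
by rewrite mem_filter vsO; case: (boolP (x \in A)) => //= /AO.
Qed.

Lemma bipartiteO M : bipartite l (mk M) -> exists f : T -> bool,
  {in O :&: M &, forall u v, e u v -> f u != f v}.
Proof.
case/(bipartiteP uvs)=> f h; exists f => u v; rewrite !in_setI => /andP[uO uM] /andP[vO vM].
by apply: h; rewrite ?vsO.
Qed.

Lemma mem_O x : x \in O -> x \in vs. Proof. by rewrite vsO. Qed.

Section Lines.
Variables (w : T) (c : bool).
Hypotheses (wO : w \in O) (pw : private w c).
Let L := line w c.
Let LO : {subset L <= O}.
Proof. by move=> x /(subsetP (res_sub res w c)); rewrite in_setD1 => /andP[]. Qed.
Variable cs : option (seq (bitseq * bitseq)).
Let b := wsum (fun d => pow2 d.-1) l (mk (nb w)).

Let pow2E v : v \in O -> pow2 (dg v) = 2 ^ dg v.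
Proof. by move/(res_deg res); case: (dg v) => [|[|[|[|]]]]. Qed.

Lemma bE : b = \sum_(q in nb w :&: O) 2 ^ (dg q).-1.
Proof.
rewrite /b wsum_mk -(@sum_vs (nb w :&: O)) ?subsetIr // big_seq_cond [RHS]big_seq_cond.
apply: eq_big => [v|v /andP[vvs _]]; first by rewrite in_setI -vsO; case: (v \in vs); rewrite ?andbF ?andbT.
have vO : v \in O by rewrite -vsO.
rewrite count_deg; have := res_deg res vO.
by case: (dg v) => [|[|[|[|]]]].
Qed.

Lemma valid_line : valid l cs (mk (setT :\ w)) (mk L).
Proof.
case v: (valid _ _ _ _) => //; have [f [pf fL]] := invalidP uvs v.
have [u [u' [uL uL' ff]]] : exists u u', [/\ u \in L, u' \in L & f u != f u'].
  apply: (res_kick res wO pw) => x y; rewrite !in_setD1 => /andP[xw xO] /andP[yw yO].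
  by apply: pf; rewrite ?mem_O // in_setD1 ?xw ?yw in_setT.
by rewrite (fL u) ?(fL u') ?mem_O ?LO in ff.
Qed.

Local Notation lns := (lines l (mk (setT :\ w)) cs (dg w) b).

Lemma lines_sub s m k forb sum acc : {subset acc <= lns [seq info v | v <- s] m k forb sum acc}.
Proof.
elim: s m k forb sum acc => [|v s IH] m k forb sum acc x xa //=.
case: ifP => _; last exact: IH.
case: ifP => _; first by rewrite inE IH ?orbT.
by apply: (IH); apply: (IH).
Qed.

(** Invariant: [A] is the part of the true line [L] taken so far, and the rest of [L] is still ahead
    and not forbidden. If no earlier prefix is accepted, then [L] itself is, by [res_ge], [res_pot]
    and [res_kick]. *)
Lemma linesP s A k sum acc B : {subset s <= vs} -> A \proper L -> {subset L :\: A <= s} ->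
  {in L :\: A, forall v, v \notin B} -> k = #|A| -> sum = \sum_(v in A) 2 ^ dg v ->
  exists A', [/\ A' \subset L, A' != set0 & mk A' \in lns [seq info v | v <- s] (mk A) k (mk B) sum acc].
Proof.
elim: s A k sum acc B => [|v s IH] A k sum acc B sub pA hs hB ek esum.
  case/properP: pA => _ [x xL xA]; by have := hs x; rewrite in_setD xL xA => /(_ isT).
have sub' : {subset s <= vs} by move=> x xs; apply: sub; rewrite inE xs orbT.
have vvs : v \in vs by apply: sub; rewrite mem_head.
rewrite /= mdis1 //; case: (boolP (v \in L :\: A)) => vLA; last first.
  have [A' [h1 h2 h3]] : exists A', [/\ A' \subset L, A' != set0 & mk A' \in lns [seq info v | v <- s] (mk A) k (mk B) sum acc].
    apply: IH => // x xLA; have := hs x xLA; rewrite inE => /predU1P[xv|//].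
    by rewrite -xv xLA in vLA.
  exists A'; split=> //; case: ifP => // _; case: ifP => _; first by rewrite inE h3 orbT.
  exact: lines_sub.
rewrite hB // mor_mk; move: (vLA); rewrite in_setD => /andP[vA vL].
have vO := LO vL; rewrite count_deg pow2E //.
have sA : A :|: [set v] \subset L.
  by rewrite subUset sub1set vL andbT; case/andP: pA.
have ek' : k.+1 = #|A :|: [set v]| by rewrite setUC cardsU1 vA ek.
have esum' : sum + 2 ^ dg v = \sum_(x in A :|: [set v]) 2 ^ dg x.
  by rewrite setUC big_setU1 //= addnC esum.
case: ifP => [_|acc_no].
  exists (A :|: [set v]); split; rewrite // ?mem_head //.
  by apply/set0Pn; exists v; rewrite in_setU set11 orbT.
case: (eqVneq (A :|: [set v]) L) => [eL|nL].
  exfalso; move/negbT/negP: acc_no; apply; rewrite ek' esum' eL valid_line.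
  case: ltnP => // le; have := res_ge res wO pw; rewrite leq_eqVlt ltnNge le orbF => /eqP es'.
  by rewrite -es' eqxx bE (res_pot res wO pw).
rewrite mor_mk; apply: IH => //.
- by rewrite properEneq nL.
- move=> x; rewrite in_setD in_setU in_set1 negb_or -andbA => /and3P[xA xv xL].
  by have := hs x; rewrite in_setD xA xL inE (negPf xv) => /(_ isT).
- move=> x; rewrite in_setD in_setU in_set1 negb_or -andbA => /and3P[xA xv xL].
  rewrite in_setU negb_or hB ?in_setD ?xA //= -farE ?LO //.
  by apply: (res_far2 res wO pw) => //; rewrite eq_sym.
Qed.

Lemma optionsP : 0 < dg w -> exists A, [/\ A \subset L, A != set0 & mk A \in options l (info w) cs].
Proof.
move=> dw; rewrite /options /= full mdiff_mk setTD /= -/b.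
have -> : ~: [set w] = setT :\ w by apply/setP=> x; rewrite in_setC in_setD1 in_set1 in_setT andbT.
rewrite filter_map zero count_deg; apply: linesP => //.
- by move=> x; rewrite mem_filter => /andP[].
- by rewrite proper0 -card_gt0; apply: leq_trans dw (res_ge res wO pw).
- move=> x; rewrite setD0 mem_filter /= => xL; have xO := LO xL.
  by rewrite mem_O // mdis1 ?mem_O // -farE // (res_far1 res wO pw) .
- by move=> x _; rewrite in_set0.
- by rewrite cards0.
- by rewrite big_set0.
Qed.
End Lines.

Lemma mk_itemP w c : w \in O -> private w c -> 0 < dg w ->
  exists A, [/\ A \subset line w c, A != set0 & mk A \in io (mk_item l (info w))].
Proof. by move=> wO pw; apply: optionsP. Qed.

Lemma ibP w : ib (mk_item l (info w)) -> exists f : T -> bool,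
  {in O :\ w &, forall u v, e u v -> f u != f v}.
Proof.
rewrite /mk_item /= full mdiff_mk => h; have [f pf] : exists f : T -> bool,
  {in O :&: (setT :\: [set w]) &, forall u v, e u v -> f u != f v} by apply: bipartiteO.
exists f => u v; rewrite !in_setD1 => /andP[uw uO] /andP[vw vO]; apply: pf.
  by rewrite in_setI in_setD uO in_set1 uw in_setT.
by rewrite in_setI in_setD vO in_set1 vw in_setT.
Qed.

Lemma line_w w c : w \notin line w c.
Proof. by apply/negP=> /(subsetP (res_sub res w c)); rewrite in_setD1 eqxx. Qed.

Definition chosen (P : {set T}) (ch : seq bitseq) := forall a, a \in ch -> exists v c A,
  [/\ v \in P, v \in O, private v c, A \subset line v c & a = mk (A :|: [set v])].

Lemma le1_line w c v c' A A' : w \in O -> v \in O -> private w c -> private v c' -> (w, c) != (v, c') ->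
  A \subset line w c -> A' \subset line v c' -> le1 (mk (A :|: [set w])) (mk (A' :|: [set v])).
Proof.
move=> wO vO pw pv ne sA sA'; apply: le1_mk.
rewrite (@eq_count _ _ (mem ((A :|: [set w]) :&: (A' :|: [set v])))) => [|x]; last by rewrite /= in_setI.
rewrite count_vs; apply: leq_trans (res_meet res wO vO pw pv ne); apply: subset_leq_card.
apply: subset_trans (subsetIl _ _) _; rewrite ![_ :|: [set _]]setUC; apply: setISS; exact: setUS.
Qed.

Lemma chosen_cons P ch w c A : w \in O -> private w c -> A \subset line w c -> chosen P ch ->
  chosen (w |: P) (mk (A :|: [set w]) :: ch).
Proof.
move=> wO pw sA hc a; rewrite inE => /predU1P[->|/hc[v [c' [A' [vP vO pv sA' ->]]]]].
  by exists w, c, A; rewrite setU11.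
by exists v, c', A'; rewrite in_setU1 vP orbT.
Qed.

Lemma chosenS (P P' : {set T}) ch : P \subset P' -> chosen P ch -> chosen P' ch.
Proof.
by move=> /subsetP sP hc a /hc[v [c' [A' [vP vO pv sA' ->]]]]; exists v, c', A'; rewrite sP.
Qed.

(** The search is followed along the truth: the actual values of [six] and, where a line is chosen,
    a subset of an actual line. Such subsets inherit from [res_meet] that they share at most one
    vertex. *)
Lemma goP ws (P : {set T}) ch : uniq ws -> {in ws, forall w, [/\ w \in O, w \notin P & 2 <= dg w]} ->
  P \subset O -> chosen P ch ->
  go l [seq mk_item l (info w) | w <- ws] ch (mk [set x in P | six x]).
Proof.
elim: ws P ch => //= w ws IH P ch /andP[wws uws] hws PO hc.
have [wO wP d2] := hws w (mem_head _ _).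
have hws' : {in ws, forall w', [/\ w' \in O, w' \notin w |: P & 2 <= dg w']}.
  move=> w' ww'; have [|h1 h2 h3] := hws w'; first by rewrite inE ww' orbT.
  by split=> //; rewrite in_setU1 negb_or h2 andbT; apply: contraNneq wws => <-.
have PO' : w |: P \subset O by rewrite subUset sub1set wO.
have d3 := res_deg res wO; rewrite count_deg.
set o := filter _ _.
have oP c : private w c -> exists A, [/\ A \subset line w c, A != set0 & mk A \in o].
  move=> pw; have [A [sA A0 Ao]] := mk_itemP wO pw (ltnW d2); exists A; split=> //.
  rewrite mem_filter Ao andbT allbE; apply/allP=> a /hc[v [c' [A' [vP vO pv sA' ->]]]].
  rewrite mor_mk; apply: le1_line pw pv _ sA sA' => //.
  by apply: contraNneq wP => -[->].
case s6: (six w); last first.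
  have eS : [set x in P | six x] = [set x in w |: P | six x].
    by apply/setP=> x; rewrite !inE; case: eqVneq => // ->; rewrite s6 andbF.
  rewrite (_ : (if dg w == 3 then _ else _) = true) //.
  case: eqP => dw.
    have [p1 p2 _] := res_three res wO dw (negbT s6).
    have [A1 [s1 n1 o1]] := oP _ p1; have [A2 [s2 n2 o2]] := oP _ p2.
    have dis x : x \in O -> ~~ ((x \in A1) && (x \in A2)).
      move=> xO; apply/negP=> /andP[x1 x2].
      have ne : (w, true) != (w, false) by rewrite xpair_eqE andbF.
      have := res_meet res wO wO p1 p2 ne.
      have h1 := subsetP s1 x x1; have h2 := subsetP s2 x x2.
      have xw : x != w by apply: contraTneq h1 => ->; apply: line_w.
      have : #|[set x; w]| <= #|(w |: line w true) :&: (w |: line w false)|.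
        apply: subset_leq_card; rewrite subUset !sub1set !in_setI !in_setU1.
        by rewrite h1 h2 eqxx !orbT.
      by rewrite cards2 xw; clear; lia.
    (* [two] may come upon the two lines in either order, so both orders are provided for. *)
    have ch2 b : chosen (w |: P) [:: mk ((if b then A1 else A2) :|: [set w]), mk ((if b then A2 else A1) :|: [set w]) & ch].
      have -> : w |: P = w |: (w |: P) by rewrite setUA setUid.
      by case: b; [apply: (chosen_cons wO p1 s1); apply: (chosen_cons wO p2 s2)
                  |apply: (chosen_cons wO p2 s2); apply: (chosen_cons wO p1 s1)].
    apply: (two_mem o1 o2); rewrite ?mor_mk.
    - apply: contraNneq n1 => eA; apply/eqP/setP=> x; rewrite in_set0; apply/negP=> x1.
      have xO : x \in O.
        by have := subsetP (res_sub res w true) x (subsetP s1 x x1); rewrite in_setD1 => /andP[].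
      by case/negP: (dis x xO); rewrite x1 -(mk_mem eA (mem_O xO)) x1.
    - rewrite mdis_mk (_ : all _ _); last by apply/allP=> x; rewrite vsO; apply: dis.
      by rewrite eS; apply: IH => //; apply: (ch2 true).
    - rewrite mdis_mk (_ : all _ _); last by apply/allP=> x; rewrite vsO andbC; apply: dis.
      by rewrite eS; apply: IH => //; apply: (ch2 false).
  have dw2 : dg w = 2 by move: d2 d3 dw; clear; lia.
  have [c pw] := res_two res wO dw2 (negbT s6); have [A [sA _ oA]] := oP c pw.
  rewrite hasbE; apply/hasP; exists (mk A) => //; rewrite mor_mk eS; apply: IH => //.
  exact: chosen_cons pw sA hc.
case: ifP => // _.
have m1 := res_match res wO s6.
have sn1 : #|nb w :&: [set x in P | six x]| <= 1.
  by apply: leq_trans m1; apply: subset_leq_card; apply/subsetP=> x; rewrite !inE => /and3P[-> _ ->].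
rewrite mand_mk mcount_mk count_vs (leq_trans _ sn1) ?subset_leq_card ?subsetIl //.
have -> : map vr l = [seq mk (nb a) | a <- vs] by rewrite -map_comp.
(* Otherwise a vertex marked by [six] would have two marked neighbours, [w] and [x]. *)
rewrite zero munion_mk mdis_mk set0U (_ : all _ _); last first.
  apply/allP=> x _; apply/negP; rewrite [_ \in nbl _ _ _]inE => /andP[/hasP[a _ /andP[]]].
  rewrite !inE => /and3P[wa aP a6] ax /andP[xP x6].
  have xw : x != w by apply: contraNneq wP => <-.
  have := res_match res (subsetP PO a aP) a6.
  have : #|[set x; w]| <= #|[set u in nb a | six u]|.
    by apply: subset_leq_card; rewrite subUset !sub1set !inE ax x6 (es a w) wa s6.
  by rewrite cards2 xw; clear; lia.
have eS : [set x in P | six x] :|: [set w] = [set x in w |: P | six x].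
  by apply/setP=> x; rewrite !inE; case: eqVneq => [->|]; rewrite ?s6 ?orbT ?orbF.
rewrite mor_mk eS; case: eqP => dw; last first.
  by apply: IH => //; apply: chosenS hc; apply: subsetUr.
have [c pw hf] := res_six res wO dw; have [A [sA _ oA]] := oP c pw.
rewrite hasbE; apply/hasP; exists (mk A) => //.
have fp : ib (mk_item l (info w)) -> farpair l (mdiff (nseq (size l) true) (mk (near e vs w))) (mk A).
  case/ibP=> f pf; have [u [u' [uL uL' fu fu' fuu]]] := hf f pf.
  have inA x : x \in O :\: line w c -> x \in O /\ x \notin A.
    rewrite in_setD => /andP[xL xO]; split=> //; apply: contra xL; exact: (subsetP sA).
  have [uO uA] := inA _ uL; have [uO' uA'] := inA _ uL'.
  rewrite /farpair full !mdiff_mk hasbE has_map; apply/hasP; exists u; rewrite /= ?mem_O //.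
  rewrite mdis1 ?mem_O // !in_setD in_setT uA -farE // fu /=.
  rewrite mdiff_mk mdis_mk; apply/allPn; exists u'; first exact: mem_O.
  by rewrite negbK !in_setD in_setT uA' -!farE // fu' fuu.
rewrite mor_mk; case: ifP => [_|/negP[]]; last by rewrite -zero; case: ifP => // h; apply: fp.
by apply: IH => //; apply: chosen_cons pw sA hc.
Qed.

Lemma itemsP d s : 2 <= d <= 3 -> {subset s <= vs} ->
  items l d [seq info v | v <- s] = Some [seq mk_item l (info w) | w <- s & dg w == d].
Proof.
move=> d23; elim: s => //= v s IH sub; have vO : v \in O by rewrite -vsO sub ?mem_head.
have sub' : {subset s <= vs} by move=> x xs; apply: sub; rewrite inE xs orbT.
rewrite count_deg IH //; case: eqP => [dv|//]; rewrite (_ : match _ with [::] => _ | _ => _ end = false) //.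
case: eqP => [d3|]; last by case: (options _ _ _).
have [c pw _] := res_six res vO (etrans dv d3).
have [|A [_ _]] := mk_itemP vO pw; first by rewrite dv; case/andP: d23; clear; lia.
by rewrite /=; case: (options _ _ _).
Qed.

Lemma csp_true : csp l.
Proof.
have sub : {subset vs <= vs} by [].
have P0 : mk set0 = mk [set x in set0 | six x] by apply: eq_mk => x _; rewrite !inE.
have gow ws : uniq ws -> {in ws, forall w, w \in O /\ 2 <= dg w} ->
    go l [seq mk_item l (info w) | w <- ws] [::] (mk set0).
  move=> uws h; rewrite P0; apply: goP => //; last exact: sub0set.
  by move=> w /h[wO d]; rewrite in_set0.
rewrite /csp zero !itemsP // -map_cat !gow //.
- rewrite cat_uniq !filter_uniq // andbT; apply/hasPn=> x; rewrite !mem_filter => /andP[/eqP-> _].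
  by rewrite andFb.
- by move=> x; rewrite mem_cat !mem_filter -!vsO => /orP[]/andP[/eqP-> ->].
- exact: filter_uniq.
- by move=> x; rewrite !mem_filter -!vsO => /andP[/eqP-> ->].
Qed.

Hypothesis no_pentagon : pentagon_free e O (far e O).

Lemma choicesP cs X p : choices cs X p -> exists X', p X'.
Proof. by elim: cs X => [|[a b] cs IH] X /=; [exists X|case: ifP => [/IH//|_ /IH]]. Qed.

Lemma cross_mk s A B : cross [seq info v | v <- s] [seq x \in A | x <- s] (mk B) =
  \sum_(v <- s | v \in A) #|(B :\: nb v) :&: O|.
Proof.
elim: s => [|v s IH] /=; rewrite ?big_nil // big_cons IH; case: ifP => // _.
by rewrite mdiff_mk mcount_mk count_vs.
Qed.

Lemma pentagonN : ~ pentagon l.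
Proof.
rewrite /pentagon hasbE has_map => /hasP[v vvs] /=; set K := near e vs v.
rewrite mcount_mk count_vs; case: eqP => // cK; rewrite allbE all_map; case: ifP => // /allP hK.
case: comps => // cs /choicesP[X]; rewrite full mdiff_mk; case: ifP => // /(proper_maskP uvs)[sX pX].
set C := [set x | colouring vs X x].
rewrite (mk_colouring uvs sX) -/C mand_mk mdiff_mk cross_mk => hc.
pose K' := K :&: O.
have nearK u : u \in K' -> {in O, forall x, (x \in near e vs u) = (x \in K)} /\
    exists g : T -> bool, {in K' :\ u &, forall x y, e x y -> g x != g y}.
  rewrite in_setI => /andP[uK uO]; have := hK u (mem_O uO); rewrite /= mdis1 ?mem_O // uK /=.
  case: ifP => // /meqP; rewrite !size_mk => /(_ erefl) eK; rewrite mdiff_mk => /bipartiteO[g pg].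
  split=> [x xO|]; first exact: mk_mem eK (mem_O xO).
  exists g => x y; rewrite !in_setD1 !in_setI => /and3P[xu xK xO] /and3P[yu yK yO].
  by apply: pg; rewrite in_setI in_setD in_set1 ?xO ?xu ?xK ?yO ?yu ?yK.
have inO x : x \in O :\: K' -> x \in O /\ x \notin K.
  by rewrite in_setD in_setI negb_and => /andP[+ xO]; rewrite xO orbF.
apply: (no_pentagon (K := K') (f := colouring vs X)) => //.
- exact: subsetIr.
- move=> u x uK xO ux; have [h _] := nearK u uK; rewrite in_setI xO andbT -h //.
  by rewrite /near !in_setU in_nb ux orbT.
- move=> u x uK xK; have [h _] := nearK u uK; move: uK xK; rewrite !in_setI => /andP[_ uO] /andP[xK xO].
  by rewrite farE // negbK h.
- by move=> u uK; case: (nearK u uK).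
- by move=> x y /inO[xO xK] /inO[yO yK]; apply: pX; rewrite ?mem_O // in_setD in_setT ?xK ?yK.
have KO x : (x \in O :\: K') = (x \in O) && (x \notin K).
  by rewrite in_setD in_setI negb_and andb_orl andNb orbF andbC.
apply: leq_trans hc; rewrite -big_filter big_uniq ?filter_uniq //=.
pose P a := (a \in O :\: K') && colouring vs X a.
pose Q a b := [&& b \in O :\: K', ~~ colouring vs X b & ~~ e a b].
rewrite -sum1_card (eq_bigl (fun p => P p.1 && Q p.1 p.2)); last first.
  move=> p; rewrite inE /P /Q -!andbA; congr (_ && _).
  by case: (p.2 \in _); rewrite ?andbF.
rewrite -(pair_big_dep P Q (fun _ _ => 1)) /= leq_eqVlt; apply/orP; left; apply/eqP.
apply: eq_big => [a|a _].
  rewrite /P KO mem_filter in_setI in_setD in_setT vsO [a \in C]inE.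
  by case: (a \in O) (a \in K) (colouring vs X a) => [] [] [].
rewrite sum1_card; apply: eq_card => b.
rewrite unfold_in /Q KO in_setI !in_setD in_nb in_setT [b \in C]inE.
by case: (b \in O) (b \in K) (colouring vs X b) (e a b) => [] [] [] [].
Qed.

Lemma leafN : ~ leaf l.
Proof.
rewrite /leaf csp_true; case: ifP => [|_ /pentagonN//].
rewrite full => /bipartiteO[f pf] _; apply: (res_odd res (f := f)) => u v uO vO.
by apply: pf; rewrite in_setI in_setT andbT.
Qed.
End Complete.

Lemma last_map_ne (A B : Type) (f : A -> B) d' d s : s <> [::] -> last d' (map f s) = f (last d s).
Proof. by case: s => //= x s _; rewrite last_map. Qed.

(** * Completeness of the ordered enumeration *)

Section Search.
Variables (T : finType) (e : rel T).
Hypothesis g5 : girth5 e.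
Let es : symmetric e. Proof. by case: g5. Qed.
Let ei : irreflexive e. Proof. by case: g5. Qed.
Let tri x y z : e x y -> e y z -> e x z = false. Proof. by case: g5 => _ _ + _; apply. Qed.
Let C4 x z y t : x != z -> e x y -> e z y -> e x t -> e z t -> y = t.
Proof. by case: g5 => _ _ _; apply. Qed.
Implicit Types (s vs : seq T) (A B K : {set T}) (u v w x y : T).
Local Notation nb := (nb e).

Lemma extend_mk vs x : uniq (x :: vs) ->
  extend [seq vinfo e vs v | v <- vs] (mk vs (nb x)) = [seq vinfo e (x :: vs) v | v <- x :: vs].
Proof.
move=> ux; rewrite -(infos_mk e ux) /extend !size_map.
suff -> : (false :: mk vs (nb x)) :: [seq p.1 :: p.2 | p <- zip (mk vs (nb x)) (map vr [seq vinfo e vs v | v <- vs])]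
   = [seq mk (x :: vs) (nb v) | v <- x :: vs] by [].
rewrite /= in_nb ei; congr (_ :: _); rewrite -map_comp /mk /=.
elim: {1 3 5}vs => //= v s ->; by rewrite !in_nb es.
Qed.

Lemma gen_mk vs s x B k : {subset s <= vs} -> uniq s -> x \notin vs -> k <= 3 ->
  {in s, forall u, e x u -> count (e u) vs < 3} -> count (e x) s <= k ->
  {in s, forall u, e x u -> u \notin B} ->
  [seq u \in nb x | u <- s] \in gen [seq vinfo e vs u | u <- s] (mk vs B) k.
Proof.
move=> + + xvs; elim: s B k => //= v s IH B k sub /andP[vs' us] k3 hd hc hB.
have vvs : v \in vs by apply: sub; rewrite mem_head.
have sub' : {subset s <= vs} by move=> u us'; apply: sub; rewrite inE us' orbT.
have hd' : {in s, forall u, e x u -> count (e u) vs < 3} by move=> u us' xu; apply: hd; rewrite // inE us' orbT.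
have hB' : {in s, forall u, e x u -> u \notin B} by move=> u us' xu; apply: hB; rewrite // inE us' orbT.
have cons_mem b (Z : bitseq) (l : seq bitseq) : Z \in l -> b :: Z \in [seq b :: Z | Z <- l].
  by move=> Zl; apply/mapP; exists Z.
rewrite in_nb mdis1 //; case xv: (e x v) hc => /= hc; last first.
  have h : false :: [seq u \in nb x | u <- s] \in [seq false :: Z | Z <- gen [seq vinfo e vs u | u <- s] (mk vs B) k].
    by apply: cons_mem; apply: IH.
  do 2?[case: ifP => _ //]; case: k {IH k3 hc} h => // k h; by rewrite mem_cat h.
rewrite hB ?mem_head // hd ?mem_head //; case: k k3 hc => // k k3; rewrite add1n ltnS => hc.
rewrite mem_cat; apply/orP; right; apply: cons_mem; rewrite mor_mk; apply: IH => //; first exact: ltnW.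
move=> u us' xu; have uv : u != v by apply: contraNneq vs' => <-.
rewrite in_setU negb_or hB' //= /near !in_setU in_set1 (negPf uv) in_nb [_ \in nbl _ _ _]inE /= negb_or.
apply/andP; split; first by apply/negP=> vu; move: (tri xv vu); rewrite xu.
apply/hasPn=> a avs /=; rewrite in_nb; apply/negP=> /andP[va au].
have := C4 uv (z := v) (y := x) (t := a); rewrite !(es _ x) => /(_ xu xv); rewrite (es u a) => /(_ au va) h.
by rewrite h avs in xvs.
Qed.

Fixpoint weight (a : bitseq) : nat := if a is x :: a' then x + 2 * weight a' else 0.
Lemma cmpP a b : size a = size b -> match cmp a b with Gt => weight b < weight a | Lt => weight a < weight b
  | Eq => weight a = weight b end.
Proof.
elim: a b => [|x a IH] [|y b] //= [/IH]; case: (cmp a b) ; case: x y => [] []; lia.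
Qed.

(** The last bit, that of the oldest vertex, outweighs all others together; hence its neighbours in
    [O] are listed before any other vertex. *)
Lemma weight_last a b : size a = size b -> last false a -> ~~ last false b -> weight b < weight a.
Proof.
elim: a b => [|x [|x' a] IH] [|y b] // [sab] la lb.
  by case: b sab lb => //= _; move: la => /= ->; case: y.
case: b sab lb => [|y' b] // sab lb; have := IH (y' :: b) sab la lb.
rewrite -[weight (y :: _)]/(y + 2 * weight (y' :: b)) -[weight (x :: _)]/(x + 2 * weight (x' :: a)).
by case: y lb => _; lia.
Qed.

Variables (O : {set T}) (line : T -> bool -> {set T}) (private : T -> bool -> bool) (six : T -> bool).
Hypothesis res : residual e O line private six (far e O).
Hypothesis no_pentagon : pentagon_free e O (far e O).
Variable r : T.
Hypotheses (rO : r \in O) (rmax : {in O, forall v, deg e O v <= deg e O r}).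

Lemma count_le_deg vs v : uniq vs -> {subset vs <= O} -> count (e v) vs <= deg e O v.
Proof.
move=> uvs sub; rewrite -size_filter -(card_uniqP (filter_uniq _ uvs)) /deg.
by apply/subset_leq_card/subsetP=> x; rewrite mem_filter in_setI in_nb => /andP[-> /sub].
Qed.

Lemma sum_le vs A F G : uniq vs -> {subset vs <= O} -> (forall v, F v <= G v) ->
  \sum_(v <- vs | v \in A) F v <= \sum_(q in A :&: O) G q.
Proof.
move=> uvs sub FG; rewrite -big_filter big_uniq ?filter_uniq //=.
rewrite big_mkcond [X in _ <= X]big_mkcond /=; apply: leq_sum => v _.
by rewrite mem_filter in_setI; case: (v \in A) => //=; case: (boolP (v \in vs)) => [/sub->|].
Qed.

Lemma plausible_mk vs : uniq vs -> {subset vs <= O} -> last r vs = r -> vs <> [::] ->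
  (e (head r vs) r \/ {in O, forall v, e r v -> v \in vs}) ->
  plausible [seq vinfo e vs v | v <- vs].
Proof.
move=> uvs sub lr n0 near_r; rewrite /plausible.
have big v : v \in vs -> count (e v) vs = 3 -> deg e O v = 3.
  move=> vvs c3; have := count_le_deg v uvs sub; have := res_deg res (sub v vvs); rewrite c3; clear; lia.
have wle v : wsum id [seq vinfo e vs v | v <- vs] (mk vs (nb v)) <= \sum_(q in nb v :&: O) deg e O q.
  by rewrite wsum_mk; apply: sum_le => // u; apply: count_le_deg.
have c1 : (if last false (head [::] (map vr [seq vinfo e vs v | v <- vs])) then true else
    allb (fun i => vd i <= vd (last (Vtx [::] [::] 0 [::]) [seq vinfo e vs v | v <- vs]))
    [seq vinfo e vs v | v <- vs]).
  rewrite (@last_map_ne _ _ _ _ r) // lr.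
  have -> : head [::] (map vr [seq vinfo e vs v | v <- vs]) = mk vs (nb (head r vs)).
    by case: {1 3 5}vs n0.
  rewrite (@last_map_ne _ _ _ _ r) // lr in_nb.
  case: ifP => // h; rewrite allbE all_map; apply/allP=> v vvs /=.
  apply: leq_trans (count_le_deg v uvs sub) _; apply: leq_trans (rmax (sub v vvs)) _.
  case: near_r => [|hr]; first by rewrite h.
  rewrite /deg -size_filter -(card_uniqP (filter_uniq _ uvs)); apply/subset_leq_card/subsetP=> x.
  by rewrite in_setI in_nb mem_filter => /andP[rx xO]; rewrite rx hr.
rewrite c1 allbE all_map (_ : all _ vs); last first.
  apply/allP=> v vvs /=; case: eqP => // /(big v vvs) d3.
  by apply: leq_trans (wle v) (res_sum res (sub v vvs) d3).
set S := [set v | (count (e v) vs == 3) && (5 < wsum id [seq vinfo e vs v | v <- vs] (mk vs (nb v)))].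
have -> : [seq (if vd i == 3 then 5 < wsum id [seq vinfo e vs v | v <- vs] (vr i) else false)
    | i <- [seq vinfo e vs v | v <- vs]] = mk vs S.
  by rewrite -map_comp; apply: eq_map => v /=; rewrite inE; case: (_ == 3).
have S6 v : v \in vs -> v \in S -> six v.
  move=> vvs; rewrite inE => /andP[/eqP/(big v vvs) d3 w5]; apply: contraTT w5 => n6.
  have [_ _ h] := res_three res (sub v vvs) d3 n6.
  by rewrite -leqNgt; apply: leq_trans (wle v) h.
rewrite allbE all_map; apply/allP=> v vvs /=; rewrite mdis1 //; case: (boolP (v \in S)) => //= vS.
rewrite mand_mk mcount_mk -size_filter -(card_uniqP (filter_uniq _ uvs)).
apply: leq_trans (res_match res (sub v vvs) (S6 v vvs vS)).
apply/subset_leq_card/subsetP=> x; rewrite mem_filter => /andP[/setIP[vx xS] xvs].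
by rewrite inE vx S6.
Qed.

(** The search is followed along the list that always takes an unlisted vertex [x] of maximal
    weight. By the maximality of the previous choice, the vector of [x] without the newest vertex
    does not exceed [lst], so this branch is never pruned. It ends with all of [O] listed, where
    [leaf] fails by [leafN]. *)
Lemma searchP k vs lst : uniq vs -> {subset vs <= O} -> last r vs = r -> vs <> [::] ->
  #|O| <= size vs + k ->
  {in O, forall x, x \notin vs -> weight (mk (behead vs) (nb x)) <= weight lst} ->
  size lst = (size vs).-1 -> ~ search k [seq vinfo e vs v | v <- vs] lst.
Proof.
elim: k vs lst => [|k IH] vs lst uvs sub lr n0 cO hmax slst /=.
  case: ifP => // lf _; apply: (leafN g5 res uvs _ no_pentagon lf) => x.
  apply/idP/idP => [/sub//|xO].
  have : #|[set x in vs]| = #|O|.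
    apply/eqP; rewrite eqn_leq subset_leq_card; last by apply/subsetP=> y; rewrite inE => /sub.
    by rewrite cardsE (card_uniqP uvs) -(addn0 (size vs)).
  have /eqVproper[eq|/proper_card] : [set x in vs] \subset O by apply/subsetP=> y; rewrite inE => /sub.
    by rewrite -eq inE in xO.
  by rewrite ltn_neqAle => /andP[/eqP].
case: ifP => // lf; rewrite allbE => /allP hall.
case: (boolP [exists x in O, x \notin vs]) => [ex|]; last first.
  rewrite negb_exists_in => /forall_inP h; apply: (leafN g5 res uvs _ no_pentagon lf) => x.
  by apply/idP/idP => [/sub//|/h]; rewrite negbK.
have [x0 x0P] : exists x, (x \in O) && (x \notin vs) by case/exists_inP: ex => x xO xvs; exists x; rewrite xO.
case: (@arg_maxnP _ x0 (fun x => (x \in O) && (x \notin vs)) (fun x => weight (mk vs (nb x))) x0P) => x /andP[xO xvs] xmax.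
have ux : uniq (x :: vs) by rewrite /= xvs.
have subx : {subset x :: vs <= O} by move=> y; rewrite inE => /predU1P[->|/sub].
have d3 v : v \in O -> count (e v) (x :: vs) <= 3.
  by move=> vO; apply: leq_trans (count_le_deg v ux subx) (res_deg res vO).
have inZ : mk vs (nb x) \in gen [seq vinfo e vs v | v <- vs] (nseq (size [seq vinfo e vs v | v <- vs]) false) 3.
  rewrite size_map -mk_set0; apply: gen_mk => //.
  - move=> u uvs' xu; have := d3 u (sub u uvs'); by rewrite /= es xu.
  - by have := d3 x xO; rewrite /= ei.
  - by move=> u _ _; rewrite in_set0.
have := hall _ inZ; rewrite extend_mk //.
have notGt (a b : bitseq) : size a = size b -> weight a <= weight b -> cmp a b <> Gt.
  by move=> sab; have := cmpP sab; case: (cmp a b) => //; rewrite ltnNge => /negP h /h.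
have eZ : behead (mk vs (nb x)) = mk (behead vs) (nb x) by case: (vs).
have := notGt (mk (behead vs) (nb x)) lst; rewrite size_mk size_behead slst => /(_ erefl (hmax x xO xvs)).
have pl : plausible [seq vinfo e (x :: vs) v | v <- x :: vs].
  apply: plausible_mk => //; first by case: (vs) n0 lr => //= v s _.
  case xr: (e x r); [by left|right=> v vO rv; rewrite inE].
  case: (boolP (v \in vs)) => vvs; rewrite ?orbT // orbF.
  have := xmax v; rewrite vO vvs /= => /(_ isT); rewrite leqNgt => /negP[].
  by apply: weight_last; rewrite ?size_mk // (@last_map_ne _ _ _ _ r) // lr in_nb ?xr // es.
have ns : ~ search k [seq vinfo e (x :: vs) v | v <- x :: vs] (mk vs (nb x)).
  apply: IH => //=; rewrite ?size_mk //.
  - by case: (vs) n0 lr => //= v s _.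
  - by rewrite addSnnS.
  - by move=> y yO; rewrite inE negb_or => /andP[_ yvs]; apply: xmax; rewrite yO.
by rewrite eZ; case: (cmp _ _) => // _; rewrite pl => /ns.
Qed.
End Search.

(** Eleven vertices may follow the first one, as [O] has at most 12. *)
Lemma search_ok : search 11 start [::].
Proof. vm_cast_no_check (erefl true). Qed.

(** * Four colours suffice up to 28 vertices *)

Lemma colorable4P (T : finType) (e : rel T) :
  reflect (exists c : T -> nat, (forall x, c x < 4) /\ forall x y, e x y -> c x != c y) (colorable e 4).
Proof.
apply: (iffP existsP) => [[c /forallP h]|[c [c4 h]]].
  exists (fun x => c x : nat); split=> [x|x y]; first exact: ltn_ord.
  exact: (implyP (forallP (h x) y)).
exists [ffun x => Ordinal (c4 x)]; apply/forallP=> x; apply/forallP=> y; apply/implyP=> /h.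
by rewrite !ffunE.
Qed.

Lemma colour_vertex (T : finType) (e : rel T) v : girth5 e -> deg e setT v <= 3 ->
  colorable (fun x y : {x : T | x != v} => e (val x) (val y)) 4 -> colorable e 4.
Proof.
case=> es ei _ _ dv /colorable4P[c [c4 hc]].
pose col k x := if insub x is Some x' then c x' else k.
have colE k x (xv : x != v) : col k x = c (exist _ x xv) by rewrite /col insubT.
set N := [seq col 4 u | u <- enum (nb e v)].
have [k k4 kN] : exists2 k, k < 4 & k \notin N.
  case: (boolP (all (mem N) (iota 0 4))) => [/allP /(uniq_leq_size (iota_uniq 0 4))|/allPn[k k4 kN]].
    by rewrite size_map -cardE; move: dv; rewrite /deg setIT size_iota; clear; lia.
  by exists k; rewrite // mem_iota in k4.
apply/colorable4P; exists (col k); split=> [x|x y xy].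
  by rewrite /col; case: insub.
have free u : e v u -> col k u != k.
  move=> vu; have uv : u != v by apply: contraTneq vu => ->; rewrite ei.
  apply: contraNneq kN => <-; rewrite colE -(colE 4); apply: map_f; by rewrite mem_enum in_nb.
have colv : col k v = k by rewrite /col insubF ?eqxx.
case: (eqVneq x v) => [xv|xv]; first by rewrite xv colv eq_sym free // -xv.
case: (eqVneq y v) => [yv|yv]; first by rewrite yv colv free // es -yv.
by rewrite !colE; apply: hc.
Qed.

Lemma girth5_sub (T : finType) (e : rel T) (P : pred T) : girth5 e ->
  girth5 (fun x y : {x : T | P x} => e (val x) (val y)).
Proof.
case=> es ei tri C4; split=> [x y|x|x y z|x z y t xz xy zy xt zt] //.
  exact: tri.
by apply/val_inj; apply: C4 xy zy xt zt.
Qed.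

(** A vertex of degree at most 3 is removed by induction and coloured last; this provides the
    minimum degree 4 used before. *)
Lemma four_colours n (T : finType) (e : rel T) : girth5 e -> #|T| <= n -> n <= 28 -> colorable e 4.
Proof.
elim: n T e => [|n IH] T e g5 cT n28.
  apply/colorable4P; exists (fun=> 0); split=> // x; have := max_card (pred1 x).
  by rewrite card1; move: cT; clear; lia.
case: (boolP [exists v, deg e setT v <= 3]) => [/existsP[v dv]|].
  apply: (colour_vertex g5 dv); apply: (IH _ _ (girth5_sub _ g5)); last exact: ltnW.
  have -> : #|{: {x : T | x != v}}| = #|T|.-1 by rewrite card_sig -(cardC1 v).
  by rewrite -ltnS prednK //; apply/card_gt0P; exists v.
rewrite negb_exists => /forallP d4'; have d4 v : 4 <= deg e setT v by rewrite ltnNge d4'.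
case: (boolP (colorable e 4)) => // nc; exfalso.
have not4 (c : T -> nat) : (forall x, c x < 4) -> exists x y, e x y /\ c x = c y.
  move=> c4; case: (boolP [exists x, exists y, e x y && (c x == c y)]) => [/existsP[x /existsP[y /andP[xy /eqP]]]|].
    by exists x, y.
  rewrite negb_exists => /forallP h; case/negP: nc; apply/colorable4P; exists c; split=> // x y xy.
  by have := h x; rewrite negb_exists => /forallP/(_ y); rewrite xy.
have c28 : #|T| <= 28 by apply: leq_trans cT n28.
have [I0 [p0 c0]] := ex_pair g5 c28 d4.
have [I [pI mI cI]] := ex_minimal p0.
have c12 : #|rest I| <= 12 by apply: leq_trans cI c0.
have res := residual_rest g5 pI mI not4 d4 c28 c12.
have [r0 r0O] : exists r, r \in rest I.
  apply/set0Pn/negP=> /eqP O0; apply: (res_odd res (f := fun=> true)) => u v.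
  by rewrite O0 in_set0.
case: (@arg_maxnP _ r0 (mem (rest I)) (fun v => deg e (rest I) v) r0O) => r rO rmax.
have pent := rest_pentagon_free g5 pI not4.
have [] : ~ search 11 [seq vinfo e [:: r] v | v <- [:: r]] [::].
  by apply: (searchP g5 res pent (r := r)) => // x; rewrite inE => /eqP->.
rewrite (_ : map _ _ = start) ?search_ok //.
case: g5 => _ ei _ _.
by rewrite /start /= /vinfo /mk /near /nbl /= in_set1 eqxx in_nb ei !in_setU in_set1 eqxx.
Qed.

Theorem theorem3 (T : finType) (e : rel T) :
  simple_graph e ->
  chromatic_number e = 5 ->
  girth_at_least e 5 ->
  29 <= #|T|.
Proof.
move=> sg chi g; rewrite leqNgt; apply/negP=> lt.
have c4 := four_colours (girth5P sg g) (leqnn _) lt.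
move: chi; rewrite /chromatic_number; case: ex_minnP => m _ /(_ 4); rewrite /chi_pred c4 => /(_ isT).
by move=> le eq; rewrite eq in le.
Qed.
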